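(* Let $\Sigma$ be a Riemann surface and $X:\Sigma\to\mathbb{R}^3$ an immersion whose Gaussian curvature is nowhere zero and whose unit normal (Gauss map) takes values in $\mathbb{S}^2\setminus\{(0,0,-1)\}$. Then $X(\Sigma)$ is an SS-surface if and only if there are holomorphic functions $f,g$ of a complex parameter $z=u_1+iu_2$ (defined locally, with values in $\mathbb{C}$), with $g'\neq 0$, such that $X(\Sigma)$ is locally parameterized by $$X=\frac{e^{\langle 1,f\rangle}}{2|g'|^2}\bigl(Tg'\overline{f'}-2g\langle g',gf'\rangle,\;-2\langle g',gf'\rangle\bigr)+e^{\langle 1,f\rangle}\,\frac{(2g,\,2-T)}{T},\qquad T=1+|g|^2,$$ with normal Gauss map $N=\frac{(2g,\,2-T)}{T}$. The regularity condition is $P=\det V=\frac1K\neq 0$, where $V=(V_{ij})_{1\le i,j\le 2}$ is the matrix defined in the context. Moreover, with $h=e^{\langle 1,f\rangle}$ and $\xi=f'\left(\frac{g''}{g'}-\frac{2}{T}g'\overline{g}\right)-f''$, the coefficients of the first and second fundamental forms of $X$ are $$\langle X_{,1},X_{,1}\rangle=\frac{T^2h^2}{4|g'|^2}\left((\langle 1,f'\rangle^2-\langle 1,\xi\rangle)^2+\left\langle i,\xi-\tfrac{f'^2}{2}\right\rangle^2\right)+2h^2(\langle 1,f'\rangle^2-\langle 1,\xi\rangle)+\frac{4h^2|g'|^2}{T^2},$$ $$\langle X_{,1},X_{,2}\rangle=\left(\frac{T^2h^2|f'|^2}{4|g'|^2}+2h^2\right)\left\langle i,\xi-\tfrac{f'^2}{2}\right\rangle,$$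 $$\langle X_{,2},X_{,2}\rangle=\frac{T^2h^2}{4|g'|^2}\left((\langle 1,if'\rangle^2+\langle 1,\xi\rangle)^2+\left\langle i,\xi-\tfrac{f'^2}{2}\right\rangle^2\right)+2h^2(\langle 1,if'\rangle^2+\langle 1,\xi\rangle)+\frac{4h^2|g'|^2}{T^2},$$ $$\langle X_{,1},N_{,1}\rangle=h(\langle 1,f'\rangle^2-\langle 1,\xi\rangle)+\frac{4h|g'|^2}{T^2},\qquad \langle X_{,1},N_{,2}\rangle=h\left\langle i,\xi-\tfrac{f'^2}{2}\right\rangle,$$ $$\langle X_{,2},N_{,2}\rangle=h(\langle 1,if'\rangle^2+\langle 1,\xi\rangle)+\frac{4h|g'|^2}{T^2}.$$
   Context: Notation: for complex numbers $a,b$, $\langle a,b\rangle=\operatorname{Re}(a\overline b)$ is the Euclidean inner product of $\mathbb{R}^2=\mathbb{C}$, so $\langle 1,w\rangle=\operatorname{Re}w$ and $\langle i,w\rangle=\operatorname{Im}w$; $\mathbb{R}^3$ is identified with $\mathbb{C}\times\mathbb{R}$; $\langle\cdot,\cdot\rangle$ also denotes the Euclidean inner product of $\mathbb{R}^3$. A subscript $,i$ denotes the partial derivative with respect to $u_i$; primes denote complex derivatives. Curvatures: for a local parametrization $X$ with unit normal $N$, the Weingarten matrix $W$ is defined by $N_{,i}=\sum_j W_{ij}X_{,j}$, and $H=-\frac12\operatorname{tr}W$, $K=\det W$ are the mean and Gaussian curvatures. The second fundamental form is taken with the sign convention $\langle X_{,i},N_{,j}\rangle$. SS-surface: let $\Sigma\subset\mathbb{R}^3$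 be a surface oriented by a unit normal $N$ with nowhere zero Gaussian curvature, and let $\psi(p)=\langle p,N(p)\rangle$ (support function) and $\Lambda(p)=\langle p,p\rangle$ (quadratic distance function). $\Sigma$ is a surface of spherical type via support function (SS-surface) if for each $p\in\Sigma$ the sphere with center $p+\left(\frac{H(p)}{K(p)}+\frac{\psi(p)}{2}\right)N(p)$ and radius $\frac{H(p)}{K(p)}+\frac{\psi(p)}{2}$ passes through the origin; that is, $2\psi H+(\Lambda+\psi^2)K=0$ on $\Sigma$. (This condition does not depend on the choice of orientation.) Matrix $V$: put $L_{11}=L_{22}=\frac{4|g'|^2}{T^2}$, $L_{12}=L_{21}=0$ (so $L_{ij}=\langle N_{,i},N_{,j}\rangle$), let $\Gamma_{ij}^k$ be the Christoffel symbols of the metric $(L_{ij})$, and with $h=e^{\langle 1,f\rangle}$ set $V_{ij}=\frac{1}{L_{jj}}\left(h_{,ij}-\sum_{k=1}^2h_{,k}\Gamma_{ij}^k+hL_{ij}\delta_{ij}\right)$.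
   Formalization: The SS side of the equivalence also requires the support function ⟨X,N⟩ to be positive everywhere: the displayed X forces ⟨X,N⟩ = e^{⟨1,f⟩} > 0, and the unit sphere minus a point with inner normal X = −N is an SS-surface with ⟨X,N⟩ = −1, so the printed ''only if'' fails. *)

(* Defs.v *)
(* Classical reals of the standard library, with Coquelicot for derivatives and
   complex numbers ([C] is [R * R]). *)
From Stdlib Require Import Reals ClassicalEpsilon Lra.
From Coquelicot Require Import Coquelicot.
Open Scope R_scope.

(** ** R^3 identified with C x R *)

Definition R3 : Type := (C * R)%type.

Definition ipC (a b : C) : R := Re (a * Cconj b)%C.
Definition ip3 (p q : R3) : R := ipC (fst p) (fst q) + snd p * snd q.

Definition origin3 : R3 := (RtoC 0, 0).
Definition plus3 (p q : R3) : R3 := ((fst p + fst q)%C, snd p + snd q).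
Definition scal3 (t : R) (p : R3) : R3 := ((RtoC t * fst p)%C, t * snd p).
Definition minus3 (p q : R3) : R3 := plus3 p (scal3 (-1) q).

(** ** Calculus in the real coordinates u1, u2 of z = u1 + i u2 *)

Inductive axis := ax1 | ax2.

Definition sum_axis (F : axis -> R) : R := F ax1 + F ax2.
Definition delta (i j : axis) : R :=
  match i, j with ax1, ax1 | ax2, ax2 => 1 | _, _ => 0 end.

Definition mat2 : Type := axis -> axis -> R.
Definition tr2 (A : mat2) : R := A ax1 ax1 + A ax2 ax2.
Definition det2 (A : mat2) : R :=
  A ax1 ax1 * A ax2 ax2 - A ax1 ax2 * A ax2 ax1.
Definition inv2 (A : mat2) : mat2 := fun i j =>
  match i, j with
  | ax1, ax1 => A ax2 ax2 / det2 A
  | ax2, ax2 => A ax1 ax1 / det2 A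
  | _, _ => - A i j / det2 A
  end.

Definition pd (i : axis) (F : C -> R) (z : C) : R :=
  match i with
  | ax1 => Derive (fun t => F (t, Im z)) (Re z)
  | ax2 => Derive (fun t => F (Re z, t)) (Im z)
  end.

Definition pd3 (i : axis) (Y : C -> R3) (z : C) : R3 :=
  ((pd i (fun w => Re (fst (Y w))) z, pd i (fun w => Im (fst (Y w))) z),
   pd i (fun w => snd (Y w)) z).

(* C^infinity; [ex_diff_n] is a pointwise condition, so the three predicates
   below have their usual meaning only on an open [U]. *)
Definition smooth_on (U : C -> Prop) (F : C -> R) : Prop :=
  forall z, U z ->
  forall n, ex_diff_n (fun x y => F (x, y)) n (Re z) (Im z).

Definition smoothC_on (U : C -> Prop) (F : C -> C) : Prop :=
  smooth_on U (fun z => Re (F z)) /\ smooth_on U (fun z => Im (F z)).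

Definition smooth3_on (U : C -> Prop) (Y : C -> R3) : Prop :=
  smoothC_on U (fun z => fst (Y z)) /\ smooth_on U (fun z => snd (Y z)).

(* [ex_derive] is here complex differentiability, over [C_AbsRing]. *)
Definition holomorphic_on (U : C -> Prop) (f : C -> C) : Prop :=
  forall z, U z -> @ex_derive C_AbsRing C_NormedModule f z.

(** ** Riemann surfaces, presented by local parametrizations *)

(* The change of coordinates from [phi : U -> S] to [psi : V -> S] is defined
   on an open set and has regularity [reg] there. *)
Definition transition {S : Type} (reg : (C -> Prop) -> (C -> C) -> Prop)
    (U : C -> Prop) (phi : C -> S) (V : C -> Prop) (psi : C -> S) : Prop :=
  let O := fun z => U z /\ exists w, V w /\ psi w = phi z in
  open O /\
  exists tau : C -> C,
    reg O tau /\ forall z, O z -> V (tau z) /\ psi (tau z) = phi z.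

Definition injective_on {S : Type} (U : C -> Prop) (phi : C -> S) : Prop :=
  forall z w, U z -> U w -> phi z = phi w -> z = w.

Definition atlas_open {S I : Type} (dom : I -> C -> Prop) (par : I -> C -> S)
    (O : S -> Prop) : Prop :=
  forall a, open (fun z => dom a z /\ O (par a z)).

(* The topology of the surface is the one induced by the atlas; it is second
   countable by Rado's theorem. *)
Record RiemannSurface := {
  point :> Type;
  chart : Type;
  dom : chart -> C -> Prop;
  par : chart -> C -> point;
  dom_open : forall a, open (dom a);
  par_inj : forall a, injective_on (dom a) (par a);
  par_cover : forall p, exists a z, dom a z /\ par a z = p;
  par_transition : forall a b,
    transition holomorphic_on (dom a) (par a) (dom b) (par b);
  surface_hausdorff : forall p q : point, p <> q ->
    exists O O' : point -> Prop,
      atlas_open dom par O /\ atlas_open dom par O' /\ O p /\ O' q /\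
      forall x, ~ (O x /\ O' x);
  surface_connected : forall O : point -> Prop,
    atlas_open dom par O -> atlas_open dom par (fun x => ~ O x) ->
    (exists x, O x) -> forall x, O x
}.

(* [phi] is a diffeomorphism from the open set [U] of R^2 onto an open subset
   of the surface: it belongs to the maximal smooth atlas. *)
Definition local_parametrization (S : RiemannSurface)
    (U : C -> Prop) (phi : C -> S) : Prop :=
  open U /\ injective_on U phi /\
  forall a : chart S,
    transition smoothC_on U phi (dom S a) (par S a) /\
    transition smoothC_on (dom S a) (par S a) U phi.

(** ** Local surface theory *)

Definition regular_at (Y : C -> R3) (z : C) : Prop :=
  forall s t : R,
    plus3 (scal3 s (pd3 ax1 Y z)) (scal3 t (pd3 ax2 Y z)) = origin3 ->
    s = 0 /\ t = 0.

Definition unit_normal_at (Y M : C -> R3) (z : C) : Prop :=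
  ip3 (M z) (M z) = 1 /\ forall i, ip3 (pd3 i Y z) (M z) = 0.

Definition is_weingarten (Y M : C -> R3) (z : C) (W : mat2) : Prop :=
  forall i, pd3 i M z =
    plus3 (scal3 (W i ax1) (pd3 ax1 Y z)) (scal3 (W i ax2) (pd3 ax2 Y z)).

(* Well defined by [is_weingarten] wherever [Y] is regular with smooth unit
   normal [M]. *)
Definition weingarten (Y M : C -> R3) (z : C) : mat2 :=
  epsilon (inhabits (fun _ _ => 0)) (is_weingarten Y M z).

Definition mean_curv (Y M : C -> R3) (z : C) : R :=
  - (1 / 2) * tr2 (weingarten Y M z).
Definition gauss_curv (Y M : C -> R3) (z : C) : R :=
  det2 (weingarten Y M z).

Definition support (Y M : C -> R3) (z : C) : R := ip3 (Y z) (M z).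
Definition quad_dist (Y : C -> R3) (z : C) : R := ip3 (Y z) (Y z).

(* The radius [r] may be negative: the sphere depends on [r ^ 2] only. *)
Definition sphere (c : R3) (r : R) (x : R3) : Prop :=
  ip3 (minus3 x c) (minus3 x c) = r ^ 2.

Definition SS_at (Y M : C -> R3) (z : C) : Prop :=
  let r := mean_curv Y M z / gauss_curv Y M z + support Y M z / 2 in
  sphere (plus3 (Y z) (scal3 r (M z))) r origin3.

Lemma SS_atE (Y M : C -> R3) (z : C) :
  ip3 (M z) (M z) = 1 -> gauss_curv Y M z <> 0 ->
  SS_at Y M z <->
  2 * support Y M z * mean_curv Y M z
    + (quad_dist Y z + support Y M z ^ 2) * gauss_curv Y M z = 0.
Proof.
unfold SS_at, sphere, support, quad_dist.
generalize (mean_curv Y M z) (gauss_curv Y M z); intros H K.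
destruct (Y z) as [[y1 y2] y3], (M z) as [[m1 m2] m3].
unfold ip3, ipC, minus3, plus3, scal3, origin3; simpl.
intros HM HK.
set (S := y1 * m1 + y2 * m2 + y3 * m3).
set (Q := y1 * y1 + y2 * y2 + y3 * y3).
set (r := H / K + (y1 * m1 - y2 * - m2 + y3 * m3) / 2).
assert (Er : r * K = H + S / 2 * K) by (unfold r, S; field; exact HK).
match goal with |- ?L = ?B <-> ?D = 0 =>
  assert (E1 : L - B = Q + 2 * r * S
            + r * r * (m1 * m1 - m2 * - m2 + m3 * m3 - 1))
    by (unfold Q, S; ring);
  assert (E2 : D = (Q + 2 * r * S) * K)
    by (transitivity (Q * K + 2 * S * (r * K));
        [rewrite Er; unfold Q, S; field | ring])
end.
rewrite HM in E1.
split; intro E.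
- rewrite E2; replace (Q + 2 * r * S) with 0 by lra; ring.
- rewrite E2 in E; destruct (Rmult_integral _ _ E); [lra | contradiction].
Qed.

(** ** Immersed surfaces [X : S -> R^3] with a choice of unit normal [N] *)

Definition immersion (S : RiemannSurface) (X : S -> R3) : Prop :=
  forall a : chart S,
    smooth3_on (dom S a) (fun z => X (par S a z)) /\
    forall z, dom S a z -> regular_at (fun w => X (par S a w)) z.

Definition gauss_map (S : RiemannSurface) (X N : S -> R3) : Prop :=
  forall a : chart S,
    smooth3_on (dom S a) (fun z => N (par S a z)) /\
    forall z, dom S a z ->
      unit_normal_at (fun w => X (par S a w)) (fun w => N (par S a w)) z.

Definition nonzero_gauss_curv (S : RiemannSurface) (X N : S -> R3) : Prop :=
  forall (a : chart S) (z : C), dom S a z ->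
    gauss_curv (fun w => X (par S a w)) (fun w => N (par S a w)) z <> 0.

Definition SS_surface (S : RiemannSurface) (X N : S -> R3) : Prop :=
  forall (a : chart S) (z : C), dom S a z ->
    SS_at (fun w => X (par S a w)) (fun w => N (par S a w)) z.

(** ** The parametrization attached to holomorphic data [f], [g] *)

Definition Tfun (g : C -> C) (z : C) : R := 1 + Cmod (g z) ^ 2.

Definition hfun (f : C -> C) (z : C) : R := exp (ipC 1 (f z)).

Definition Nfg (g : C -> C) (z : C) : R3 :=
  let T := Tfun g z in scal3 (/ T) ((RtoC 2 * g z)%C, 2 - T).

Definition Xfg (f g : C -> C) (z : C) : R3 :=
  let T := Tfun g z in
  let h := hfun f z in
  let f' := C_derive f z in
  let g' := C_derive g z in
  let k := ipC g' (g z * f')%C in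
  plus3
    (scal3 (h / (2 * Cmod g' ^ 2))
       ((RtoC T * g' * Cconj f' - RtoC 2 * g z * RtoC k)%C, - 2 * k))
    (scal3 h (Nfg g z)).

Definition Lmat (g : C -> C) (z : C) : mat2 := fun i j =>
  4 * Cmod (C_derive g z) ^ 2 / Tfun g z ^ 2 * delta i j.

(* [christoffel L k i j] is Gamma_ij^k for the metric [L]. *)
Definition christoffel (L : C -> mat2) (k i j : axis) (z : C) : R :=
  1 / 2 * sum_axis (fun l => inv2 (L z) k l *
    (pd i (fun w => L w j l) z + pd j (fun w => L w i l) z
     - pd l (fun w => L w i j) z)).

Definition Vmat (f g : C -> C) (z : C) : mat2 := fun i j =>
  / Lmat g z j j *
  (pd j (pd i (hfun f)) z
   - sum_axis (fun k => pd k (hfun f) z * christoffel (Lmat g) k i j z)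
   + hfun f z * Lmat g z i j * delta i j).

(* [phi] need not be holomorphic for the given complex structure of [S], which
   is unrelated to [X]: [z] is a complex parameter of the surface [X(S)]. *)
Definition locally_given_by_fg (S : RiemannSurface) (X N : S -> R3) : Prop :=
  forall p : S,
    exists (U : C -> Prop) (phi : C -> S) (f g : C -> C),
      local_parametrization S U phi /\
      (exists z, U z /\ phi z = p) /\
      holomorphic_on U f /\ holomorphic_on U g /\
      forall z, U z ->
        C_derive g z <> RtoC 0 /\
        X (phi z) = Xfg f g z /\ N (phi z) = Nfg g z.

(* Main.v *)
Require Import Defs.
From Stdlib Require Import Reals Classical ClassicalEpsilon Lra Lia.
From Coquelicot Require Import Coquelicot.
Open Scope R_scope.

(* For g' <> 0 the normal N = (2g, 2 - T)/T is a conformal map to the sphere, so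
   N_,1 and N_,2 form an orthogonal frame of the tangent plane.  An immersion X
   with normal N is X = grad h + h N for its support function h, and in that
   frame X_,i = sum_j V_ij N_,j; hence the Weingarten matrix is V^-1, and
   H/K = -(tr V)/2, 1/K = det V.  The spherical type equation becomes
   h * laplacian h = |grad h|^2, i.e. ln h is harmonic, which is to say that
   locally h = exp(Re f) with f holomorphic.  When K <> 0 the stereographic
   projection of N is a local coordinate, and in it one may take g(z) = z.

   As "holomorphic" means complex differentiable, f'' and g'' need Goursat's
   theorem.  It provides primitives F; differentiating the mean value formula
   for F over circles and integrating by parts writes F' as a circle average of
   F, which can be differentiated again. *)

(** * Plane calculus *)

(** Positivity of the support function stands beside the sphere condition because [exp (Re f)] is
    positive: passing from X to -X with the same normal preserves the condition and reverses the
    sign of h, and h = |z|^2 with g(z) = z solves h * laplacian h = |grad h|^2 with a zero at the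
    origin.

    The charts of [S] are unrelated to the parameter z. Instead of proving that curvatures are
    invariant under reparametrization, the derivatives of X and of N in a chart are expanded in one
    common frame N_,1, N_,2 of the sphere. If J is the Jacobian of the coordinate change, their
    coefficient matrices are J V and J, so the Weingarten matrix W satisfies W J V = J. Then W = J
    V^-1 J^-1, whose trace and determinant do not see J. Both directions of the equivalence use
    this.

    The converse has to produce a parametrization with smooth transitions in both directions to
    every chart. This calls for an inverse function theorem for plane maps with smoothness of every
    order, and also for smoothness of the holomorphic transitions between charts. *)

Lemma C1_differentiable (f fx : R -> R -> R) (x y fy : R) :
  locally_2d (fun u v => is_derive (fun t => f t v) u (fx u v)) x y ->
  is_derive (fun t => f x t) y fy ->
  continuity_2d_pt fx x y ->
  differentiable_pt_lim f x y (fx x y) fy.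
Proof.
intros [d1 H1] H2 H3 eps.
destruct (H3 (pos_div_2 eps)) as [d3 H3'].
apply is_derive_Reals in H2.
destruct (H2 (eps / 2)) as [d2 H2']; [apply is_pos_div_2|].
assert (Hd : 0 < Rmin d1 (Rmin d2 d3))
  by (repeat apply Rmin_pos; apply cond_pos).
exists (mkposreal _ Hd); simpl; intros u v Hu Hv.
assert (Rmin d1 (Rmin d2 d3) <= d1) by apply Rmin_l.
assert (Rmin d1 (Rmin d2 d3) <= d2)
  by (eapply Rle_trans; [apply Rmin_r | apply Rmin_l]).
assert (Rmin d1 (Rmin d2 d3) <= d3)
  by (eapply Rle_trans; [apply Rmin_r | apply Rmin_r]).
(* The increment is split into a horizontal leg at height [v], where the mean value theorem and
   continuity of [fx] apply, and a vertical leg at abscissa [x], where the derivative at the single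
   point [y] suffices. *)
destruct (MVT_cor4 (fun t => f t v) (fun t => fx t v) x (Rabs (u - x)))
  with (b := u) as [c [Ec Hc]]; [ | apply Rle_refl | ].
{ intros c Hc; apply H1; lra. }
assert (A1 : Rabs (fx c v - fx x y) <= eps / 2).
{ left; apply H3'; lra. }
assert (A2 : Rabs (f x v - f x y - fy * (v - y)) <= eps / 2 * Rabs (v - y)).
{ destruct (Req_dec v y) as [-> | Hvy].
  - replace (f x y - f x y - fy * (y - y)) with 0 by ring.
    rewrite Rminus_diag, Rabs_R0; lra.
  - specialize (H2' (v - y)).
    replace (y + (v - y)) with v in H2' by ring.
    replace (f x v - f x y - fy * (v - y))
      with (((f x v - f x y) / (v - y) - fy) * (v - y)) by (field; lra).
    rewrite Rabs_mult; apply Rmult_le_compat_r; [apply Rabs_pos|].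
    left; apply H2'; lra. }
replace (f u v - f x y - (fx x y * (u - x) + fy * (v - y)))
  with ((fx c v - fx x y) * (u - x) + (f x v - f x y - fy * (v - y)))
  by (simpl in Ec; lra).
eapply Rle_trans; [apply Rabs_triang|].
rewrite Rabs_mult.
assert (B1 := Rmax_l (Rabs (u - x)) (Rabs (v - y))).
assert (B2 := Rmax_r (Rabs (u - x)) (Rabs (v - y))).
assert (P1 := Rabs_pos (u - x)); assert (P2 := Rabs_pos (fx c v - fx x y)).
assert (P3 := cond_pos eps).
nra.
Qed.

Lemma differentiable_slice1 (f : R -> R -> R) (x y a b : R) :
  differentiable_pt_lim f x y a b -> is_derive (fun t => f t y) x a.
Proof.
intros H; apply is_derive_Reals.
replace a with (a * 1 + b * 0) by ring.
apply (derivable_pt_lim_comp_2d f (fun t => t) (fun _ => y)); auto.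
- apply derivable_pt_lim_id.
- apply derivable_pt_lim_const.
Qed.

Lemma differentiable_slice2 (f : R -> R -> R) (x y a b : R) :
  differentiable_pt_lim f x y a b -> is_derive (fun t => f x t) y b.
Proof.
intros H; apply is_derive_Reals.
replace b with (a * 0 + b * 1) by ring.
apply (derivable_pt_lim_comp_2d f (fun _ => x) (fun t => t)); auto.
- apply derivable_pt_lim_const.
- apply derivable_pt_lim_id.
Qed.

Lemma differentiable_continuity (f : R -> R -> R) (x y a b : R) :
  differentiable_pt_lim f x y a b -> continuity_2d_pt f x y.
Proof.
intros H; apply differentiable_continuity_pt; exists a, b; exact H.
Qed.

Lemma Cmod_le_Rmax (z : C) (M : R) :
  Rmax (Rabs (Re z)) (Rabs (Im z)) <= M -> Cmod z <= 2 * M.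
Proof.
intros H.
eapply Rle_trans; [apply Cmod_2Rmax|].
assert (sqrt 2 <= 2) by (rewrite <- (sqrt_Rsqr 2) at 2; [apply sqrt_le_1; unfold Rsqr; lra | lra]).
assert (0 <= sqrt 2) by apply sqrt_pos.
assert (0 <= Rmax (Rabs (fst z)) (Rabs (snd z)))
  by (eapply Rle_trans; [apply Rabs_pos | apply Rmax_l]).
unfold Re, Im in H.
nra.
Qed.

Lemma is_derive_C_epsilon (f : C -> C) (z l : C) :
  @is_derive C_AbsRing C_NormedModule f z l <->
  forall eps : posreal, exists d : posreal, forall w : C,
    Cmod (w - z) < d ->
    Cmod (f w - f z - (w - z) * l) <= eps * Cmod (w - z).
Proof.
split.
- intros [_ H] eps.
  destruct (H z (fun P HP => HP) eps) as [d Hd].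
  exists d; exact Hd.
- intros H; split; [apply is_linear_scal_l|].
  intros x Hx eps.
  apply (@is_filter_lim_locally_unique C_AbsRing (AbsRing_NormedModule C_AbsRing)) in Hx; subst x.
  destruct (H eps) as [d Hd].
  exists d; exact Hd.
Qed.

Lemma Cmod_Re (z : C) : Rabs (Re z) <= Cmod z.
Proof. eapply Rle_trans; [apply Rmax_l | apply Rmax_Cmod]. Qed.

Lemma Cmod_Im (z : C) : Rabs (Im z) <= Cmod z.
Proof. eapply Rle_trans; [apply Rmax_r | apply Rmax_Cmod]. Qed.

(** The complex derivative bounds the error in modulus, the plane differentials bound each
    coordinate in the max norm. Each norm is at most twice the other, so each passage is paid for by
    halving [eps]. The matrix is that of multiplication by [a + ib]. *)
Lemma is_derive_C_Cauchy_Riemann (f : C -> C) (z : C) (a b : R) :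
  @is_derive C_AbsRing C_NormedModule f z (a, b) <->
  differentiable_pt_lim (fun x y => Re (f (x, y))) (Re z) (Im z) a (- b) /\
  differentiable_pt_lim (fun x y => Im (f (x, y))) (Re z) (Im z) b a.
Proof.
rewrite is_derive_C_epsilon.
destruct z as [x y]; simpl.
split.
- intros H.
  assert (K : forall eps : posreal, locally_2d (fun u v =>
    Cmod (f (u, v) - f (x, y) - ((u, v) - (x, y)) * (a, b))
      <= eps * Rmax (Rabs (u - x)) (Rabs (v - y))) x y).
  { intros eps; destruct (H (pos_div_2 eps)) as [d Hd].
    exists (pos_div_2 d); simpl; intros u v Hu Hv.
    assert (E : Cmod ((u, v) - (x, y)) <= 2 * Rmax (Rabs (u - x)) (Rabs (v - y)))
      by (apply Cmod_le_Rmax, Rle_refl).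
    assert (Rmax (Rabs (u - x)) (Rabs (v - y)) < d / 2)
      by (apply Rmax_lub_lt; assumption).
    eapply Rle_trans; [apply Hd; lra|].
    simpl; assert (P := cond_pos eps); nra. }
  split; intros eps; destruct (K eps) as [d Hd]; exists d; intros u v Hu Hv;
    (eapply Rle_trans; [| apply Hd; assumption]).
  + eapply Rle_trans; [| apply Cmod_Re]; simpl; right; f_equal; unfold Re; ring.
  + eapply Rle_trans; [| apply Cmod_Im]; simpl; right; f_equal; unfold Im; ring.
- intros [H1 H2] eps.
  destruct (H1 (pos_div_2 eps)) as [d1 D1]; destruct (H2 (pos_div_2 eps)) as [d2 D2].
  assert (Hd : 0 < Rmin d1 d2) by (apply Rmin_pos; apply cond_pos).
  exists (mkposreal _ Hd); simpl; intros [u v] Hw.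
  assert (E1 := Cmod_Re ((u, v) - (x, y))); assert (E2 := Cmod_Im ((u, v) - (x, y))).
  simpl in E1, E2.
  assert (L1 := Rmin_l d1 d2); assert (L2 := Rmin_r d1 d2).
  change (u + - x) with (u - x) in E1; change (v + - y) with (v - y) in E2.
  specialize (D1 u v ltac:(lra) ltac:(lra)); specialize (D2 u v ltac:(lra) ltac:(lra)).
  replace (eps * Cmod ((u, v) - (x, y))) with (2 * (eps / 2 * Cmod ((u, v) - (x, y))))
    by field.
  apply Cmod_le_Rmax.
  assert (Rmax (Rabs (u - x)) (Rabs (v - y)) <= Cmod ((u, v) - (x, y)))
    by (apply Rmax_lub; assumption).
  assert (P := cond_pos eps); simpl in D1, D2.
  apply Rmax_lub.
  + eapply Rle_trans; [| eapply Rle_trans; [exact D1 |]].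
    * right; f_equal; simpl; unfold Re; ring.
    * nra.
  + eapply Rle_trans; [| eapply Rle_trans; [exact D2 |]].
    * right; f_equal; simpl; unfold Im; ring.
    * nra.
Qed.

(** * Goursat's lemma and potentials *)

Lemma nested_segments (lo hi : nat -> R) :
  (forall n, lo n <= lo (S n)) -> (forall n, hi (S n) <= hi n) ->
  (forall n, lo n <= hi n) ->
  exists x, forall n, lo n <= x <= hi n.
Proof.
intros Hlo Hhi Hle.
assert (M1 : forall n k, lo n <= lo (k + n)%nat).
{ intros n; induction k as [|k IH]; simpl; [lra|].
  specialize (Hlo (k + n)%nat); lra. }
assert (M2 : forall n k, hi (k + n)%nat <= hi n).
{ intros n; induction k as [|k IH]; simpl; [lra|].
  specialize (Hhi (k + n)%nat); lra. }
assert (Hmn : forall m n, lo m <= hi n).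
{ intros m n; specialize (M1 m n); specialize (M2 n m).
  rewrite (Nat.add_comm m n) in M2; specialize (Hle (n + m)%nat); lra. }
destruct (completeness (fun r => exists n, r = lo n)) as [x [Hx1 Hx2]].
- exists (hi 0%nat); intros r [n ->]; apply Hmn.
- exists (lo 0%nat), 0%nat; reflexivity.
- exists x; intros n; split.
  + apply Hx1; exists n; reflexivity.
  + apply Hx2; intros r [m ->]; apply Hmn.
Qed.

Lemma dependent_choice {A : Type} (inv : nat -> A -> Prop)
    (step : nat -> A -> A -> Prop) (a0 : A) :
  inv 0%nat a0 ->
  (forall n a, inv n a -> exists b, step n a b /\ inv (S n) b) ->
  exists s : nat -> A, s 0%nat = a0 /\
    forall n, inv n (s n) /\ step n (s n) (s (S n)).
Proof.
intros H0 HS.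
set (next := fun n a => epsilon (inhabits a0) (fun b => step n a b /\ inv (S n) b)).
set (s := fix s n := match n with O => a0 | S m => next m (s m) end).
assert (Hs : forall n, inv n (s n)).
{ induction n as [|n IH]; [exact H0|].
  exact (proj2 (epsilon_spec (inhabits a0) _ (HS n (s n) IH))). }
exists s; split; [reflexivity|]; intros n; split; [apply Hs|].
exact (proj1 (epsilon_spec (inhabits a0) _ (HS n (s n) (Hs n)))).
Qed.

(* The integral of [P dx + Q dy] along the boundary of [a, b] x [c, d]. *)
Definition rect_int (P Q : R -> R -> R) (a b c d : R) : R :=
  RInt (fun x => P x c - P x d) a b + RInt (fun y => Q b y - Q a y) c d.

Lemma continuity_2d_slice1 (f : R -> R -> R) (x y : R) :
  continuity_2d_pt f x y -> continuous (fun t => f t y) x.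
Proof.
intros H; apply continuity_pt_filterlim, continuity_pt_locally; intros eps.
destruct (H eps) as [d Hd]; exists d; intros t Ht.
apply Hd; [exact Ht|]; rewrite Rminus_diag, Rabs_R0; apply cond_pos.
Qed.

Lemma continuity_2d_slice2 (f : R -> R -> R) (x y : R) :
  continuity_2d_pt f x y -> continuous (fun t => f x t) y.
Proof.
intros H; apply continuity_pt_filterlim, continuity_pt_locally; intros eps.
destruct (H eps) as [d Hd]; exists d; intros t Ht.
apply Hd; [|exact Ht]; rewrite Rminus_diag, Rabs_R0; apply cond_pos.
Qed.

Lemma RInt_Rext (f g : R -> R) (a b : R) :
  (forall x, f x = g x) -> RInt f a b = RInt g a b.
Proof. intros H; apply RInt_ext; intros x _; apply H. Qed.

Lemma RInt_Rconst (k a b : R) : RInt (fun _ => k) a b = (b - a) * k.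
Proof. exact (RInt_const a b k). Qed.

Lemma RInt_Rplus (f g : R -> R) (a b : R) :
  ex_RInt f a b -> ex_RInt g a b ->
  RInt (fun x => f x + g x) a b = RInt f a b + RInt g a b.
Proof. intros Hf Hg; exact (RInt_plus f g a b Hf Hg). Qed.

Lemma RInt_Rminus (f g : R -> R) (a b : R) :
  ex_RInt f a b -> ex_RInt g a b ->
  RInt (fun x => f x - g x) a b = RInt f a b - RInt g a b.
Proof. intros Hf Hg; exact (RInt_minus f g a b Hf Hg). Qed.

Lemma RInt_RChasles (f : R -> R) (a b c : R) :
  ex_RInt f a b -> ex_RInt f b c -> RInt f a c = RInt f a b + RInt f b c.
Proof. intros Hf Hg; symmetry; exact (RInt_Chasles f a b c Hf Hg). Qed.

Lemma ex_RInt_slice1_minus (P : R -> R -> R) (a b c d : R) :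
  a <= b ->
  (forall x, a <= x <= b -> continuity_2d_pt P x c) ->
  (forall x, a <= x <= b -> continuity_2d_pt P x d) ->
  ex_RInt (fun x => P x c - P x d) a b.
Proof.
intros Hab Hc Hd; apply (ex_RInt_continuous (V := R_CompleteNormedModule)).
rewrite Rmin_left, Rmax_right by lra; intros x Hx.
apply (continuous_minus (V := R_NormedModule)).
- apply (continuity_2d_slice1 P); auto.
- apply (continuity_2d_slice1 P); auto.
Qed.

Lemma ex_RInt_slice2_minus (Q : R -> R -> R) (a b c d : R) :
  c <= d ->
  (forall y, c <= y <= d -> continuity_2d_pt Q a y) ->
  (forall y, c <= y <= d -> continuity_2d_pt Q b y) ->
  ex_RInt (fun y => Q b y - Q a y) c d.
Proof.
intros Hcd Ha Hb; apply (ex_RInt_continuous (V := R_CompleteNormedModule)).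
rewrite Rmin_left, Rmax_right by lra; intros y Hy.
apply (continuous_minus (V := R_NormedModule)).
- apply (continuity_2d_slice2 Q); auto.
- apply (continuity_2d_slice2 Q); auto.
Qed.

Lemma rect_int_split_x (P Q : R -> R -> R) (a m b c d : R) :
  a <= m <= b -> c <= d ->
  (forall x y, a <= x <= b -> c <= y <= d ->
     continuity_2d_pt P x y /\ continuity_2d_pt Q x y) ->
  rect_int P Q a b c d = rect_int P Q a m c d + rect_int P Q m b c d.
Proof.
intros Hm Hcd H; unfold rect_int.
rewrite (RInt_RChasles (fun x => P x c - P x d) a m b);
  try (apply ex_RInt_slice1_minus; [lra | |]; intros; apply H; lra).
rewrite (RInt_Rext (fun y => Q b y - Q a y)
          (fun y => (Q b y - Q m y) + (Q m y - Q a y)))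
  by (intros; ring).
rewrite RInt_Rplus;
  try (apply ex_RInt_slice2_minus; [lra | |]; intros; apply H; lra).
ring.
Qed.

Lemma rect_int_split_y (P Q : R -> R -> R) (a b c m d : R) :
  a <= b -> c <= m <= d ->
  (forall x y, a <= x <= b -> c <= y <= d ->
     continuity_2d_pt P x y /\ continuity_2d_pt Q x y) ->
  rect_int P Q a b c d = rect_int P Q a b c m + rect_int P Q a b m d.
Proof.
intros Hab Hm H; unfold rect_int.
rewrite (RInt_RChasles (fun y => Q b y - Q a y) c m d);
  try (apply ex_RInt_slice2_minus; [lra | |]; intros; apply H; lra).
rewrite (RInt_Rext (fun x => P x c - P x d)
          (fun x => (P x c - P x m) + (P x m - P x d)))
  by (intros; ring).
rewrite RInt_Rplus;
  try (apply ex_RInt_slice1_minus; [lra | |]; intros; apply H; lra).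
ring.
Qed.

(* The linear parts of [P] and [Q] at [(x0, y0)] contribute nothing, since
   their cross derivatives agree. *)
Lemma rect_int_small (P Q : R -> R -> R) (x0 y0 p r q : R) (eps : posreal) :
  differentiable_pt_lim P x0 y0 p r ->
  differentiable_pt_lim Q x0 y0 r q ->
  exists delta : posreal, forall a b c d M,
    a <= x0 <= b -> c <= y0 <= d -> b - a <= M -> d - c <= M -> M < delta ->
    (forall x y, a <= x <= b -> c <= y <= d ->
       continuity_2d_pt P x y /\ continuity_2d_pt Q x y) ->
    Rabs (rect_int P Q a b c d) <= eps * M ^ 2.
Proof.
intros HP HQ.
assert (He : 0 < eps / 4) by (assert (H := cond_pos eps); lra).
destruct (HP (mkposreal _ He)) as [d1 H1]; destruct (HQ (mkposreal _ He)) as [d2 H2].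
simpl in H1, H2.
exists (mkposreal _ (Rmin_pos _ _ (cond_pos d1) (cond_pos d2))); simpl.
intros a b c d M Hx Hy Hba Hdc HM Hcont.
assert (L1 := Rmin_l d1 d2); assert (L2 := Rmin_r d1 d2).
(* There are two pairs of opposite sides, each of length at most [M], and on each pair the integrand
   is off by at most [2 * (e * M)]: in total [4 * e * M ^ 2]. *)
set (e := eps / 4) in *.
assert (B : forall u v, a <= u <= b -> c <= v <= d ->
  Rmax (Rabs (u - x0)) (Rabs (v - y0)) <= M).
{ intros u v Hu Hv; apply Rmax_lub; apply Rabs_le; lra. }
assert (BP : forall u v, a <= u <= b -> c <= v <= d ->
  Rabs (P u v - P x0 y0 - (p * (u - x0) + r * (v - y0))) <= e * M).
{ intros u v Hu Hv; eapply Rle_trans.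
  - apply H1; apply Rle_lt_trans with M; try lra; apply Rabs_le; lra.
  - apply Rmult_le_compat_l; [lra | auto]. }
assert (BQ : forall u v, a <= u <= b -> c <= v <= d ->
  Rabs (Q u v - Q x0 y0 - (r * (u - x0) + q * (v - y0))) <= e * M).
{ intros u v Hu Hv; eapply Rle_trans.
  - apply H2; apply Rle_lt_trans with M; try lra; apply Rabs_le; lra.
  - apply Rmult_le_compat_l; [lra | auto]. }
assert (EP : ex_RInt (fun x => P x c - P x d) a b)
  by (apply ex_RInt_slice1_minus; [lra | |]; intros; apply Hcont; lra).
assert (EQ : ex_RInt (fun y => Q b y - Q a y) c d)
  by (apply ex_RInt_slice2_minus; [lra | |]; intros; apply Hcont; lra).
assert (IP : Rabs (RInt (fun x => P x c - P x d) a b - (b - a) * (r * (c - d)))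
             <= (b - a) * (2 * (e * M))).
{ assert (E : RInt (fun x => P x c - P x d) a b - (b - a) * (r * (c - d))
      = RInt (fun x => P x c - P x d - r * (c - d)) a b).
  { rewrite (RInt_Rminus (fun x => P x c - P x d) (fun _ => r * (c - d))), RInt_Rconst;
      [reflexivity | exact EP | apply ex_RInt_const]. }
  rewrite E.
  apply abs_RInt_le_const; [lra | |].
  - apply (ex_RInt_minus (V := R_NormedModule)); [exact EP | apply ex_RInt_const].
  - intros t Ht.
    assert (U1 := BP t c ltac:(lra) ltac:(lra)).
    assert (U2 := BP t d ltac:(lra) ltac:(lra)).
    apply Rabs_le_between in U1; apply Rabs_le_between in U2.
    apply Rabs_le; lra. }
assert (IQ : Rabs (RInt (fun y => Q b y - Q a y) c d - (d - c) * (r * (b - a)))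
             <= (d - c) * (2 * (e * M))).
{ assert (E : RInt (fun y => Q b y - Q a y) c d - (d - c) * (r * (b - a))
      = RInt (fun y => Q b y - Q a y - r * (b - a)) c d).
  { rewrite (RInt_Rminus (fun y => Q b y - Q a y) (fun _ => r * (b - a))), RInt_Rconst;
      [reflexivity | exact EQ | apply ex_RInt_const]. }
  rewrite E.
  apply abs_RInt_le_const; [lra | |].
  - apply (ex_RInt_minus (V := R_NormedModule)); [exact EQ | apply ex_RInt_const].
  - intros t Ht.
    assert (U1 := BQ b t ltac:(lra) ltac:(lra)).
    assert (U2 := BQ a t ltac:(lra) ltac:(lra)).
    apply Rabs_le_between in U1; apply Rabs_le_between in U2.
    apply Rabs_le; lra. }
unfold rect_int.
replace (RInt (fun x => P x c - P x d) a b + RInt (fun y => Q b y - Q a y) c d)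
  with ((RInt (fun x => P x c - P x d) a b - (b - a) * (r * (c - d)))
        + (RInt (fun y => Q b y - Q a y) c d - (d - c) * (r * (b - a)))) by ring.
eapply Rle_trans; [apply Rabs_triang|].
replace (eps * (M * (M * 1))) with (M * (2 * (e * M)) + M * (2 * (e * M)))
  by (unfold e; field).
assert (0 <= 2 * (e * M)) by (apply Rmult_le_pos; [lra | apply Rmult_le_pos; lra]).
apply Rplus_le_compat; (eapply Rle_trans; [eassumption|]);
  apply Rmult_le_compat_r; lra.
Qed.

(* Goursat's bisection: continuity of the derivatives is not assumed. *)
Lemma rect_int_0 (P Q : R -> R -> R) (a b c d : R) :
  a <= b -> c <= d ->
  (forall x y, a <= x <= b -> c <= y <= d ->
     exists p r q, differentiable_pt_lim P x y p r /\
                   differentiable_pt_lim Q x y r q) ->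
  rect_int P Q a b c d = 0.
Proof.
intros Hab Hcd H.
assert (Hcont : forall x y, a <= x <= b -> c <= y <= d ->
   continuity_2d_pt P x y /\ continuity_2d_pt Q x y).
{ intros x y Hx Hy; destruct (H x y Hx Hy) as [p [r [q [H1 H2]]]].
  split; eapply differentiable_continuity; eassumption. }
set (w := b - a); set (k := d - c); set (I := rect_int P Q a b c d).
destruct (Req_dec I 0) as [|HI]; [assumption | exfalso].
assert (HI' : 0 < Rabs I) by (apply Rabs_pos_lt; exact HI).
assert (P2 : forall n, 0 < (/ 2) ^ n) by (intros n; apply pow_lt; lra).
set (inv := fun (n : nat) (s : R * R) =>
  a <= fst s /\ fst s + w * (/ 2) ^ n <= b /\
  c <= snd s /\ snd s + k * (/ 2) ^ n <= d /\
  Rabs I * (/ 4) ^ n <=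
    Rabs (rect_int P Q (fst s) (fst s + w * (/ 2) ^ n)
                       (snd s) (snd s + k * (/ 2) ^ n))).
set (step := fun (n : nat) (s t : R * R) =>
  fst s <= fst t /\ fst t + w * (/ 2) ^ (S n) <= fst s + w * (/ 2) ^ n /\
  snd s <= snd t /\ snd t + k * (/ 2) ^ (S n) <= snd s + k * (/ 2) ^ n).
destruct (dependent_choice inv step (a, c)) as [s [_ Hs]].
{ unfold inv, w, k; simpl; repeat split; try lra.
  replace (a + (b - a) * 1) with b by ring.
  replace (c + (d - c) * 1) with d by ring.
  unfold I; lra. }
{ intros n [x y]; unfold inv, step; simpl.
  specialize (P2 n); set (h := (/ 2) ^ n) in *.
  intros [A1 [A2 [A3 [A4 A5]]]].
  assert (0 <= w * h) by (apply Rmult_le_pos; unfold w; lra).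
  assert (0 <= k * h) by (apply Rmult_le_pos; unfold k; lra).
  set (x1 := x + w * (/ 2 * h)); set (y1 := y + k * (/ 2 * h)).
  assert (X2 : x1 + w * (/ 2 * h) = x + w * h) by (unfold x1; field).
  assert (Y2 : y1 + k * (/ 2 * h) = y + k * h) by (unfold y1; field).
  assert (x <= x1 <= x + w * h) by (unfold x1; lra).
  assert (y <= y1 <= y + k * h) by (unfold y1; lra).
  assert (E : rect_int P Q x (x + w * h) y (y + k * h)
    = rect_int P Q x x1 y y1 + rect_int P Q x x1 y1 (y + k * h)
      + (rect_int P Q x1 (x + w * h) y y1 + rect_int P Q x1 (x + w * h) y1 (y + k * h))).
  { rewrite (rect_int_split_x P Q x x1 (x + w * h)); try lra;
      [| intros; apply Hcont; lra].
    rewrite (rect_int_split_y P Q x x1 y y1 (y + k * h)); try lra;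
      [| intros; apply Hcont; lra].
    rewrite (rect_int_split_y P Q x1 (x + w * h) y y1 (y + k * h)); try lra.
    intros; apply Hcont; lra. }
  (* If all four quarters fell below a quarter of the lower bound, the triangle inequality would
     contradict [A5]. *)
  assert (S1 : exists u v, (u = x \/ u = x1) /\ (v = y \/ v = y1) /\
    Rabs I * (/ 4 * (/ 4) ^ n) <=
    Rabs (rect_int P Q u (u + w * (/ 2 * h)) v (v + k * (/ 2 * h)))).
  { apply NNPP; intros N.
    assert (N' : forall u v, (u = x \/ u = x1) -> (v = y \/ v = y1) ->
      Rabs (rect_int P Q u (u + w * (/ 2 * h)) v (v + k * (/ 2 * h)))
        < Rabs I * (/ 4 * (/ 4) ^ n)).
    { intros u v Hu Hv; apply Rnot_le_lt; intros K; apply N; exists u, v; auto. }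
    assert (N1 := N' x y (or_introl eq_refl) (or_introl eq_refl)).
    assert (N2 := N' x y1 (or_introl eq_refl) (or_intror eq_refl)).
    assert (N3 := N' x1 y (or_intror eq_refl) (or_introl eq_refl)).
    assert (N4 := N' x1 y1 (or_intror eq_refl) (or_intror eq_refl)).
    fold x1 in N1, N2; fold y1 in N1, N3; rewrite Y2 in N2, N4; rewrite X2 in N3, N4.
    rewrite E in A5.
    assert (T := Rabs_triang
      (rect_int P Q x x1 y y1 + rect_int P Q x x1 y1 (y + k * h))
      (rect_int P Q x1 (x + w * h) y y1 + rect_int P Q x1 (x + w * h) y1 (y + k * h))).
    assert (T1 := Rabs_triang (rect_int P Q x x1 y y1) (rect_int P Q x x1 y1 (y + k * h))).
    assert (T2 := Rabs_triang (rect_int P Q x1 (x + w * h) y y1)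
                              (rect_int P Q x1 (x + w * h) y1 (y + k * h))).
    lra. }
  destruct S1 as [u [v [Hu [Hv Huv]]]].
  exists (u, v); simpl.
  assert (u = x \/ u + w * (/ 2 * h) = x + w * h)
    by (destruct Hu as [-> | ->]; [left; reflexivity | right; exact X2]).
  assert (v = y \/ v + k * (/ 2 * h) = y + k * h)
    by (destruct Hv as [-> | ->]; [left; reflexivity | right; exact Y2]).
  assert (x <= u) by (destruct Hu; subst u; lra).
  assert (y <= v) by (destruct Hv; subst v; lra).
  assert (u + w * (/ 2 * h) <= x + w * h) by lra.
  assert (v + k * (/ 2 * h) <= y + k * h) by lra.
  repeat split; try lra. }
assert (Hh : forall n, 0 <= w * (/ 2) ^ n /\ 0 <= k * (/ 2) ^ n).
{ intros n; specialize (P2 n); split; apply Rmult_le_pos; unfold w, k; lra. }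
destruct (nested_segments (fun n => fst (s n)) (fun n => fst (s n) + w * (/ 2) ^ n))
  as [x0 Hx0].
{ intros n; apply (Hs n). }
{ intros n; apply (Hs n). }
{ intros n; specialize (Hh n); lra. }
destruct (nested_segments (fun n => snd (s n)) (fun n => snd (s n) + k * (/ 2) ^ n))
  as [y0 Hy0].
{ intros n; apply (Hs n). }
{ intros n; apply (Hs n). }
{ intros n; specialize (Hh n); lra. }
destruct (H x0 y0) as [p [r [q [HP HQ]]]].
{ specialize (Hx0 0%nat); destruct (Hs 0%nat) as [[A1 [A2 _]] _]; lra. }
{ specialize (Hy0 0%nat); destruct (Hs 0%nat) as [[_ [_ [A1 [A2 _]]]] _]; lra. }
(* [D * h] bounds both sides of the n-th rectangle, and the [+ 1] keeps [D] positive for a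
   degenerate one. With tolerance [|I| / (2 * D ^ 2)] the upper bound becomes half of the lower
   bound [|I| * h ^ 2]. *)
set (D := w + k + 1).
assert (HD : 1 <= D) by (unfold D, w, k; lra).
assert (He : 0 < Rabs I / (2 * D ^ 2)).
{ apply Rdiv_lt_0_compat; [exact HI' | nra]. }
destruct (rect_int_small P Q x0 y0 p r q (mkposreal _ He) HP HQ) as [delta Hdelta].
destruct (pow_lt_1_zero (/ 2)) with (y := delta / D) as [n0 Hn0].
{ rewrite Rabs_right; lra. }
{ apply Rdiv_lt_0_compat; [apply cond_pos | lra]. }
specialize (Hn0 n0 (Nat.le_refl _)).
rewrite Rabs_right in Hn0 by (specialize (P2 n0); lra).
destruct (Hs n0) as [[A1 [A2 [A3 [A4 A5]]]] _].
specialize (P2 n0); specialize (Hh n0); specialize (Hx0 n0); specialize (Hy0 n0).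
assert (F4 : (/ 4) ^ n0 = (/ 2) ^ n0 * (/ 2) ^ n0).
{ rewrite <- Rpow_mult_distr; f_equal; field. }
rewrite F4 in A5.
set (h := (/ 2) ^ n0) in *.
assert (K := Hdelta (fst (s n0)) (fst (s n0) + w * h) (snd (s n0)) (snd (s n0) + k * h)
               (D * h) Hx0 Hy0).
assert (Rabs I * (h * h) <= Rabs I / (2 * D ^ 2) * (D * h) ^ 2).
{ eapply Rle_trans; [exact A5 | apply K].
  - unfold D, w, k in *; nra.
  - unfold D, w, k in *; nra.
  - apply Rmult_lt_compat_l with (r := D) in Hn0; [|lra].
    replace (D * (delta / D)) with (pos delta) in Hn0 by (field; lra); exact Hn0.
  - intros; apply Hcont; lra. }
replace (Rabs I / (2 * D ^ 2) * (D * h) ^ 2) with (Rabs I * (h * h) / 2) in H0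
  by (field; lra).
assert (0 < Rabs I * (h * h)) by (apply Rmult_lt_0_compat; nra).
lra.
Qed.

Definition box (x0 y0 r x y : R) : Prop := Rabs (x - x0) < r /\ Rabs (y - y0) < r.

Lemma RInt_Rswap (f : R -> R) (a b : R) :
  ex_RInt f a b -> RInt f b a = - RInt f a b.
Proof. intros H; symmetry; exact (opp_RInt_swap f a b H). Qed.

Lemma Rabs_between (a b c x0 r : R) :
  Rabs (a - x0) < r -> Rabs (b - x0) < r -> Rmin a b <= c <= Rmax a b ->
  Rabs (c - x0) < r.
Proof.
intros Ha Hb Hc; apply Rabs_lt_between in Ha; apply Rabs_lt_between in Hb.
apply Rabs_lt_between.
revert Hc; unfold Rmin, Rmax; destruct (Rle_dec a b); lra.
Qed.

Lemma box_open (x0 y0 r x y : R) :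
  box x0 y0 r x y -> locally_2d (box x0 y0 r) x y.
Proof.
intros [Hx Hy].
assert (H : 0 < Rmin (r - Rabs (x - x0)) (r - Rabs (y - y0)))
  by (apply Rmin_pos; lra).
exists (mkposreal _ H); simpl; intros u v Hu Hv.
assert (L1 := Rmin_l (r - Rabs (x - x0)) (r - Rabs (y - y0))).
assert (L2 := Rmin_r (r - Rabs (x - x0)) (r - Rabs (y - y0))).
split.
- replace (u - x0) with ((u - x) + (x - x0)) by ring.
  eapply Rle_lt_trans; [apply Rabs_triang | lra].
- replace (v - y0) with ((v - y) + (y - y0)) by ring.
  eapply Rle_lt_trans; [apply Rabs_triang | lra].
Qed.

Lemma ex_RInt_slice1 (P : R -> R -> R) (x0 y0 r a b y : R) :
  (forall u v, box x0 y0 r u v -> continuity_2d_pt P u v) ->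
  box x0 y0 r a y -> box x0 y0 r b y ->
  ex_RInt (fun t => P t y) a b.
Proof.
intros H [Ha Hy] [Hb _]; apply (ex_RInt_continuous (V := R_CompleteNormedModule)).
intros t Ht; apply (continuity_2d_slice1 P), H; split; [| exact Hy].
exact (Rabs_between _ _ _ _ _ Ha Hb Ht).
Qed.

Lemma ex_RInt_slice2 (Q : R -> R -> R) (x0 y0 r c d x : R) :
  (forall u v, box x0 y0 r u v -> continuity_2d_pt Q u v) ->
  box x0 y0 r x c -> box x0 y0 r x d ->
  ex_RInt (fun t => Q x t) c d.
Proof.
intros H [Hx Hc] [_ Hd]; apply (ex_RInt_continuous (V := R_CompleteNormedModule)).
intros t Ht; apply (continuity_2d_slice2 Q), H; split; [exact Hx |].
exact (Rabs_between _ _ _ _ _ Hc Hd Ht).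
Qed.

(** The potential is the integral along a path of two legs. The path ending with a vertical leg
    shows the [y]-derivative, the one ending with a horizontal leg the [x]-derivative, and
    [rect_int_0] makes them agree. Continuity of [P] then gives the total differential. *)
Lemma potential_on_box (P Q : R -> R -> R) (x0 y0 r : R) :
  (forall x y, box x0 y0 r x y ->
     exists p s q, differentiable_pt_lim P x y p s /\
                   differentiable_pt_lim Q x y s q) ->
  exists Phi : R -> R -> R, forall x y, box x0 y0 r x y ->
    differentiable_pt_lim Phi x y (P x y) (Q x y).
Proof.
intros H.
assert (HP : forall x y, box x0 y0 r x y -> continuity_2d_pt P x y).
{ intros x y Hxy; destruct (H x y Hxy) as [p [s [q [K _]]]].
  eapply differentiable_continuity; exact K. }
assert (HQ : forall x y, box x0 y0 r x y -> continuity_2d_pt Q x y).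
{ intros x y Hxy; destruct (H x y Hxy) as [p [s [q [_ K]]]].
  eapply differentiable_continuity; exact K. }
assert (E1 : forall a b c d, a <= b -> c <= d -> box x0 y0 r a c -> box x0 y0 r b d ->
  RInt (fun t => P t c) a b + RInt (fun t => Q b t) c d
  = RInt (fun t => Q a t) c d + RInt (fun t => P t d) a b).
{ intros a b c d Hab Hcd [Ha Hc] [Hb Hd].
  assert (K := rect_int_0 P Q a b c d Hab Hcd).
  unfold rect_int in K.
  rewrite (RInt_Rminus (fun x => P x c) (fun x => P x d)) in K;
    try (apply (ex_RInt_slice1 P x0 y0 r); [exact HP | split; assumption | split; assumption]).
  rewrite (RInt_Rminus (fun y => Q b y) (fun y => Q a y)) in K;
    try (apply (ex_RInt_slice2 Q x0 y0 r); [exact HQ | split; assumption | split; assumption]).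
  assert (K' := K (fun x y Hx Hy => H x y (conj
    (Rabs_between a b x x0 r Ha Hb ltac:(rewrite Rmin_left, Rmax_right; lra))
    (Rabs_between c d y y0 r Hc Hd ltac:(rewrite Rmin_left, Rmax_right; lra))))).
  lra. }
(* Exchanging the ends of a side reverses both integrals along that direction, so the order of the
   corners does not matter. *)
assert (E2 : forall a b c d, box x0 y0 r a c -> box x0 y0 r b d ->
  RInt (fun t => P t c) a b + RInt (fun t => Q b t) c d
  = RInt (fun t => Q a t) c d + RInt (fun t => P t d) a b).
{ intros a b c d [Ha Hc] [Hb Hd].
  destruct (Rle_dec a b) as [Hab|Hab]; destruct (Rle_dec c d) as [Hcd|Hcd];
    repeat match goal with N : ~ _ <= _ |- _ => apply Rnot_le_lt, Rlt_le in N end.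
  - apply E1; try assumption; split; assumption.
  - rewrite (RInt_Rswap (fun t => Q b t) d c), (RInt_Rswap (fun t => Q a t) d c);
      try (apply (ex_RInt_slice2 Q x0 y0 r); [exact HQ | split; assumption | split; assumption]).
    assert (K := E1 a b d c Hab Hcd (conj Ha Hd) (conj Hb Hc)); lra.
  - rewrite (RInt_Rswap (fun t => P t c) b a), (RInt_Rswap (fun t => P t d) b a);
      try (apply (ex_RInt_slice1 P x0 y0 r); [exact HP | split; assumption | split; assumption]).
    assert (K := E1 b a c d Hab Hcd (conj Hb Hc) (conj Ha Hd)); lra.
  - rewrite (RInt_Rswap (fun t => Q b t) d c), (RInt_Rswap (fun t => Q a t) d c);
      try (apply (ex_RInt_slice2 Q x0 y0 r); [exact HQ | split; assumption | split; assumption]).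
    rewrite (RInt_Rswap (fun t => P t c) b a), (RInt_Rswap (fun t => P t d) b a);
      try (apply (ex_RInt_slice1 P x0 y0 r); [exact HP | split; assumption | split; assumption]).
    assert (K := E1 b a d c Hab Hcd (conj Hb Hd) (conj Ha Hc)); lra. }
exists (fun x y => RInt (fun t => P t y0) x0 x + RInt (fun t => Q x t) y0 y).
intros x y Hxy.
assert (Hc : forall u v, box x0 y0 r u v -> box x0 y0 r x0 y0 /\ box x0 y0 r u y0 /\ box x0 y0 r x0 v).
{ intros u v [Hu Hv].
  assert (R0 : 0 < r) by (eapply Rle_lt_trans; [apply Rabs_pos | exact Hu]).
  repeat split; try assumption; rewrite Rminus_diag, Rabs_R0; exact R0. }
apply C1_differentiable.
- destruct (box_open _ _ _ _ _ Hxy) as [d Hd]; exists d; intros u v Hu Hv.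
  specialize (Hd u v Hu Hv).
  destruct (Hc u v Hd) as [B0 [B1 B2]].
  apply is_derive_ext_loc with
    (fun t => RInt (fun s => Q x0 s) y0 v + RInt (fun s => P s v) x0 t).
  + destruct (box_open _ _ _ _ _ Hd) as [e He].
    exists e; intros t Ht; symmetry; apply E2; [exact B0 |].
    apply He; [exact Ht | rewrite Rminus_diag, Rabs_R0; apply cond_pos].
  + replace (P u v) with (0 + P u v) by ring.
    apply (is_derive_plus (V := R_NormedModule)); [apply (is_derive_const (V := R_NormedModule)) |].
    apply (is_derive_RInt (V := R_NormedModule) (fun s => P s v)) with (a := x0).
    * destruct (box_open _ _ _ _ _ Hd) as [e He].
      exists e; intros t Ht; apply (RInt_correct (V := R_CompleteNormedModule)).
      apply (ex_RInt_slice1 P x0 y0 r); [exact HP | exact B2 |].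
      apply He; [exact Ht | rewrite Rminus_diag, Rabs_R0; apply cond_pos].
    * apply (continuity_2d_slice1 P), HP, Hd.
- replace (Q x y) with (0 + Q x y) by ring.
  destruct (Hc x y Hxy) as [B0 [B1 B2]].
  apply (is_derive_plus (V := R_NormedModule)); [apply (is_derive_const (V := R_NormedModule)) |].
  apply (is_derive_RInt (V := R_NormedModule) (fun s => Q x s)) with (a := y0).
  + destruct (box_open _ _ _ _ _ Hxy) as [e He].
    exists e; intros t Ht; apply (RInt_correct (V := R_CompleteNormedModule)).
    apply (ex_RInt_slice2 Q x0 y0 r); [exact HQ | exact B1 |].
    apply He; [rewrite Rminus_diag, Rabs_R0; apply cond_pos | exact Ht].
  + apply (continuity_2d_slice2 Q), HQ, Hxy.
- apply HP, Hxy.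
Qed.

(** * Holomorphic functions are smooth *)

Lemma continuity_2d_pt_continuous (f : R -> R -> R) (x y : R) :
  continuity_2d_pt f x y <-> continuous (fun p : R * R => f (fst p) (snd p)) (x, y).
Proof. apply continuity_2d_pt_filterlim. Qed.

Lemma continuous_comp_2d (f : R -> R -> R) (g h : R -> R) (t : R) :
  continuity_2d_pt f (g t) (h t) -> continuous g t -> continuous h t ->
  continuous (fun t => f (g t) (h t)) t.
Proof.
intros Hf Hg Hh; apply (continuous_comp_2 g h f); auto.
apply continuity_2d_pt_continuous; exact Hf.
Qed.

Lemma continuity_2d_pt_comp (f g h : R -> R -> R) (x y : R) :
  continuity_2d_pt f (g x y) (h x y) ->
  continuity_2d_pt g x y -> continuity_2d_pt h x y ->
  continuity_2d_pt (fun u v => f (g u v) (h u v)) x y.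
Proof.
rewrite !continuity_2d_pt_continuous; intros Hf Hg Hh.
apply (continuous_comp_2 (fun p : R * R => g (fst p) (snd p))
                         (fun p : R * R => h (fst p) (snd p)) f); auto.
Qed.

Lemma continuity_2d_pt_snd (g : R -> R) (x y : R) :
  continuous g y -> continuity_2d_pt (fun _ v => g v) x y.
Proof.
intros Hg; apply (continuity_1d_2d_pt_comp g (fun _ v => v)).
- apply continuity_pt_filterlim; exact Hg.
- apply continuity_2d_pt_id2.
Qed.

Lemma continuity_2d_pt_flip (f : R -> R -> R) (x y : R) :
  continuity_2d_pt f x y -> continuity_2d_pt (fun u v => f v u) y x.
Proof.
intros H eps; destruct (H eps) as [d Hd]; exists d; intros u v Hu Hv; auto.
Qed.

(** * Averages over circles and the gain of a derivative *)

Definition bounded_loop (g h : R -> R) (rho : R) : Prop :=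
  forall t, Rabs (g t) <= rho /\ Rabs (h t) <= rho /\ continuous g t /\ continuous h t.

(* Weighted averages over the translates of the loop [(g, h)]. *)
Definition loop_avg (g h c : R -> R) (K : R -> R -> R) (x y : R) : R :=
  RInt (fun t => K (x + g t) (y + h t) * c t) 0 (2 * PI).

(** Source of the two radii below: data are given on the box of radius [2 * rho] and averages are
    formed over the box of radius [rho], so each use of averages halves the radius. *)
Lemma loop_in_box (g h : R -> R) (rho x0 y0 x y t : R) :
  bounded_loop g h rho ->
  box x0 y0 rho x y -> box x0 y0 (2 * rho) (x + g t) (y + h t).
Proof.
intros L [Hx Hy]; destruct (L t) as [G [H _]]; split.
- replace (x + g t - x0) with ((x - x0) + g t) by ring.
  eapply Rle_lt_trans; [apply Rabs_triang | lra].
- replace (y + h t - y0) with ((y - y0) + h t) by ring.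
  eapply Rle_lt_trans; [apply Rabs_triang | lra].
Qed.

Lemma ex_RInt_loop (g h c : R -> R) (rho : R) (K : R -> R -> R) (x0 y0 x y : R) :
  bounded_loop g h rho -> (forall t, continuous c t) ->
  (forall u v, box x0 y0 (2 * rho) u v -> continuity_2d_pt K u v) ->
  box x0 y0 rho x y ->
  ex_RInt (fun t => K (x + g t) (y + h t) * c t) 0 (2 * PI).
Proof.
intros L Cc HK Hxy; apply (ex_RInt_continuous (V := R_CompleteNormedModule)); intros t _.
apply (continuous_mult (K := R_AbsRing)); [| apply Cc].
apply (continuous_comp_2d K (fun t => x + g t) (fun t => y + h t)).
- apply HK, loop_in_box, Hxy; exact L.
- apply (continuous_plus (V := R_NormedModule)); [apply continuous_const | apply (L t)].
- apply (continuous_plus (V := R_NormedModule)); [apply continuous_const | apply (L t)].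
Qed.

Lemma is_derive_loop_avg (g h c : R -> R) (rho : R) (K Kx : R -> R -> R) (x0 y0 x y : R) :
  bounded_loop g h rho -> (forall t, continuous c t) ->
  (forall u v, box x0 y0 (2 * rho) u v -> continuity_2d_pt K u v) ->
  (forall u v, box x0 y0 (2 * rho) u v -> continuity_2d_pt Kx u v) ->
  (forall u v, box x0 y0 (2 * rho) u v -> is_derive (fun s => K s v) u (Kx u v)) ->
  box x0 y0 rho x y ->
  is_derive (fun s => loop_avg g h c K s y) x (loop_avg g h c Kx x y).
Proof.
intros L Cc HK HKx HD Hxy.
assert (D : forall s t, box x0 y0 rho s y ->
  is_derive (fun u => K (u + g t) (y + h t) * c t) s (Kx (s + g t) (y + h t) * c t)).
{ intros s t Hs.
  apply (is_derive_ext (fun u => scal (c t) (K (u + g t) (y + h t)))).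
  { intros u; apply Rmult_comm. }
  replace (Kx (s + g t) (y + h t) * c t)
    with (scal (c t) (Kx (s + g t) (y + h t))) by apply Rmult_comm.
  apply (is_derive_scal (fun u => K (u + g t) (y + h t))).
  replace (Kx (s + g t) (y + h t)) with (scal 1 (Kx (s + g t) (y + h t)))
    by apply Rmult_1_l.
  apply (is_derive_comp (V := R_NormedModule) (fun u => K u (y + h t)) (fun u => u + g t)).
  - apply HD, loop_in_box, Hs; exact L.
  - replace 1 with (1 + 0) at 3 by ring.
    auto_derive; [exact I | ring]. }
destruct (box_open _ _ _ _ _ Hxy) as [e He].
assert (HL : forall s, ball x e s -> box x0 y0 rho s y).
{ intros s Hs; apply He; [exact Hs | rewrite Rminus_diag, Rabs_R0; apply cond_pos]. }
replace (loop_avg g h c Kx x y)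
  with (RInt (fun t => Derive (fun u => K (u + g t) (y + h t) * c t) x) 0 (2 * PI))
  by (apply RInt_Rext; intros t; apply is_derive_unique, D, Hxy).
apply is_derive_RInt_param.
- exists e; intros s Hs t _; eexists; apply D, HL, Hs.
- intros t _.
  apply (continuity_2d_pt_ext_loc (fun u v => Kx (u + g v) (y + h v) * c v)).
  { exists e; intros u v Hu _; symmetry; apply is_derive_unique, D, HL, Hu. }
  apply continuity_2d_pt_mult; [| apply continuity_2d_pt_snd, Cc].
  apply (continuity_2d_pt_comp Kx (fun u v => u + g v) (fun u v => y + h v)).
  + apply HKx, loop_in_box, Hxy; exact L.
  + apply continuity_2d_pt_plus; [apply continuity_2d_pt_id1 |].
    apply continuity_2d_pt_snd, (L t).
  + apply continuity_2d_pt_plus; [apply continuity_2d_pt_const |].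
    apply continuity_2d_pt_snd, (L t).
- exists e; intros s Hs; apply ex_RInt_loop with rho x0 y0; auto.
Qed.

Lemma continuity_loop_avg (g h c : R -> R) (rho : R) (K : R -> R -> R) (x0 y0 x y : R) :
  bounded_loop g h rho -> (forall t, continuous c t) ->
  (forall t, Rabs (c t) <= 1) ->
  (forall u v, box x0 y0 (2 * rho) u v -> continuity_2d_pt K u v) ->
  box x0 y0 rho x y ->
  continuity_2d_pt (loop_avg g h c K) x y.
Proof.
intros L Cc Hc HK Hxy eps.
destruct (box_open _ _ _ _ _ Hxy) as [e He].
assert (P0 := PI_RGT_0); assert (Pe := cond_pos e).
assert (Heps : 0 < eps / (4 * PI)) by (apply Rdiv_lt_0_compat; [apply cond_pos | lra]).
(* This compact rectangle contains every loop centred within [e / 2] of [(x, y)]; it stays inside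
   the large box because the points at distance [e / 2] are still in the small one. The tolerance
   [eps / (4 * PI)] integrates over a full turn to [eps / 2]. *)
destruct (uniform_continuity_2d K (x - e / 2 - rho) (x + e / 2 + rho)
           (y - e / 2 - rho) (y + e / 2 + rho)) with (eps := mkposreal _ Heps) as [d Hd].
{ intros u v Hu Hv; apply HK.
  assert (B : forall w a0 a, a - e / 2 - rho <= w <= a + e / 2 + rho ->
     (forall s, Rabs (s - a) < e -> Rabs (s - a0) < rho) -> Rabs (w - a0) < 2 * rho).
  { intros w a0 a Hw Hs.
    assert (S1 := Hs (a + e / 2)); assert (S2 := Hs (a - e / 2)).
    replace (a + e / 2 - a) with (e / 2) in S1 by ring.
    replace (a - e / 2 - a) with (- (e / 2)) in S2 by ring.
    rewrite Rabs_Ropp in S2; rewrite Rabs_right in S1, S2 by lra.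
    specialize (S1 ltac:(lra)); specialize (S2 ltac:(lra)).
    apply Rabs_lt_between in S1; apply Rabs_lt_between in S2.
    apply Rabs_lt_between; lra. }
  split.
  - apply (B u x0 x); [lra |]; intros s Hs; apply (He s y Hs).
    rewrite Rminus_diag, Rabs_R0; exact Pe.
  - apply (B v y0 y); [lra |]; intros s Hs; apply (He x s); [| exact Hs].
    rewrite Rminus_diag, Rabs_R0; exact Pe. }
assert (Hd' : 0 < Rmin d (e / 2)) by (apply Rmin_pos; [apply cond_pos | lra]).
exists (mkposreal _ Hd'); simpl; intros u v Hu Hv.
assert (L1 := Rmin_l d (e / 2)); assert (L2 := Rmin_r d (e / 2)).
assert (Huv : box x0 y0 rho u v) by (apply He; lra).
unfold loop_avg.
rewrite <- RInt_Rminus by (eapply ex_RInt_loop; eassumption).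
apply Rle_lt_trans with ((2 * PI - 0) * (eps / (4 * PI))).
- apply abs_RInt_le_const; [lra | |].
  + apply (ex_RInt_minus (V := R_NormedModule)); eapply ex_RInt_loop; eassumption.
  + intros t _.
    replace (K (u + g t) (v + h t) * c t - K (x + g t) (y + h t) * c t)
      with ((K (u + g t) (v + h t) - K (x + g t) (y + h t)) * c t) by ring.
    rewrite Rabs_mult.
    destruct (L t) as [G [H _]]; specialize (Hc t).
    apply Rabs_le_between in G; apply Rabs_le_between in H.
    apply Rabs_lt_between in Hu; apply Rabs_lt_between in Hv.
    assert (B : Rabs (K (u + g t) (v + h t) - K (x + g t) (y + h t)) < eps / (4 * PI)).
    { apply Hd; try lra; apply Rabs_lt_between; lra. }
    assert (B0 := Rabs_pos (K (u + g t) (v + h t) - K (x + g t) (y + h t))).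
    assert (B1 := Rabs_pos (c t)).
    nra.
- assert (E : (2 * PI - 0) * (eps / (4 * PI)) = eps / 2) by (field; lra).
  rewrite E; assert (P := cond_pos eps); lra.
Qed.

(* [u + i v] is holomorphic on the box, with continuous derivative [a + i b]. *)
Definition holo_C1 (x0 y0 r : R) (u v a b : R -> R -> R) : Prop :=
  forall x y, box x0 y0 r x y ->
    differentiable_pt_lim u x y (a x y) (- b x y) /\
    differentiable_pt_lim v x y (b x y) (a x y) /\
    continuity_2d_pt a x y /\ continuity_2d_pt b x y.

(** This is multiplication by [-i], which takes [u + iv] to [v - iu] and [a + ib] to [b - ia].
    Formulas proved for the real part thereby carry over to the imaginary part. *)
Lemma holo_C1_rotate (x0 y0 r : R) (u v a b : R -> R -> R) :
  holo_C1 x0 y0 r u v a b ->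
  holo_C1 x0 y0 r v (fun x y => - u x y) b (fun x y => - a x y).
Proof.
intros H x y Hxy; destruct (H x y Hxy) as [H1 [H2 [H3 H4]]].
rewrite Ropp_involutive; repeat split; try assumption.
- intros eps; destruct (H1 eps) as [d Hd]; exists d; intros s t Hs Ht.
  specialize (Hd s t Hs Ht); rewrite <- Rabs_Ropp in Hd.
  eapply Rle_trans; [right | exact Hd]; f_equal; ring.
- apply continuity_2d_pt_opp; assumption.
Qed.

Lemma circle_bounded_loop (rho : R) :
  0 <= rho -> bounded_loop (fun t => rho * cos t) (fun t => rho * sin t) rho.
Proof.
intros Hr t.
assert (C := COS_bound t); assert (S := SIN_bound t).
repeat split.
- apply Rabs_le; nra.
- apply Rabs_le; nra.
- apply (continuous_scal_r rho cos t), continuous_cos.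
- apply (continuous_scal_r rho sin t), continuous_sin.
Qed.

Lemma is_derive_along_curve (f : R -> R -> R) (X Y : R -> R) (t fx fy X' Y' : R) :
  differentiable_pt_lim f (X t) (Y t) fx fy ->
  is_derive X t X' -> is_derive Y t Y' ->
  is_derive (fun s => f (X s) (Y s)) t (fx * X' + fy * Y').
Proof.
intros H HX HY; apply is_derive_Reals.
apply derivable_pt_lim_comp_2d; [exact H | |]; apply is_derive_Reals; assumption.
Qed.

Lemma is_RInt_full_turn (F F' : R -> R) :
  (forall t, is_derive F t (F' t)) -> (forall t, continuous F' t) ->
  F (2 * PI) = F 0 -> RInt F' 0 (2 * PI) = 0.
Proof.
intros HF HF' E.
apply (is_RInt_unique (V := R_CompleteNormedModule)).
replace 0 with (minus (F (2 * PI)) (F 0)) at 2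
  by (rewrite E; apply (minus_eq_zero (G := R_AbelianGroup))).
apply (is_RInt_derive (V := R_CompleteNormedModule)); auto.
Qed.

(** The integral [m s] over the circle of radius [s] does not depend on [s]. At radius [rho] it is
    the left-hand side, and at radius 0 its integrand is the constant [u x y]. *)
Lemma mean_value_circle (x0 y0 rho : R) (u v a b : R -> R -> R) (x y : R) :
  holo_C1 x0 y0 (2 * rho) u v a b -> box x0 y0 rho x y ->
  RInt (fun t => u (x + rho * cos t) (y + rho * sin t)) 0 (2 * PI) = 2 * PI * u x y.
Proof.
intros H [Hx Hy].
assert (Hrho : 0 < rho) by (eapply Rle_lt_trans; [apply Rabs_pos | exact Hx]).
set (m := fun s : R => RInt (fun t => u (x + s * cos t) (y + s * sin t)) 0 (2 * PI) : R).
set (f' := fun s t => a (x + s * cos t) (y + s * sin t) * cos t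
                      - b (x + s * cos t) (y + s * sin t) * sin t).
(* [M] is the distance from the centre of the box, so circles of radius below [2 * rho - M] fit in
   the large box. Since [M < rho], the radius [rho] is among them with room to spare. *)
set (M := Rmax (Rabs (x - x0)) (Rabs (y - y0))).
assert (HM : M < rho) by (apply Rmax_lub_lt; assumption).
assert (M1 : Rabs (x - x0) <= M) by apply Rmax_l.
assert (M2 : Rabs (y - y0) <= M) by apply Rmax_r.
assert (B : forall s t, Rabs s < 2 * rho - M -> box x0 y0 (2 * rho) (x + s * cos t) (y + s * sin t)).
{ intros s t Hs; assert (C := COS_bound t); assert (S := SIN_bound t).
  assert (P := Rabs_pos s).
  split.
  - replace (x + s * cos t - x0) with ((x - x0) + s * cos t) by ring.
    eapply Rle_lt_trans; [apply Rabs_triang |].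
    assert (Rabs (s * cos t) <= Rabs s).
    { rewrite Rabs_mult; assert (Rabs (cos t) <= 1) by (apply Rabs_le; lra).
      assert (P' := Rabs_pos (cos t)); nra. }
    lra.
  - replace (y + s * sin t - y0) with ((y - y0) + s * sin t) by ring.
    eapply Rle_lt_trans; [apply Rabs_triang |].
    assert (Rabs (s * sin t) <= Rabs s).
    { rewrite Rabs_mult; assert (Rabs (sin t) <= 1) by (apply Rabs_le; lra).
      assert (P' := Rabs_pos (sin t)); nra. }
    lra. }
assert (XC : forall s t, continuous (fun t => x + s * cos t) t).
{ intros s t; apply (continuous_plus (V := R_NormedModule)); [apply continuous_const |].
  apply (continuous_scal_r s cos), continuous_cos. }
assert (YC : forall s t, continuous (fun t => y + s * sin t) t).
{ intros s t; apply (continuous_plus (V := R_NormedModule)); [apply continuous_const |].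
  apply (continuous_scal_r s sin), continuous_sin. }
assert (D : forall s t, Rabs s < 2 * rho - M ->
  is_derive (fun s => u (x + s * cos t) (y + s * sin t)) s (f' s t)).
{ intros s t Hs; unfold f'.
  replace (a (x + s * cos t) (y + s * sin t) * cos t
           - b (x + s * cos t) (y + s * sin t) * sin t)
    with (a (x + s * cos t) (y + s * sin t) * cos t
          + - b (x + s * cos t) (y + s * sin t) * sin t) by ring.
  apply (is_derive_along_curve u (fun s => x + s * cos t) (fun s => y + s * sin t)).
  - apply H, B, Hs.
  - auto_derive; [exact I | ring].
  - auto_derive; [exact I | ring]. }
assert (N : forall s, Rabs s < 2 * rho - M -> locally s (fun r => Rabs r < 2 * rho - M)).
{ intros s Hs; assert (P : 0 < 2 * rho - M - Rabs s) by lra.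
  exists (mkposreal _ P); intros r Hr.
  change (Rabs (r - s) < 2 * rho - M - Rabs s) in Hr.
  replace r with ((r - s) + s) by ring.
  eapply Rle_lt_trans; [apply Rabs_triang | lra]. }
assert (ab_cont : forall s t, Rabs s < 2 * rho - M ->
  continuity_2d_pt f' s t).
{ intros s t Hs; apply continuity_2d_pt_minus; (apply continuity_2d_pt_mult;
    [| apply continuity_2d_pt_snd; first [apply continuous_cos | apply continuous_sin]]).
  - apply (continuity_2d_pt_comp a (fun s t => x + s * cos t) (fun s t => y + s * sin t)).
    + apply H, B, Hs.
    + apply continuity_2d_pt_plus; [apply continuity_2d_pt_const |].
      apply continuity_2d_pt_mult; [apply continuity_2d_pt_id1 |].
      apply continuity_2d_pt_snd, continuous_cos.
    + apply continuity_2d_pt_plus; [apply continuity_2d_pt_const |].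
      apply continuity_2d_pt_mult; [apply continuity_2d_pt_id1 |].
      apply continuity_2d_pt_snd, continuous_sin.
  - apply (continuity_2d_pt_comp b (fun s t => x + s * cos t) (fun s t => y + s * sin t)).
    + apply H, B, Hs.
    + apply continuity_2d_pt_plus; [apply continuity_2d_pt_const |].
      apply continuity_2d_pt_mult; [apply continuity_2d_pt_id1 |].
      apply continuity_2d_pt_snd, continuous_cos.
    + apply continuity_2d_pt_plus; [apply continuity_2d_pt_const |].
      apply continuity_2d_pt_mult; [apply continuity_2d_pt_id1 |].
      apply continuity_2d_pt_snd, continuous_sin. }
assert (Dm : forall s, Rabs s < 2 * rho - M ->
  is_derive m s (RInt (fun t => f' s t) 0 (2 * PI))).
{ intros s Hs.
  replace (RInt (fun t => f' s t) 0 (2 * PI)) with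
    (RInt (fun t => Derive (fun s => u (x + s * cos t) (y + s * sin t)) s) 0 (2 * PI))
    by (apply RInt_Rext; intros t; apply is_derive_unique, D, Hs).
  unfold m; apply is_derive_RInt_param.
  - destruct (N s Hs) as [e He]; exists e; intros r Hr t _.
    eexists; apply D, He, Hr.
  - intros t _; apply (continuity_2d_pt_ext_loc f'); [| apply ab_cont, Hs].
    destruct (N s Hs) as [e He]; exists e; intros r w Hr _.
    symmetry; apply is_derive_unique, D, He, Hr.
  - destruct (N s Hs) as [e He]; exists e; intros r Hr.
    apply (ex_RInt_continuous (V := R_CompleteNormedModule)); intros t _.
    apply (continuous_comp_2d u (fun t => x + r * cos t) (fun t => y + r * sin t));
      [| apply XC | apply YC].
    eapply differentiable_continuity; apply H, B, He, Hr. }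
(* By Cauchy-Riemann, [s * f' s t] is the derivative in [t] of [v] along the
   circle of radius [s]. *)
assert (Z : forall s, 0 < s < 2 * rho - M -> RInt (fun t => f' s t) 0 (2 * PI) = 0).
{ intros s Hs.
  assert (Hs' : Rabs s < 2 * rho - M) by (rewrite Rabs_right; lra).
  apply (is_RInt_full_turn (fun t => / s * v (x + s * cos t) (y + s * sin t))).
  - intros t.
    replace (f' s t) with (/ s * (b (x + s * cos t) (y + s * sin t) * (- s * sin t)
        + a (x + s * cos t) (y + s * sin t) * (s * cos t)))
      by (unfold f'; field; lra).
    apply (is_derive_scal (fun t => v (x + s * cos t) (y + s * sin t))).
    apply (is_derive_along_curve v (fun t => x + s * cos t) (fun t => y + s * sin t)).
    + apply H, B, Hs'.
    + auto_derive; [exact I | ring].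
    + auto_derive; [exact I | ring].
  - intros t; apply continuity_2d_slice2, ab_cont, Hs'.
  - rewrite cos_2PI, sin_2PI, cos_0, sin_0; reflexivity. }
(* The intermediate radius [c] is strictly positive, so [Z], which divides by the radius, applies to
   it. *)
destruct (MVT_cor2 m (fun s => RInt (fun t => f' s t) 0 (2 * PI)) 0 rho Hrho) as [c [Ec Hc]].
{ intros s Hs; apply is_derive_Reals, Dm; rewrite Rabs_right; lra. }
rewrite Z in Ec by lra.
replace (2 * PI * u x y) with (m 0).
{ unfold m in Ec |- *; lra. }
unfold m; rewrite (RInt_Rext _ (fun _ => u x y)); [rewrite RInt_Rconst, Rminus_0_r; reflexivity |].
intros t; rewrite !Rmult_0_l, !Rplus_0_r; reflexivity.
Qed.

Definition circle_avg (rho : R) (c : R -> R) : (R -> R -> R) -> R -> R -> R :=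
  loop_avg (fun t => rho * cos t) (fun t => rho * sin t) c.

(* Differentiate the mean value formula, then integrate by parts. *)
Lemma derivative_circle_avg (x0 y0 rho : R) (u v a b : R -> R -> R) (x y : R) :
  holo_C1 x0 y0 (2 * rho) u v a b -> box x0 y0 rho x y ->
  a x y = / (2 * PI * rho) * (circle_avg rho cos u x y + circle_avg rho sin v x y).
Proof.
intros H Hxy.
assert (Hrho : 0 < rho) by (destruct Hxy as [Hx _]; eapply Rle_lt_trans; [apply Rabs_pos | exact Hx]).
assert (P0 := PI_RGT_0).
assert (L := circle_bounded_loop rho (Rlt_le _ _ Hrho)).
assert (E1 : circle_avg rho (fun _ => 1) a x y = 2 * PI * a x y).
{ assert (D : is_derive (fun s => circle_avg rho (fun _ => 1) u s y) x
                (circle_avg rho (fun _ => 1) a x y)).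
  { apply (is_derive_loop_avg _ _ _ rho u a x0 y0); auto.
    - intros t; apply continuous_const.
    - intros s t Hst; eapply differentiable_continuity; apply H, Hst.
    - intros s t Hst; apply H, Hst.
    - intros s t Hst; eapply differentiable_slice1; apply H, Hst. }
  assert (D' : is_derive (fun s => circle_avg rho (fun _ => 1) u s y) x (2 * PI * a x y)).
  { apply (is_derive_ext_loc (fun s => 2 * PI * u s y)).
    - destruct (box_open _ _ _ _ _ Hxy) as [e He]; exists e; intros s Hs.
      assert (Bs : box x0 y0 rho s y)
        by (apply He; [exact Hs | rewrite Rminus_diag, Rabs_R0; apply cond_pos]).
      rewrite <- (mean_value_circle x0 y0 rho u v a b s y H Bs).
      apply RInt_Rext; intros t; symmetry; apply Rmult_1_r.
    - apply (is_derive_scal (fun s => u s y)); eapply differentiable_slice1; apply H.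
      destruct Hxy; split; lra. }
  rewrite <- (is_derive_unique _ _ _ D); exact (is_derive_unique _ _ _ D'). }
assert (C1 : forall u, (forall s t, box x0 y0 (2 * rho) s t -> continuity_2d_pt u s t) ->
   forall c, (forall t, continuous c t) -> forall t,
   continuous (fun t => u (x + rho * cos t) (y + rho * sin t) * c t) t).
{ intros w Hw c Hc t; apply (continuous_mult (K := R_AbsRing)); [| apply Hc].
  apply (continuous_comp_2d w (fun t => x + rho * cos t) (fun t => y + rho * sin t)).
  - apply Hw, (loop_in_box (fun t => rho * cos t) (fun t => rho * sin t)); assumption.
  - apply (continuous_plus (V := R_NormedModule)); [apply continuous_const | apply (L t)].
  - apply (continuous_plus (V := R_NormedModule)); [apply continuous_const | apply (L t)]. }
assert (Cu : forall s t, box x0 y0 (2 * rho) s t -> continuity_2d_pt u s t)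
  by (intros s t Hst; eapply differentiable_continuity; apply H, Hst).
assert (Cv : forall s t, box x0 y0 (2 * rho) s t -> continuity_2d_pt v s t)
  by (intros s t Hst; eapply differentiable_continuity; apply H, Hst).
assert (Ca : forall s t, box x0 y0 (2 * rho) s t -> continuity_2d_pt a s t)
  by (intros s t Hst; apply H, Hst).
assert (I1 := fun w Hw c Hc => ex_RInt_continuous (V := R_CompleteNormedModule) _ 0 (2 * PI)
                   (fun t _ => C1 w Hw c Hc t)).
(* The integrand is the derivative of [v cos t - u sin t], the imaginary part of
   [(u + iv) exp(-it)], along the circle; by Cauchy-Riemann the derivatives of [u] and [v] combine
   to [rho * a]. The outcome is the real part of Cauchy's integral formula for the derivative. *)
assert (E2 : RInt (fun t => rho * (a (x + rho * cos t) (y + rho * sin t) * 1)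
     - (u (x + rho * cos t) (y + rho * sin t) * cos t
        + v (x + rho * cos t) (y + rho * sin t) * sin t)) 0 (2 * PI) = 0).
{ apply (is_RInt_full_turn (fun t => v (x + rho * cos t) (y + rho * sin t) * cos t
           - u (x + rho * cos t) (y + rho * sin t) * sin t)).
  - intros t.
    assert (Bt := loop_in_box _ _ _ _ _ _ _ t L Hxy); simpl in Bt.
    destruct (H _ _ Bt) as [H1 [H2 _]].
    assert (DX : is_derive (fun t => x + rho * cos t) t (- rho * sin t))
      by (auto_derive; [exact I | ring]).
    assert (DY : is_derive (fun t => y + rho * sin t) t (rho * cos t))
      by (auto_derive; [exact I | ring]).
    assert (Du := is_derive_along_curve u _ _ t _ _ _ _ H1 DX DY).
    assert (Dv := is_derive_along_curve v _ _ t _ _ _ _ H2 DX DY).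
    set (U := fun t => u (x + rho * cos t) (y + rho * sin t)) in *.
    set (V := fun t => v (x + rho * cos t) (y + rho * sin t)) in *.
    change (u (x + rho * cos t) (y + rho * sin t)) with (U t).
    change (v (x + rho * cos t) (y + rho * sin t)) with (V t).
    apply (is_derive_ext (fun t => V t * cos t - U t * sin t)); [reflexivity |].
    auto_derive.
    + repeat split; eexists; eassumption.
    + replace (Derive (fun x => V x) t) with (Derive V t) by reflexivity.
      replace (Derive (fun x => U x) t) with (Derive U t) by reflexivity.
      rewrite (is_derive_unique U t _ Du), (is_derive_unique V t _ Dv).
      assert (S := sin2_cos2 t); unfold Rsqr in S.
      set (A := a (x + rho * cos t) (y + rho * sin t)).
      set (B := b (x + rho * cos t) (y + rho * sin t)).
      replace (rho * (A * 1)) with (rho * (A * (sin t * sin t + cos t * cos t)))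
        by (rewrite S; ring).
      ring.
  - intros t; apply (continuous_minus (V := R_NormedModule)).
    + apply (continuous_scal_r rho (fun t => a (x + rho * cos t) (y + rho * sin t) * 1)).
      apply (C1 a Ca (fun _ => 1)); intros; apply continuous_const.
    + apply (continuous_plus (V := R_NormedModule)).
      * apply (C1 u Cu cos), continuous_cos.
      * apply (C1 v Cv sin), continuous_sin.
  - rewrite cos_2PI, sin_2PI, cos_0, sin_0; reflexivity. }
assert (Ea := I1 a Ca (fun _ => 1) (fun t => continuous_const 1 t)).
assert (Eu := I1 u Cu cos continuous_cos).
assert (Ev := I1 v Cv sin continuous_sin).
simpl in Ea, Eu, Ev.
rewrite RInt_Rminus in E2.
2: apply (ex_RInt_scal (V := R_NormedModule)), Ea.
2: apply (ex_RInt_plus (V := R_NormedModule)); assumption.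
rewrite RInt_Rplus in E2 by assumption.
assert (E3 := RInt_scal (V := R_CompleteNormedModule) _ 0 (2 * PI) rho Ea).
change (RInt (fun t => rho * (a (x + rho * cos t) (y + rho * sin t) * 1)) 0 (2 * PI)
        = rho * circle_avg rho (fun _ => 1) a x y) in E3.
rewrite E3, E1 in E2.
change (rho * (2 * PI * a x y) - (circle_avg rho cos u x y + circle_avg rho sin v x y) = 0) in E2.
apply Rmult_eq_reg_l with (2 * PI * rho); [| nra].
rewrite <- Rmult_assoc, Rinv_r, Rmult_1_l by nra.
lra.
Qed.

Lemma circle_avg_derives (x0 y0 rho : R) (c : R -> R) (K Kx Ky : R -> R -> R) (x y : R) :
  (forall t, continuous c t) ->
  (forall s t, box x0 y0 (2 * rho) s t ->
     differentiable_pt_lim K s t (Kx s t) (Ky s t) /\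
     continuity_2d_pt Kx s t /\ continuity_2d_pt Ky s t) ->
  box x0 y0 rho x y ->
  is_derive (fun s => circle_avg rho c K s y) x (circle_avg rho c Kx x y) /\
  is_derive (fun t => circle_avg rho c K x t) y (circle_avg rho c Ky x y).
Proof.
intros Hc H Hxy.
assert (Hrho : 0 <= rho) by (destruct Hxy as [Hx _]; left; eapply Rle_lt_trans; [apply Rabs_pos | exact Hx]).
assert (L := circle_bounded_loop rho Hrho).
split.
- apply (is_derive_loop_avg _ _ _ rho K Kx x0 y0); auto.
  + intros s t Hst; eapply differentiable_continuity; apply H, Hst.
  + intros s t Hst; apply H, Hst.
  + intros s t Hst; eapply differentiable_slice1; apply H, Hst.
(* The second variable is reduced to the first by exchanging the coordinates, which also exchanges
   the components of the loop. *)
- apply (is_derive_loop_avg (fun t => rho * sin t) (fun t => rho * cos t) c rho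
           (fun s t => K t s) (fun s t => Ky t s) y0 x0); auto.
  + intros t; destruct (L t) as [? [? [? ?]]]; repeat split; assumption.
  + intros s t [Hs Ht]; apply (continuity_2d_pt_flip K).
    eapply differentiable_continuity; apply H; split; assumption.
  + intros s t [Hs Ht]; apply (continuity_2d_pt_flip Ky), H; split; assumption.
  + intros s t [Hs Ht]; apply (differentiable_slice2 K t s (Kx t s)), H; split; assumption.
  + destruct Hxy; split; assumption.
Qed.

Lemma circle_avg_opp (x0 y0 rho : R) (c : R -> R) (K : R -> R -> R) (x y : R) :
  (forall t, continuous c t) ->
  (forall s t, box x0 y0 (2 * rho) s t -> continuity_2d_pt K s t) ->
  box x0 y0 rho x y ->
  circle_avg rho c (fun s t => - K s t) x y = - circle_avg rho c K x y.
Proof.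
intros Hc H Hxy.
assert (Hrho : 0 <= rho) by (destruct Hxy as [Hx _]; left; eapply Rle_lt_trans; [apply Rabs_pos | exact Hx]).
assert (L := circle_bounded_loop rho Hrho).
assert (E := ex_RInt_loop _ _ c rho K x0 y0 x y L Hc H Hxy).
assert (O := RInt_opp (V := R_CompleteNormedModule) _ _ _ E).
unfold circle_avg, loop_avg.
transitivity (RInt (fun t => opp (K (x + rho * cos t) (y + rho * sin t) * c t)) 0 (2 * PI)).
- apply RInt_Rext; intros t; apply Ropp_mult_distr_l_reverse.
- exact O.
Qed.

Lemma Rabs_cos_le_1 (t : R) : Rabs (cos t) <= 1.
Proof. apply Rabs_le, COS_bound. Qed.

Lemma Rabs_sin_le_1 (t : R) : Rabs (sin t) <= 1.
Proof. apply Rabs_le, SIN_bound. Qed.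

Lemma continuity_circle_avg (x0 y0 rho : R) (c : R -> R) (K : R -> R -> R) (x y : R) :
  (forall t, continuous c t) -> (forall t, Rabs (c t) <= 1) ->
  (forall s t, box x0 y0 (2 * rho) s t -> continuity_2d_pt K s t) ->
  box x0 y0 rho x y ->
  continuity_2d_pt (circle_avg rho c K) x y.
Proof.
intros Hc Hc1 H Hxy.
assert (Hrho : 0 <= rho) by (destruct Hxy as [Hx _]; left; eapply Rle_lt_trans; [apply Rabs_pos | exact Hx]).
apply (continuity_loop_avg _ _ _ rho K x0 y0); auto.
apply circle_bounded_loop, Hrho.
Qed.

(** [a] and [b] are circle averages of [u] and [v], whose partial derivatives are [a] and [b] up to
    sign. Hence the partial derivatives of [a] and [b] are circle averages of [a] and [b], and such
    averages are continuous. *)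
Lemma holo_C1_derivative (x0 y0 rho : R) (u v a b : R -> R -> R) :
  holo_C1 x0 y0 (2 * rho) u v a b ->
  exists a1 b1, holo_C1 x0 y0 rho a b a1 b1.
Proof.
intros H.
assert (H' := holo_C1_rotate _ _ _ _ _ _ _ H).
set (k := / (2 * PI * rho)).
(* These are the averages of [derivative_circle_avg] with the pair [(a, b)] in place of [(u, v)];
   [b1] is the same expression for the rotated pair [(b, -a)]. *)
set (a1 := fun x y => k * (circle_avg rho cos a x y + circle_avg rho sin b x y)).
set (b1 := fun x y => k * (circle_avg rho cos b x y
                           + circle_avg rho sin (fun s t => - a s t) x y)).
exists a1, b1.
assert (Hu : forall s t, box x0 y0 (2 * rho) s t ->
  differentiable_pt_lim u s t (a s t) (- b s t) /\
  continuity_2d_pt a s t /\ continuity_2d_pt (fun s t => - b s t) s t).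
{ intros s t Hst; destruct (H s t Hst) as [? [? [? ?]]]; repeat split; auto.
  apply continuity_2d_pt_opp; assumption. }
assert (Hv : forall s t, box x0 y0 (2 * rho) s t ->
  differentiable_pt_lim v s t (b s t) (a s t) /\
  continuity_2d_pt b s t /\ continuity_2d_pt a s t).
{ intros s t Hst; destruct (H s t Hst) as [? [? [? ?]]]; repeat split; auto. }
assert (Hnu : forall s t, box x0 y0 (2 * rho) s t ->
  differentiable_pt_lim (fun s t => - u s t) s t (- a s t) (b s t) /\
  continuity_2d_pt (fun s t => - a s t) s t /\ continuity_2d_pt b s t).
{ intros s t Hst; destruct (H' s t Hst) as [? [? [? ?]]]; repeat split; auto. }
assert (Ca1 : forall x y, box x0 y0 rho x y -> continuity_2d_pt a1 x y).
{ intros x y Hxy; apply continuity_2d_pt_mult; [apply continuity_2d_pt_const |].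
  apply continuity_2d_pt_plus; apply (continuity_circle_avg x0 y0); auto using
    Rabs_cos_le_1, Rabs_sin_le_1, continuous_cos, continuous_sin; intros s t Hst.
  - apply Hu, Hst.
  - apply Hv, Hst. }
assert (Cb1 : forall x y, box x0 y0 rho x y -> continuity_2d_pt b1 x y).
{ intros x y Hxy; apply continuity_2d_pt_mult; [apply continuity_2d_pt_const |].
  apply continuity_2d_pt_plus; apply (continuity_circle_avg x0 y0); auto using
    Rabs_cos_le_1, Rabs_sin_le_1, continuous_cos, continuous_sin; intros s t Hst.
  - apply Hv, Hst.
  - apply Hnu, Hst. }
assert (Ea : forall x y, box x0 y0 rho x y ->
  a x y = k * (circle_avg rho cos u x y + circle_avg rho sin v x y))
  by (intros x y Hxy; apply (derivative_circle_avg x0 y0 rho u v a b); assumption).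
assert (Eb : forall x y, box x0 y0 rho x y ->
  b x y = k * (circle_avg rho cos v x y + circle_avg rho sin (fun s t => - u s t) x y))
  by (intros x y Hxy; apply (derivative_circle_avg x0 y0 rho v _ b (fun s t => - a s t)); assumption).
assert (Dax : forall x y, box x0 y0 rho x y -> is_derive (fun s => a s y) x (a1 x y)).
{ intros x y Hxy.
  apply (is_derive_ext_loc (fun s => k * (circle_avg rho cos u s y + circle_avg rho sin v s y))).
  - destruct (box_open _ _ _ _ _ Hxy) as [e He]; exists e; intros s Hs; symmetry; apply Ea, He.
    + exact Hs.
    + rewrite Rminus_diag, Rabs_R0; apply cond_pos.
  - apply (is_derive_scal (fun s => circle_avg rho cos u s y + circle_avg rho sin v s y)).
    apply (is_derive_plus (V := R_NormedModule)).
    + apply (circle_avg_derives x0 y0 rho cos u a _ x y continuous_cos Hu Hxy).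
    + apply (circle_avg_derives x0 y0 rho sin v b _ x y continuous_sin Hv Hxy). }
assert (Day : forall x y, box x0 y0 rho x y -> is_derive (fun t => a x t) y (- b1 x y)).
{ intros x y Hxy.
  apply (is_derive_ext_loc (fun t => k * (circle_avg rho cos u x t + circle_avg rho sin v x t))).
  - destruct (box_open _ _ _ _ _ Hxy) as [e He]; exists e; intros s Hs; symmetry; apply Ea, He.
    + rewrite Rminus_diag, Rabs_R0; apply cond_pos.
    + exact Hs.
  - replace (- b1 x y) with
      (k * (circle_avg rho cos (fun s t => - b s t) x y + circle_avg rho sin a x y)).
    + apply (is_derive_scal (fun t => circle_avg rho cos u x t + circle_avg rho sin v x t)).
      apply (is_derive_plus (V := R_NormedModule)).
      * apply (circle_avg_derives x0 y0 rho cos u a _ x y continuous_cos Hu Hxy).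
      * apply (circle_avg_derives x0 y0 rho sin v b _ x y continuous_sin Hv Hxy).
    + unfold b1.
      rewrite (circle_avg_opp x0 y0 rho cos b), (circle_avg_opp x0 y0 rho sin a); auto using
        continuous_cos, continuous_sin.
      * ring.
      * intros s t Hst; apply Hv, Hst.
      * intros s t Hst; apply Hv, Hst. }
assert (Dbx : forall x y, box x0 y0 rho x y -> is_derive (fun s => b s y) x (b1 x y)).
{ intros x y Hxy.
  apply (is_derive_ext_loc (fun s => k * (circle_avg rho cos v s y
           + circle_avg rho sin (fun s t => - u s t) s y))).
  - destruct (box_open _ _ _ _ _ Hxy) as [e He]; exists e; intros s Hs; symmetry; apply Eb, He.
    + exact Hs.
    + rewrite Rminus_diag, Rabs_R0; apply cond_pos.
  - apply (is_derive_scal (fun s => circle_avg rho cos v s y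
           + circle_avg rho sin (fun s t => - u s t) s y)).
    apply (is_derive_plus (V := R_NormedModule)).
    + apply (circle_avg_derives x0 y0 rho cos v b _ x y continuous_cos Hv Hxy).
    + apply (circle_avg_derives x0 y0 rho sin _ (fun s t => - a s t) _ x y continuous_sin Hnu Hxy). }
assert (Dby : forall x y, box x0 y0 rho x y -> is_derive (fun t => b x t) y (a1 x y)).
{ intros x y Hxy.
  apply (is_derive_ext_loc (fun t => k * (circle_avg rho cos v x t
           + circle_avg rho sin (fun s t => - u s t) x t))).
  - destruct (box_open _ _ _ _ _ Hxy) as [e He]; exists e; intros s Hs; symmetry; apply Eb, He.
    + rewrite Rminus_diag, Rabs_R0; apply cond_pos.
    + exact Hs.
  - apply (is_derive_scal (fun t => circle_avg rho cos v x t
           + circle_avg rho sin (fun s t => - u s t) x t)).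
    apply (is_derive_plus (V := R_NormedModule)).
    + apply (circle_avg_derives x0 y0 rho cos v b _ x y continuous_cos Hv Hxy).
    + apply (circle_avg_derives x0 y0 rho sin _ (fun s t => - a s t) _ x y continuous_sin Hnu Hxy). }
intros x y Hxy; repeat split; auto.
- apply C1_differentiable; auto.
  destruct (box_open _ _ _ _ _ Hxy) as [e He]; exists e; intros s t Hs Ht; apply Dax; auto.
- apply C1_differentiable; auto.
  destruct (box_open _ _ _ _ _ Hxy) as [e He]; exists e; intros s t Hs Ht; apply Dbx; auto.
Qed.

Lemma open_box (U : C -> Prop) (z : C) :
  open U -> U z ->
  exists r : posreal, forall x y, box (Re z) (Im z) r x y -> U (x, y).
Proof.
intros HU Hz; destruct (HU z Hz) as [r Hr].
exists r; intros x y [Hx Hy]; apply Hr; split; assumption.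
Qed.

Lemma C_eta (z : C) : (Re z, Im z) = z.
Proof. destruct z; reflexivity. Qed.

Lemma holomorphic_C1 (U : C -> Prop) (f : C -> C) (z : C) :
  open U -> holomorphic_on U f -> U z ->
  exists r : posreal, (forall x y, box (Re z) (Im z) r x y -> U (x, y)) /\
  holo_C1 (Re z) (Im z) r (fun x y => Re (f (x, y))) (fun x y => Im (f (x, y)))
    (fun x y => Re (C_derive f (x, y))) (fun x y => Im (C_derive f (x, y))).
Proof.
intros HU Hf Hz.
destruct (open_box U z HU Hz) as [r Hr].
set (u := fun x y => Re (f (x, y))); set (v := fun x y => Im (f (x, y))).
set (a := fun x y => Re (C_derive f (x, y))); set (b := fun x y => Im (C_derive f (x, y))).
set (x0 := Re z) in *; set (y0 := Im z) in *.
assert (D : forall x y, box x0 y0 r x y ->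
  differentiable_pt_lim u x y (a x y) (- b x y) /\
  differentiable_pt_lim v x y (b x y) (a x y)).
{ intros x y Hxy.
  apply (is_derive_C_Cauchy_Riemann f (x, y)).
  unfold a, b; rewrite C_eta.
  apply C_derive_correct; [exact (RtoC 0) | apply Hf, Hr, Hxy]. }
(* [F1 + i F2] is a primitive of [f]: the gradients are [(u, -v)] and [(v, u)], and the
   Cauchy-Riemann equations of [f] make both forms closed. Its derivative [f] is continuous, so the
   gain of a derivative applies to it. *)
destruct (potential_on_box u (fun x y => - v x y) x0 y0 r) as [F1 HF1].
{ intros x y Hxy; destruct (D x y Hxy) as [D1 D2].
  exists (a x y), (- b x y), (- a x y); split; [exact D1 |].
  intros eps; destruct (D2 eps) as [d Hd]; exists d; intros s t Hs Ht.
  specialize (Hd s t Hs Ht); rewrite <- Rabs_Ropp in Hd.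
  eapply Rle_trans; [right | exact Hd]; f_equal; ring. }
destruct (potential_on_box v u x0 y0 r) as [F2 HF2].
{ intros x y Hxy; destruct (D x y Hxy) as [D1 D2].
  exists (b x y), (a x y), (- b x y); split; assumption. }
assert (H0 : holo_C1 x0 y0 r F1 F2 u v).
{ intros x y Hxy; destruct (D x y Hxy) as [D1 D2]; repeat split; auto;
    eapply differentiable_continuity; eassumption. }
assert (Pr := cond_pos r).
exists (pos_div_2 r); simpl; split.
{ intros x y [Hx Hy]; apply Hr; split; lra. }
replace (pos r) with (2 * (r / 2)) in H0 by field.
destruct (holo_C1_derivative x0 y0 (r / 2) F1 F2 u v H0) as [a1 [b1 H1]].
(* The averages provide some continuous derivative of [f]; uniqueness of derivatives identifies it
   with [C_derive f]. *)
assert (E : forall x y, box x0 y0 (r / 2) x y -> a1 x y = a x y /\ b1 x y = b x y).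
{ intros x y Hxy; destruct (H1 x y Hxy) as [K1 [K2 _]].
  destruct (D x y) as [D1 D2]; [destruct Hxy; split; lra |].
  split.
  - rewrite <- (is_derive_unique _ _ _ (differentiable_slice1 _ _ _ _ _ K1)).
    exact (is_derive_unique _ _ _ (differentiable_slice1 _ _ _ _ _ D1)).
  - rewrite <- (is_derive_unique _ _ _ (differentiable_slice1 _ _ _ _ _ K2)).
    exact (is_derive_unique _ _ _ (differentiable_slice1 _ _ _ _ _ D2)). }
intros x y Hxy.
destruct (H1 x y Hxy) as [_ [_ [K3 K4]]].
destruct (D x y) as [D1 D2]; [destruct Hxy; split; lra |].
destruct (box_open _ _ _ _ _ Hxy) as [e He].
repeat split; try assumption.
- apply (continuity_2d_pt_ext_loc a1); [| exact K3].
  exists e; intros s t Hs Ht; apply E; auto.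
- apply (continuity_2d_pt_ext_loc b1); [| exact K4].
  exists e; intros s t Hs Ht; apply E; auto.
Qed.

(** Once [f'] is known to be continuous, the gain of a derivative applies to [f] itself in place of
    its primitive. *)
Lemma holomorphic_derive (U : C -> Prop) (f : C -> C) :
  open U -> holomorphic_on U f -> holomorphic_on U (C_derive f).
Proof.
intros HU Hf z Hz.
destruct (holomorphic_C1 U f z HU Hf Hz) as [r [_ H]].
replace (pos r) with (2 * (r / 2)) in H by field.
destruct (holo_C1_derivative _ _ _ _ _ _ _ H) as [a1 [b1 H1]].
assert (P := cond_pos r).
destruct (H1 (Re z) (Im z)) as [K1 [K2 _]].
{ split; rewrite Rminus_diag, Rabs_R0; lra. }
exists (a1 (Re z) (Im z), b1 (Re z) (Im z)).
apply is_derive_C_Cauchy_Riemann; split; assumption.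
Qed.

(** * Smooth functions on open sets *)

(** Finite order is isolated because every smoothness proof below is an induction on the order. *)
Definition Cn (n : nat) (U : C -> Prop) (F : C -> R) : Prop :=
  forall z, U z -> ex_diff_n (fun x y => F (x, y)) n (Re z) (Im z).

Definition diff_at (F : C -> R) (z : C) (a b : R) : Prop :=
  differentiable_pt_lim (fun x y => F (x, y)) (Re z) (Im z) a b.

Definition cont_at (F : C -> R) (z : C) : Prop :=
  continuity_2d_pt (fun x y => F (x, y)) (Re z) (Im z).

Lemma smooth_on_Cn (U : C -> Prop) (F : C -> R) :
  smooth_on U F <-> forall n, Cn n U F.
Proof. split; [intros H n z Hz | intros H z Hz n]; apply H, Hz. Qed.

Lemma open_locally_2d (U : C -> Prop) (z : C) :
  open U -> U z -> locally_2d (fun x y => U (x, y)) (Re z) (Im z).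
Proof.
intros HU Hz; destruct (open_box U z HU Hz) as [r Hr].
exists r; intros u v Hu Hv; apply Hr; split; assumption.
Qed.

Lemma diff_at_slices (F : C -> R) (z : C) (a b : R) :
  diff_at F z a b ->
  is_derive (fun t => F (t, Im z)) (Re z) a /\ is_derive (fun t => F (Re z, t)) (Im z) b.
Proof.
intros H; split.
- exact (differentiable_slice1 _ _ _ _ _ H).
- exact (differentiable_slice2 _ _ _ _ _ H).
Qed.

Lemma diff_at_pd (F : C -> R) (z : C) (a b : R) :
  diff_at F z a b -> pd ax1 F z = a /\ pd ax2 F z = b.
Proof.
intros H; split; apply is_derive_unique; apply (diff_at_slices F z a b H).
Qed.

Lemma diff_at_ext (U : C -> Prop) (F G : C -> R) (z : C) (a b : R) :
  open U -> U z -> (forall w, U w -> F w = G w) ->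
  diff_at F z a b -> diff_at G z a b.
Proof.
intros HU Hz E; apply differentiable_pt_lim_ext.
destruct (open_locally_2d U z HU Hz) as [r Hr].
exists r; intros u v Hu Hv; apply E; auto.
Qed.

Lemma pd_ext (U : C -> Prop) (F G : C -> R) (i : axis) (z : C) :
  open U -> U z -> (forall w, U w -> F w = G w) -> pd i F z = pd i G z.
Proof.
intros HU Hz E.
destruct (open_locally_2d U z HU Hz) as [r Hr].
assert (P := cond_pos r).
destruct i; apply Derive_ext_loc; exists r; intros t Ht; apply E, Hr; try exact Ht;
  rewrite Rminus_diag, Rabs_R0; exact P.
Qed.

Lemma diff_at_const (k : R) (z : C) : diff_at (fun _ => k) z 0 0.
Proof.
intros eps; exists (mkposreal 1 Rlt_0_1); intros u v _ _.
replace (k - k - (0 * (u - Re z) + 0 * (v - Im z))) with 0 by ring.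
rewrite Rabs_R0; apply Rmult_le_pos; [left; apply cond_pos |].
eapply Rle_trans; [apply Rabs_pos | apply Rmax_l].
Qed.

Lemma diff_at_Re (z : C) : diff_at (fun w => Re w) z 1 0.
Proof.
apply (differentiable_pt_lim_proj1_0 (fun x => x)), derivable_pt_lim_id.
Qed.

Lemma diff_at_Im (z : C) : diff_at (fun w => Im w) z 0 1.
Proof.
intros eps; exists (mkposreal 1 Rlt_0_1); intros u v _ _; simpl.
replace (v - Im z - (0 * (u - Re z) + 1 * (v - Im z))) with 0 by ring.
rewrite Rabs_R0; apply Rmult_le_pos; [left; apply cond_pos |].
eapply Rle_trans; [apply Rabs_pos | apply Rmax_l].
Qed.

Lemma diff_at_plus (F G : C -> R) (z : C) (a b c d : R) :
  diff_at F z a b -> diff_at G z c d ->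
  diff_at (fun w => F w + G w) z (a + c) (b + d).
Proof.
intros HF HG eps.
destruct (HF (pos_div_2 eps)) as [d1 H1]; destruct (HG (pos_div_2 eps)) as [d2 H2].
exists (mkposreal _ (Rmin_pos _ _ (cond_pos d1) (cond_pos d2))); simpl; intros u v Hu Hv.
assert (L1 := Rmin_l d1 d2); assert (L2 := Rmin_r d1 d2).
specialize (H1 u v ltac:(lra) ltac:(lra)); specialize (H2 u v ltac:(lra) ltac:(lra)).
simpl in H1, H2.
set (m := Rmax (Rabs (u - Re z)) (Rabs (v - Im z))) in *.
apply Rabs_le_between in H1; apply Rabs_le_between in H2; apply Rabs_le; lra.
Qed.

Lemma diff_at_scal (F : C -> R) (z : C) (k a b : R) :
  diff_at F z a b -> diff_at (fun w => k * F w) z (k * a) (k * b).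
Proof.
intros HF eps.
assert (P : 0 < Rabs k + 1) by (assert (H := Rabs_pos k); lra).
assert (He : 0 < eps / (Rabs k + 1)) by (apply Rdiv_lt_0_compat; [apply cond_pos | exact P]).
destruct (HF (mkposreal _ He)) as [d1 H1].
exists d1; intros u v Hu Hv; specialize (H1 u v Hu Hv); simpl in H1.
set (m := Rmax (Rabs (u - Re z)) (Rabs (v - Im z))) in *.
replace (k * F (u, v) - k * F (Re z, Im z) - (k * a * (u - Re z) + k * b * (v - Im z)))
  with (k * (F (u, v) - F (Re z, Im z) - (a * (u - Re z) + b * (v - Im z)))) by ring.
rewrite Rabs_mult.
replace (eps * m) with ((Rabs k + 1) * (eps / (Rabs k + 1) * m)) by (field; lra).
apply Rmult_le_compat; try apply Rabs_pos; lra.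
Qed.

Lemma diff_at_mult (F G : C -> R) (z : C) (a b c d : R) :
  diff_at F z a b -> diff_at G z c d ->
  diff_at (fun w => F w * G w) z (a * G z + F z * c) (b * G z + F z * d).
Proof.
intros HF HG.
assert (E : forall u v, differentiable_pt_lim (fun x y => x * y) u v v u).
{ intros u v.
  replace u with (0 + u * 1) at 2 by ring.
  apply (C1_differentiable (fun x y => x * y) (fun x y => y) u v).
  - exists (mkposreal 1 Rlt_0_1); intros s t _ _; auto_derive; [exact I | ring].
  - auto_derive; [exact I | ring].
  - apply continuity_2d_pt_id2. }
assert (K := differentiable_pt_lim_comp (fun x y => x * y) _ _ _ _ _ _ _ _ _ _ (E _ _) HF HG).
cbv beta in K; rewrite !C_eta in K.
replace (a * G z + F z * c) with (G z * a + F z * c) by ring.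
replace (b * G z + F z * d) with (G z * b + F z * d) by ring.
exact K.
Qed.

Lemma diff_at_comp1 (phi : R -> R) (F : C -> R) (z : C) (l a b : R) :
  is_derive phi (F z) l -> diff_at F z a b ->
  diff_at (fun w => phi (F w)) z (l * a) (l * b).
Proof.
intros Hphi HF.
rewrite <- (C_eta z) in Hphi.
assert (K := differentiable_pt_lim_comp (fun x _ => phi x) (fun x y => F (x, y)) (fun _ _ => 0)
   (Re z) (Im z) l 0 a b 0 0
   (differentiable_pt_lim_proj1_0 phi _ _ _ (proj1 (is_derive_Reals _ _ _) Hphi))
   HF (diff_at_const 0 z)).
rewrite !Rmult_0_l, !Rplus_0_r in K; exact K.
Qed.

Lemma diff_at_inv (F : C -> R) (z : C) (a b : R) :
  diff_at F z a b -> F z <> 0 ->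
  diff_at (fun w => / F w) z (- / (F z * F z) * a) (- / (F z * F z) * b).
Proof.
intros HF Hz; apply (diff_at_comp1 Rinv F); [| exact HF].
auto_derive; [exact Hz | field; exact Hz].
Qed.

Lemma diff_at_comp (F : C -> R) (gamma : C -> C) (z : C) (fx fy a b c d : R) :
  diff_at F (gamma z) fx fy ->
  diff_at (fun w => Re (gamma w)) z a b -> diff_at (fun w => Im (gamma w)) z c d ->
  diff_at (fun w => F (gamma w)) z (fx * a + fy * c) (fx * b + fy * d).
Proof.
intros HF H1 H2.
rewrite <- (C_eta z) in HF.
assert (K := differentiable_pt_lim_comp (fun x y => F (x, y)) _ _ _ _ _ _ _ _ _ _ HF H1 H2).
apply differentiable_pt_lim_ext with (2 := K).
exists (mkposreal 1 Rlt_0_1); intros u v _ _; rewrite C_eta; reflexivity.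
Qed.

Lemma cont_at_comp (F : C -> R) (gamma : C -> C) (z : C) :
  cont_at F (gamma z) ->
  cont_at (fun w => Re (gamma w)) z -> cont_at (fun w => Im (gamma w)) z ->
  cont_at (fun w => F (gamma w)) z.
Proof.
intros HF H1 H2.
rewrite <- (C_eta z) in HF.
assert (K := continuity_2d_pt_comp (fun x y => F (x, y)) _ _ _ _ HF H1 H2).
apply continuity_2d_pt_ext with (2 := K).
intros u v; rewrite C_eta; reflexivity.
Qed.

Lemma diff_at_cont (F : C -> R) (z : C) (a b : R) : diff_at F z a b -> cont_at F z.
Proof. apply differentiable_continuity. Qed.

Lemma Cn_cont (n : nat) (U : C -> Prop) (F : C -> R) (z : C) :
  Cn n U F -> U z -> cont_at F z.
Proof. intros H Hz; specialize (H z Hz); destruct n; apply H. Qed.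

Lemma Cn_pred (n : nat) (U : C -> Prop) (F : C -> R) : Cn (S n) U F -> Cn n U F.
Proof. intros H z Hz; apply (ex_diff_n_m (S n)); [lia | apply H, Hz]. Qed.

Lemma Cn_pd (n : nat) (U : C -> Prop) (F : C -> R) (i : axis) :
  Cn (S n) U F -> Cn n U (pd i F).
Proof. intros H z Hz; destruct (H z Hz) as [_ [_ [_ [H1 H2]]]]; destruct i; assumption. Qed.

(** [ex_diff_n] speaks of partial derivatives only. Order at least one makes the first partial
    continuous, and [C1_differentiable] turns this into a total differential. *)
Lemma Cn_diff (n : nat) (U : C -> Prop) (F : C -> R) (z : C) :
  open U -> Cn (S n) U F -> U z -> diff_at F z (pd ax1 F z) (pd ax2 F z).
Proof.
intros HU H Hz.
destruct (open_locally_2d U z HU Hz) as [r Hr].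
replace (pd ax1 F z) with ((fun x y => pd ax1 F (x, y)) (Re z) (Im z))
  by (cbv beta; rewrite C_eta; reflexivity).
apply (C1_differentiable (fun x y => F (x, y)) (fun x y => pd ax1 F (x, y))).
- exists r; intros u v Hu Hv; destruct (H (u, v) (Hr u v Hu Hv)) as [_ [E _]].
  apply Derive_correct, E.
- destruct (H z Hz) as [_ [_ [E _]]]; apply Derive_correct, E.
- exact (Cn_cont n U _ z (Cn_pd n U F ax1 H) Hz).
Qed.

Lemma Cn_ext (n : nat) (U : C -> Prop) (F G : C -> R) :
  open U -> (forall w, U w -> F w = G w) -> Cn n U F -> Cn n U G.
Proof.
intros HU E H z Hz; apply ex_diff_n_ext_loc with (2 := H z Hz).
destruct (open_locally_2d U z HU Hz) as [r Hr].
exists r; intros u v Hu Hv; apply E; auto.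
Qed.

Lemma Cn_subset (n : nat) (U V : C -> Prop) (F : C -> R) :
  (forall z, U z -> V z) -> Cn n V F -> Cn n U F.
Proof. intros HUV H z Hz; apply H, HUV, Hz. Qed.

(** The step of the inductions on the order below: an operation needs only its rule of
    differentiation, whose coefficients the induction hypothesis handles. Openness of [U] allows [A]
    and [B] to replace the partial derivatives near each point. *)
Lemma Cn_of_diff (n : nat) (U : C -> Prop) (F A B : C -> R) :
  open U -> (forall z, U z -> diff_at F z (A z) (B z)) ->
  Cn n U A -> Cn n U B -> Cn (S n) U F.
Proof.
intros HU H HA HB z Hz.
assert (E : forall w, U w -> pd ax1 F w = A w /\ pd ax2 F w = B w)
  by (intros w Hw; apply diff_at_pd, H, Hw).
repeat split.
- eapply differentiable_continuity; apply H, Hz.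
- exists (A z); apply (diff_at_slices F z (A z) (B z)), H, Hz.
- exists (B z); apply (diff_at_slices F z (A z) (B z)), H, Hz.
- apply (Cn_ext n U A (pd ax1 F)); auto; intros w Hw; symmetry; apply E, Hw.
- apply (Cn_ext n U B (pd ax2 F)); auto; intros w Hw; symmetry; apply E, Hw.
Qed.

Lemma Cn_const (n : nat) (U : C -> Prop) (k : R) : open U -> Cn n U (fun _ => k).
Proof.
intros HU; revert k; induction n as [|n IH]; intros k.
- intros z _; split; [apply continuity_2d_pt_const | exact I].
- apply (Cn_of_diff n U _ (fun _ => 0) (fun _ => 0)); auto.
  intros; apply diff_at_const.
Qed.

Lemma Cn_Re (n : nat) (U : C -> Prop) : open U -> Cn n U (fun z => Re z).
Proof.
intros HU; destruct n as [|n].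
- intros z _; split; [apply continuity_2d_pt_id1 | exact I].
- apply (Cn_of_diff n U _ (fun _ => 1) (fun _ => 0)); auto using Cn_const.
  intros; apply diff_at_Re.
Qed.

Lemma Cn_Im (n : nat) (U : C -> Prop) : open U -> Cn n U (fun z => Im z).
Proof.
intros HU; destruct n as [|n].
- intros z _; split; [apply continuity_2d_pt_id2 | exact I].
- apply (Cn_of_diff n U _ (fun _ => 0) (fun _ => 1)); auto using Cn_const.
  intros; apply diff_at_Im.
Qed.

Lemma Cn_plus (n : nat) (U : C -> Prop) (F G : C -> R) :
  open U -> Cn n U F -> Cn n U G -> Cn n U (fun z => F z + G z).
Proof.
intros HU; revert F G; induction n as [|n IH]; intros F G HF HG.
- intros z Hz; split; [apply continuity_2d_pt_plus; [apply HF | apply HG]; exact Hz | exact I].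
- apply (Cn_of_diff n U _ (fun z => pd ax1 F z + pd ax1 G z) (fun z => pd ax2 F z + pd ax2 G z));
    auto using Cn_pd.
  intros z Hz; apply diff_at_plus; eapply Cn_diff; eassumption.
Qed.

Lemma Cn_mult (n : nat) (U : C -> Prop) (F G : C -> R) :
  open U -> Cn n U F -> Cn n U G -> Cn n U (fun z => F z * G z).
Proof.
intros HU; revert F G; induction n as [|n IH]; intros F G HF HG.
- intros z Hz; split; [apply continuity_2d_pt_mult; [apply HF | apply HG]; exact Hz | exact I].
- apply (Cn_of_diff n U _ (fun z => pd ax1 F z * G z + F z * pd ax1 G z)
          (fun z => pd ax2 F z * G z + F z * pd ax2 G z)); auto.
  + intros z Hz; apply diff_at_mult; eapply Cn_diff; eassumption.
  + apply Cn_plus; auto using Cn_pd, Cn_pred.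
  + apply Cn_plus; auto using Cn_pd, Cn_pred.
Qed.

Lemma Cn_opp (n : nat) (U : C -> Prop) (F : C -> R) :
  open U -> Cn n U F -> Cn n U (fun z => - F z).
Proof.
intros HU HF; apply (Cn_ext n U (fun z => -1 * F z)); auto.
- intros; ring.
- apply Cn_mult; auto using Cn_const.
Qed.

Lemma Cn_inv (n : nat) (U : C -> Prop) (F : C -> R) :
  open U -> (forall z, U z -> F z <> 0) -> Cn n U F -> Cn n U (fun z => / F z).
Proof.
intros HU H0; revert F H0; induction n as [|n IH]; intros F H0 HF.
- intros z Hz; split; [apply continuity_2d_pt_inv; [apply HF; exact Hz |] | exact I].
  rewrite C_eta; auto.
- apply (Cn_of_diff n U _ (fun z => - / (F z * F z) * pd ax1 F z)
          (fun z => - / (F z * F z) * pd ax2 F z)); auto.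
  + intros z Hz; apply diff_at_inv; [eapply Cn_diff; eassumption | auto].
  + apply Cn_mult; auto using Cn_pd; apply Cn_opp, IH; auto using Cn_mult, Cn_pred.
  + apply Cn_mult; auto using Cn_pd; apply Cn_opp, IH; auto using Cn_mult, Cn_pred.
Qed.

Lemma Cn_comp (n : nat) (U V : C -> Prop) (F : C -> R) (gamma : C -> C) :
  open U -> open V -> (forall z, U z -> V (gamma z)) -> Cn n V F ->
  Cn n U (fun z => Re (gamma z)) -> Cn n U (fun z => Im (gamma z)) ->
  Cn n U (fun z => F (gamma z)).
Proof.
intros HU HV Hg; revert F; induction n as [|n IH]; intros F HF H1 H2.
- intros z Hz; split; [| exact I].
  apply cont_at_comp.
  + apply (Cn_cont 0 V); auto.
  + apply (Cn_cont 0 U (fun z => Re (gamma z))); auto.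
  + apply (Cn_cont 0 U (fun z => Im (gamma z))); auto.
- apply (Cn_of_diff n U _
   (fun z => pd ax1 F (gamma z) * pd ax1 (fun z => Re (gamma z)) z
             + pd ax2 F (gamma z) * pd ax1 (fun z => Im (gamma z)) z)
   (fun z => pd ax1 F (gamma z) * pd ax2 (fun z => Re (gamma z)) z
             + pd ax2 F (gamma z) * pd ax2 (fun z => Im (gamma z)) z)); auto.
  + intros z Hz; apply diff_at_comp.
    * apply (Cn_diff n V); auto.
    * apply (Cn_diff n U (fun z => Re (gamma z))); auto.
    * apply (Cn_diff n U (fun z => Im (gamma z))); auto.
  + apply Cn_plus; auto; apply Cn_mult; auto using Cn_pd, Cn_pred.
  + apply Cn_plus; auto; apply Cn_mult; auto using Cn_pd, Cn_pred.
Qed.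

Lemma holomorphic_diff_at (U : C -> Prop) (f : C -> C) (z : C) :
  holomorphic_on U f -> U z ->
  diff_at (fun w => Re (f w)) z (Re (C_derive f z)) (- Im (C_derive f z)) /\
  diff_at (fun w => Im (f w)) z (Im (C_derive f z)) (Re (C_derive f z)).
Proof.
intros Hf Hz; apply is_derive_C_Cauchy_Riemann; rewrite C_eta.
apply C_derive_correct; [exact (RtoC 0) | apply Hf, Hz].
Qed.

(** The partial derivatives of the parts of [f] are, up to sign, the parts of [f'], which is
    holomorphic again; hence the induction runs over all [f] at once. *)
Lemma holomorphic_smooth (U : C -> Prop) (f : C -> C) :
  open U -> holomorphic_on U f -> smoothC_on U f.
Proof.
intros HU Hf.
assert (H : forall n f, holomorphic_on U f ->
  Cn n U (fun z => Re (f z)) /\ Cn n U (fun z => Im (f z))).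
{ induction n as [|n IH]; intros g Hg.
  - split; intros z Hz; (split; [| exact I]); destruct (holomorphic_diff_at U g z Hg Hz);
      eapply differentiable_continuity; eassumption.
  - destruct (IH _ (holomorphic_derive U g HU Hg)) as [K1 K2]; split.
    + apply (Cn_of_diff n U (fun z => Re (g z)) (fun z => Re (C_derive g z))
               (fun z => - Im (C_derive g z)));
        auto using Cn_opp.
      intros z Hz; apply (holomorphic_diff_at U g z Hg Hz).
    + apply (Cn_of_diff n U (fun z => Im (g z)) (fun z => Im (C_derive g z))
               (fun z => Re (C_derive g z))); auto.
      intros z Hz; apply (holomorphic_diff_at U g z Hg Hz). }
split; apply smooth_on_Cn; intros n; apply (H n f Hf).
Qed.

(** * The inverse function theorem *)

Definition Cbox (z0 : C) (r : R) (z : C) : Prop := box (Re z0) (Im z0) r (Re z) (Im z).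

Definition Cdist (z w : C) : R := Rmax (Rabs (Re z - Re w)) (Rabs (Im z - Im w)).

Lemma open_Cbox (z0 : C) (r : R) : open (Cbox z0 r).
Proof.
intros z Hz; destruct (box_open _ _ _ _ _ Hz) as [d Hd].
exists d; intros w [H1 H2]; apply Hd; assumption.
Qed.

Lemma Cbox_dist (z0 z : C) (r : R) : Cbox z0 r z <-> Cdist z z0 < r.
Proof.
unfold Cbox, box, Cdist; split.
- intros [H1 H2]; apply Rmax_lub_lt; assumption.
- intros H; split; (eapply Rle_lt_trans; [| exact H]); [apply Rmax_l | apply Rmax_r].
Qed.

Lemma Cbox_center (z : C) (r : R) : 0 < r -> Cbox z r z.
Proof. intros Hr; split; rewrite Rminus_diag, Rabs_R0; exact Hr. Qed.

Lemma open_Cbox_subset (U : C -> Prop) (z : C) :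
  open U -> U z -> exists r : posreal, forall w, Cbox z r w -> U w.
Proof.
intros HU Hz; destruct (open_box U z HU Hz) as [r Hr].
exists r; intros w Hw; rewrite <- (C_eta w); apply Hr, Hw.
Qed.

Lemma Cdist_pos (z w : C) : 0 <= Cdist z w.
Proof. eapply Rle_trans; [apply Rabs_pos | apply Rmax_l]. Qed.

Lemma Cdist_0 (z w : C) : Cdist z w <= 0 -> z = w.
Proof.
unfold Cdist; intros H.
assert (L1 := Rmax_l (Rabs (Re z - Re w)) (Rabs (Im z - Im w))).
assert (L2 := Rmax_r (Rabs (Re z - Re w)) (Rabs (Im z - Im w))).
assert (P1 := Rabs_pos (Re z - Re w)); assert (P2 := Rabs_pos (Im z - Im w)).
rewrite <- (C_eta z), <- (C_eta w); f_equal; apply Rminus_diag_uniq.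
- destruct (Req_dec (Re z - Re w) 0) as [|N]; [assumption |].
  apply Rabs_pos_lt in N; lra.
- destruct (Req_dec (Im z - Im w) 0) as [|N]; [assumption |].
  apply Rabs_pos_lt in N; lra.
Qed.

Lemma Cdist_sym (z w : C) : Cdist z w = Cdist w z.
Proof. unfold Cdist; f_equal; apply Rabs_minus_sym. Qed.

Lemma Cdist_triang (z w u : C) : Cdist z u <= Cdist z w + Cdist w u.
Proof.
unfold Cdist; apply Rmax_lub.
- replace (Re z - Re u) with ((Re z - Re w) + (Re w - Re u)) by ring.
  eapply Rle_trans; [apply Rabs_triang |]; apply Rplus_le_compat; apply Rmax_l.
- replace (Im z - Im u) with ((Im z - Im w) + (Im w - Im u)) by ring.
  eapply Rle_trans; [apply Rabs_triang |]; apply Rplus_le_compat; apply Rmax_r.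
Qed.

(** Moving along one axis at a time costs [k] per axis, which gives [2 * k] in the max norm. The
    corner of the path stays in the box. *)
Lemma Lipschitz_on_Cbox (F A B : C -> R) (z0 z w : C) (r k : R) :
  (forall z, Cbox z0 r z -> diff_at F z (A z) (B z) /\ Rabs (A z) <= k /\ Rabs (B z) <= k) ->
  Cbox z0 r z -> Cbox z0 r w ->
  Rabs (F z - F w) <= 2 * k * Cdist z w.
Proof.
intros H [Hz1 Hz2] [Hw1 Hw2].
destruct z as [x y], w as [x' y']; simpl in *.
assert (K1 : Rabs (F (x, y) - F (x', y)) <= k * Rabs (x - x')).
{ destruct (MVT_gen (fun t => F (t, y)) x' x (fun t => A (t, y))) as [c [Hc E]].
  - intros t Ht; apply (diff_at_slices F (t, y) (A (t, y)) (B (t, y))), H.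
    split; simpl; [| exact Hz2].
    apply (Rabs_between x' x); [assumption | assumption | lra].
  - intros t Ht; apply continuity_pt_filterlim.
    apply (continuity_2d_slice1 (fun x y => F (x, y))).
    eapply differentiable_continuity; apply (H (t, y)).
    split; simpl; [| exact Hz2].
    apply (Rabs_between x' x); assumption.
  - rewrite E, Rabs_mult; apply Rmult_le_compat_r; [apply Rabs_pos |].
    apply (H (c, y)); split; simpl; [| exact Hz2].
    apply (Rabs_between x' x); assumption. }
assert (K2 : Rabs (F (x', y) - F (x', y')) <= k * Rabs (y - y')).
{ destruct (MVT_gen (fun t => F (x', t)) y' y (fun t => B (x', t))) as [c [Hc E]].
  - intros t Ht; apply (diff_at_slices F (x', t) (A (x', t)) (B (x', t))), H.
    split; simpl; [exact Hw1 |].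
    apply (Rabs_between y' y); [assumption | assumption | lra].
  - intros t Ht; apply continuity_pt_filterlim.
    apply (continuity_2d_slice2 (fun x y => F (x, y))).
    eapply differentiable_continuity; apply (H (x', t)).
    split; simpl; [exact Hw1 |].
    apply (Rabs_between y' y); assumption.
  - rewrite E, Rabs_mult; apply Rmult_le_compat_r; [apply Rabs_pos |].
    apply (H (x', c)); split; simpl; [exact Hw1 |].
    apply (Rabs_between y' y); assumption. }
assert (Hk : 0 <= k).
{ eapply Rle_trans; [apply Rabs_pos | apply (H (x, y)); split; assumption]. }
replace (F (x, y) - F (x', y')) with ((F (x, y) - F (x', y)) + (F (x', y) - F (x', y'))) by ring.
eapply Rle_trans; [apply Rabs_triang |].
unfold Cdist; simpl.
assert (L1 := Rmax_l (Rabs (x - x')) (Rabs (y - y'))).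
assert (L2 := Rmax_r (Rabs (x - x')) (Rabs (y - y'))).
nra.
Qed.

(** The intervals of radius [2 * k * (/ 2) ^ n] about [x n] are nested: from one to the next the
    radius drops by [k * (/ 2) ^ n], exactly the step allowed to the centre. *)
Lemma geometric_limit (x : nat -> R) (k : R) :
  (forall n, Rabs (x (S n) - x n) <= k * (/ 2) ^ n) ->
  exists l, forall n, Rabs (x n - l) <= 2 * k * (/ 2) ^ n.
Proof.
intros H.
assert (Hk : 0 <= k).
{ specialize (H 0%nat); simpl in H; assert (P := Rabs_pos (x 1%nat - x 0%nat)); lra. }
destruct (nested_segments (fun n => x n - 2 * k * (/ 2) ^ n) (fun n => x n + 2 * k * (/ 2) ^ n))
  as [l Hl].
- intros n; specialize (H n); apply Rabs_le_between in H; simpl; lra.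
- intros n; specialize (H n); apply Rabs_le_between in H; simpl; lra.
- intros n; assert (P : 0 < (/ 2) ^ n) by (apply pow_lt; lra).
  assert (0 <= k * (/ 2) ^ n) by (apply Rmult_le_pos; lra); lra.
- exists l; intros n; specialize (Hl n); apply Rabs_le; lra.
Qed.

(** Iteration of [E z + t] from the centre. A first step below [r / 4] and the ratio 1/2 keep all
    iterates within [r / 2] of [z0], so the contraction estimate is only invoked inside the box. *)
Lemma contraction_fixed_point (E : C -> C) (z0 t : C) (r : R) :
  0 < r ->
  (forall z w, Cbox z0 r z -> Cbox z0 r w -> Cdist (E z) (E w) <= / 2 * Cdist z w) ->
  Cdist (E z0 + t)%C z0 < r / 4 ->
  exists z, Cbox z0 r z /\ (E z + t)%C = z.
Proof.
intros Hr HE H0.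
set (s := fix s n := match n with O => z0 | S m => (E (s m) + t)%C end).
assert (T : forall z w, Cdist (E z + t)%C (E w + t)%C = Cdist (E z) (E w)).
{ intros z w; unfold Cdist, Cplus; simpl; f_equal; f_equal; unfold Re, Im; ring. }
assert (P : forall n, 0 < (/ 2) ^ n) by (intros n; apply pow_lt; lra).
assert (K : forall n, Cdist (s n) z0 <= r / 2 * (1 - (/ 2) ^ n) /\
                      Cdist (s (S n)) (s n) <= r / 4 * (/ 2) ^ n).
{ induction n as [|n [IH1 IH2]].
  - simpl; split; [| lra].
    unfold Cdist; rewrite !Rminus_diag, Rabs_R0, Rmax_left; lra.
  - specialize (P n).
    assert (D1 : Cdist (s (S n)) z0 <= r / 2 * (1 - (/ 2) ^ (S n))).
    { eapply Rle_trans; [apply (Cdist_triang _ (s n)) |]; simpl in *; lra. }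
    split; [exact D1 |].
    change (s (S (S n))) with (E (s (S n)) + t)%C.
    change (s (S n)) with (E (s n) + t)%C at 2.
    rewrite T.
    eapply Rle_trans; [apply HE; apply Cbox_dist |].
    + simpl ((/ 2) ^ S n) in D1; nra.
    + nra.
    + simpl ((/ 2) ^ S n); lra. }
destruct (geometric_limit (fun n => Re (s n)) (r / 4)) as [l1 H1].
{ intros n; eapply Rle_trans; [| apply (K n)]; apply Rmax_l. }
destruct (geometric_limit (fun n => Im (s n)) (r / 4)) as [l2 H2].
{ intros n; eapply Rle_trans; [| apply (K n)]; apply Rmax_r. }
assert (L : forall n, Cdist (s n) (l1, l2) <= r / 2 * (/ 2) ^ n).
{ intros n; apply Rmax_lub; simpl; [specialize (H1 n) | specialize (H2 n)]; lra. }
assert (B : Cbox z0 r (l1, l2)).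
{ apply Cbox_dist; eapply Rle_lt_trans; [apply (Cdist_triang _ (s 0%nat)) |].
  specialize (L 0%nat); rewrite Cdist_sym in L; simpl in *.
  unfold Cdist at 2; rewrite !Rminus_diag, Rabs_R0, Rmax_left; lra. }
exists (l1, l2); split; [exact B |].
apply Cdist_0, Rnot_lt_le; intros N.
set (d := Cdist (E (l1, l2) + t)%C (l1, l2)) in *.
destruct (pow_lt_1_zero (/ 2)) with (y := d / r) as [n Hn].
{ rewrite Rabs_right; lra. }
{ apply Rdiv_lt_0_compat; assumption. }
specialize (Hn n (Nat.le_refl _)); specialize (P n).
rewrite Rabs_right in Hn by lra.
(* The defect [d] of the limit is compared with the iterate [s (S n)]: the contraction bounds one
   distance and the rate of convergence the other. But [n] was chosen with [d] above
   [r * (/ 2) ^ n]. *)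
assert (D : d <= r / 2 * (/ 2) ^ n).
{ unfold d; eapply Rle_trans; [apply (Cdist_triang _ (s (S n))) |].
  change (s (S n)) with (E (s n) + t)%C at 1; rewrite T.
  assert (L0 := L n); assert (L1 := L (S n)); destruct (K n) as [K1 _].
  assert (HE' := HE (l1, l2) (s n) B); rewrite (Cdist_sym (l1, l2)) in HE'.
  simpl ((/ 2) ^ S n) in L1.
  assert (Cbox z0 r (s n)) by (apply Cbox_dist; nra).
  specialize (HE' H); lra. }
apply Rmult_lt_compat_l with (r := r) in Hn; [| exact Hr].
replace (r * (d / r)) with d in Hn by (field; lra).
assert (0 < r * (/ 2) ^ n) by (apply Rmult_lt_0_compat; lra).
lra.
Qed.

Definition jacobian (G : C -> C) (z : C) : R :=
  pd ax1 (fun w => Re (G w)) z * pd ax2 (fun w => Im (G w)) z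
  - pd ax2 (fun w => Re (G w)) z * pd ax1 (fun w => Im (G w)) z.

Lemma smoothC_diff (U : C -> Prop) (G : C -> C) (z : C) :
  open U -> smoothC_on U G -> U z ->
  diff_at (fun w => Re (G w)) z (pd ax1 (fun w => Re (G w)) z) (pd ax2 (fun w => Re (G w)) z) /\
  diff_at (fun w => Im (G w)) z (pd ax1 (fun w => Im (G w)) z) (pd ax2 (fun w => Im (G w)) z).
Proof.
intros HU [H1 H2] Hz; split.
- apply (Cn_diff 0 U (fun w => Re (G w))); auto; intros w Hw; apply H1, Hw.
- apply (Cn_diff 0 U (fun w => Im (G w))); auto; intros w Hw; apply H2, Hw.
Qed.

(** The differential of [G] leaves an error that is small against the increment of [gamma]. The
    Lipschitz bound makes it small against the increment of the argument, and the inverse of the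
    Jacobian matrix solves for the increment of [gamma]. *)
Lemma inverse_differentiable (U V : C -> Prop) (G gamma : C -> C) (t : C) :
  open U -> open V -> smoothC_on V G ->
  (forall w, U w -> V (gamma w) /\ G (gamma w) = w) ->
  (forall w, U w -> Cdist (gamma w) (gamma t) <= 2 * Cdist w t) ->
  U t -> jacobian G (gamma t) <> 0 ->
  let z := gamma t in
  let D := jacobian G z in
  diff_at (fun w => Re (gamma w)) t (pd ax2 (fun w => Im (G w)) z / D)
    (- pd ax2 (fun w => Re (G w)) z / D) /\
  diff_at (fun w => Im (gamma w)) t (- pd ax1 (fun w => Im (G w)) z / D)
    (pd ax1 (fun w => Re (G w)) z / D).
Proof.
intros HU HV HG Hinv Hlip Ht HD z D.
destruct (Hinv t Ht) as [Hz Ez]; fold z in Hz, Ez; fold D in HD.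
destruct (smoothC_diff V G z HV HG Hz) as [D1 D2].
set (al := pd ax1 (fun w => Re (G w)) z) in *.
set (be := pd ax2 (fun w => Re (G w)) z) in *.
set (de := pd ax1 (fun w => Im (G w)) z) in *.
set (ep := pd ax2 (fun w => Im (G w)) z) in *.
assert (HDe : D = al * ep - be * de) by reflexivity.
destruct (open_Cbox_subset U t HU Ht) as [rU HrU].
assert (Main : forall k l : R, forall eps : posreal, locally_2d (fun u v =>
  Rabs (k * (Re (G (gamma (u, v))) - Re (G z)
             - (al * (Re (gamma (u, v)) - Re z) + be * (Im (gamma (u, v)) - Im z)))
      + l * (Im (G (gamma (u, v))) - Im (G z)
             - (de * (Re (gamma (u, v)) - Re z) + ep * (Im (gamma (u, v)) - Im z))))
  <= eps * Cdist (u, v) t) (Re t) (Im t)).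
{ intros k l eps.
  assert (P1 := Rabs_pos k); assert (P2 := Rabs_pos l).
  assert (Pe : 0 < eps / (2 * (Rabs k + Rabs l + 1)))
    by (apply Rdiv_lt_0_compat; [apply cond_pos | lra]).
  destruct (D1 (mkposreal _ Pe)) as [d1 H1]; destruct (D2 (mkposreal _ Pe)) as [d2 H2].
  simpl in H1, H2.
  set (eta := eps / (2 * (Rabs k + Rabs l + 1))) in *.
  assert (Q1 := cond_pos d1); assert (Q2 := cond_pos d2).
  assert (Pd : 0 < Rmin rU (Rmin (d1 / 2) (d2 / 2)))
    by (repeat apply Rmin_pos; try apply cond_pos; lra).
  exists (mkposreal _ Pd); simpl; intros u v Hu Hv.
  assert (L0 := Rmin_l rU (Rmin (d1 / 2) (d2 / 2))).
  assert (L1 := Rmin_r rU (Rmin (d1 / 2) (d2 / 2))).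
  assert (L2 := Rmin_l (d1 / 2) (d2 / 2)).
  assert (L3 := Rmin_r (d1 / 2) (d2 / 2)).
  assert (HUw : U (u, v)) by (apply HrU; split; simpl; lra).
  specialize (Hlip (u, v) HUw); fold z in Hlip.
  assert (Hd : Cdist (u, v) t < Rmin rU (Rmin (d1 / 2) (d2 / 2)))
    by (apply Rmax_lub_lt; assumption).
  set (w := gamma (u, v)) in *.
  assert (M1 : Rabs (Re w - Re z) <= Cdist w z) by apply Rmax_l.
  assert (M2 : Rabs (Im w - Im z) <= Cdist w z) by apply Rmax_r.
  specialize (H1 (Re w) (Im w) ltac:(lra) ltac:(lra)).
  specialize (H2 (Re w) (Im w) ltac:(lra) ltac:(lra)).
  rewrite !C_eta in H1, H2.
  change (Rmax (Rabs (Re w - Re z)) (Rabs (Im w - Im z))) with (Cdist w z) in H1, H2.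
  eapply Rle_trans; [apply Rabs_triang |]; rewrite !Rabs_mult.
  assert (B1 := Rmult_le_compat_l _ _ _ P1 H1).
  assert (B2 := Rmult_le_compat_l _ _ _ P2 H2).
  assert (E : eps * Cdist (u, v) t = (Rabs k + Rabs l + 1) * (eta * (2 * Cdist (u, v) t)))
    by (unfold eta; field; lra).
  rewrite E.
  assert (eta * Cdist w z <= eta * (2 * Cdist (u, v) t)) by (apply Rmult_le_compat_l; lra).
  assert (0 <= eta * Cdist w z) by (apply Rmult_le_pos; [lra | apply Cdist_pos]).
  nra. }
split; intros eps.
(* The coefficients are the first row of the inverse Jacobian matrix with sign reversed, so that
   only the increment of [Re gamma] survives; the other case uses the second row. *)
- destruct (Main (- ep / D) (be / D) eps) as [d Hd].
  exists (mkposreal _ (Rmin_pos _ _ (cond_pos d) (cond_pos rU))); simpl; intros u v Hu Hv.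
  assert (L1 := Rmin_l d rU); assert (L2 := Rmin_r d rU).
  specialize (Hd u v ltac:(lra) ltac:(lra)).
  assert (HUw : U (u, v)) by (apply HrU; split; simpl; lra).
  destruct (Hinv _ HUw) as [_ Ew]; rewrite Ew, Ez in Hd; simpl in Hd.
  rewrite C_eta; fold z.
  eapply Rle_trans; [right | exact Hd].
  f_equal; rewrite HDe in *; field; exact HD.
- destruct (Main (de / D) (- al / D) eps) as [d Hd].
  exists (mkposreal _ (Rmin_pos _ _ (cond_pos d) (cond_pos rU))); simpl; intros u v Hu Hv.
  assert (L1 := Rmin_l d rU); assert (L2 := Rmin_r d rU).
  specialize (Hd u v ltac:(lra) ltac:(lra)).
  assert (HUw : U (u, v)) by (apply HrU; split; simpl; lra).
  destruct (Hinv _ HUw) as [_ Ew]; rewrite Ew, Ez in Hd; simpl in Hd.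
  rewrite C_eta; fold z.
  eapply Rle_trans; [right | exact Hd].
  f_equal; rewrite HDe in *; field; exact HD.
Qed.

(** A bootstrap: the partial derivatives of [gamma] are those of [G], up to sign, divided by the
    Jacobian and evaluated at [gamma], so order [n] of [gamma] yields order [n] of its partials. *)
Lemma inverse_smooth (U V : C -> Prop) (G gamma : C -> C) :
  open U -> open V -> smoothC_on V G ->
  (forall w, U w -> V (gamma w) /\ G (gamma w) = w) ->
  (forall w t, U w -> U t -> Cdist (gamma w) (gamma t) <= 2 * Cdist w t) ->
  (forall z, V z -> jacobian G z <> 0) ->
  smoothC_on U gamma.
Proof.
intros HU HV HG Hinv Hlip HJ.
assert (D := fun t Ht => inverse_differentiable U V G gamma t HU HV HG Hinv
   (fun w Hw => Hlip w t Hw Ht) Ht (HJ _ (proj1 (Hinv t Ht)))).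
simpl in D.
assert (H1 : forall n, Cn n V (fun z => Re (G z))) by (apply smooth_on_Cn, HG).
assert (H2 : forall n, Cn n V (fun z => Im (G z))) by (apply smooth_on_Cn, HG).
assert (HJn : forall n, Cn n V (fun z => / jacobian G z)).
{ intros n; apply Cn_inv; auto; unfold jacobian.
  apply (Cn_ext n V (fun z =>
    pd ax1 (fun w => Re (G w)) z * pd ax2 (fun w => Im (G w)) z
    + - (pd ax2 (fun w => Re (G w)) z * pd ax1 (fun w => Im (G w)) z))); auto.
  apply Cn_plus, Cn_opp; auto; apply Cn_mult; auto using Cn_pd. }
assert (K : forall n, Cn n U (fun w => Re (gamma w)) /\ Cn n U (fun w => Im (gamma w))).
{ induction n as [|n [IH1 IH2]].
  - split; intros t Ht; (split; [| exact I]); destruct (D t Ht) as [D1 D2];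
      eapply differentiable_continuity; eassumption.
  - assert (Cmp : forall F, Cn n V F -> Cn n U (fun w => F (gamma w)))
      by (intros F HF; apply (Cn_comp n U V F gamma); auto; intros w Hw; apply Hinv, Hw).
    split.
    + apply (Cn_of_diff n U (fun w => Re (gamma w))
        (fun w => pd ax2 (fun w => Im (G w)) (gamma w) * / jacobian G (gamma w))
        (fun w => - pd ax2 (fun w => Re (G w)) (gamma w) * / jacobian G (gamma w))); auto.
      * intros t Ht; apply (D t Ht).
      * apply (Cmp (fun z => pd ax2 (fun w => Im (G w)) z * / jacobian G z)).
        apply Cn_mult; auto using Cn_pd.
      * apply (Cmp (fun z => - pd ax2 (fun w => Re (G w)) z * / jacobian G z)).
        apply Cn_mult; auto using Cn_pd, Cn_opp.
    + apply (Cn_of_diff n U (fun w => Im (gamma w))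
        (fun w => - pd ax1 (fun w => Im (G w)) (gamma w) * / jacobian G (gamma w))
        (fun w => pd ax1 (fun w => Re (G w)) (gamma w) * / jacobian G (gamma w))); auto.
      * intros t Ht; apply (D t Ht).
      * apply (Cmp (fun z => - pd ax1 (fun w => Im (G w)) z * / jacobian G z)).
        apply Cn_mult; auto using Cn_pd, Cn_opp.
      * apply (Cmp (fun z => pd ax1 (fun w => Re (G w)) z * / jacobian G z)).
        apply Cn_mult; auto using Cn_pd. }
split; apply smooth_on_Cn; intros n; apply (K n).
Qed.

(** Partials within 1/4 of those of the identity make [z - H z] a contraction of ratio 2 * 1/4.
    Hence [H] shrinks distances at most by half, which gives injectivity and the Lipschitz bound,
    and solving [H z = t] is a fixed point problem. *)
Lemma near_identity_inverse (H : C -> C) (z0 : C) (r : R) :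
  0 < r -> smoothC_on (Cbox z0 r) H ->
  (forall z, Cbox z0 r z ->
     Rabs (pd ax1 (fun w => Re (H w)) z - 1) <= / 4 /\
     Rabs (pd ax2 (fun w => Re (H w)) z) <= / 4 /\
     Rabs (pd ax1 (fun w => Im (H w)) z) <= / 4 /\
     Rabs (pd ax2 (fun w => Im (H w)) z - 1) <= / 4) ->
  (forall z w, Cbox z0 r z -> Cbox z0 r w -> H z = H w -> z = w) /\
  exists gamma : C -> C,
    (forall t, Cbox (H z0) (r / 4) t -> Cbox z0 r (gamma t) /\ H (gamma t) = t) /\
    smoothC_on (Cbox (H z0) (r / 4)) gamma.
Proof.
intros Hr HS HB.
set (E := fun z => (z - H z)%C).
assert (HE : forall z w, Cbox z0 r z -> Cbox z0 r w -> Cdist (E z) (E w) <= / 2 * Cdist z w).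
{ intros z w Hz Hw; apply Rmax_lub.
  - replace (/ 2 * Cdist z w) with (2 * / 4 * Cdist z w) by field.
    apply (Lipschitz_on_Cbox (fun z => Re (E z))
      (fun z => 1 + -1 * pd ax1 (fun w => Re (H w)) z)
      (fun z => 0 + -1 * pd ax2 (fun w => Re (H w)) z) z0 z w r); auto.
    intros y Hy; destruct (HB y Hy) as [B1 [B2 [B3 B4]]].
    destruct (smoothC_diff _ H y (open_Cbox z0 r) HS Hy) as [D1 D2].
    split; [| split].
    + apply (diff_at_ext (Cbox z0 r) (fun w => Re w + -1 * Re (H w)));
        [apply open_Cbox | exact Hy | intros; unfold E, Re; simpl; ring |].
      apply diff_at_plus; [apply diff_at_Re | apply diff_at_scal, D1].
    + rewrite <- Rabs_Ropp; eapply Rle_trans; [right | exact B1]; f_equal; ring.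
    + rewrite <- Rabs_Ropp; eapply Rle_trans; [right | exact B2]; f_equal; ring.
  - replace (/ 2 * Cdist z w) with (2 * / 4 * Cdist z w) by field.
    apply (Lipschitz_on_Cbox (fun z => Im (E z))
      (fun z => 0 + -1 * pd ax1 (fun w => Im (H w)) z)
      (fun z => 1 + -1 * pd ax2 (fun w => Im (H w)) z) z0 z w r); auto.
    intros y Hy; destruct (HB y Hy) as [B1 [B2 [B3 B4]]].
    destruct (smoothC_diff _ H y (open_Cbox z0 r) HS Hy) as [D1 D2].
    split; [| split].
    + apply (diff_at_ext (Cbox z0 r) (fun w => Im w + -1 * Im (H w)));
        [apply open_Cbox | exact Hy | intros; unfold E, Im; simpl; ring |].
      apply diff_at_plus; [apply diff_at_Im | apply diff_at_scal, D2].
    + rewrite <- Rabs_Ropp; eapply Rle_trans; [right | exact B3]; f_equal; ring.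
    + rewrite <- Rabs_Ropp; eapply Rle_trans; [right | exact B4]; f_equal; ring. }
assert (Expand : forall z w, Cbox z0 r z -> Cbox z0 r w ->
  Cdist z w <= 2 * Cdist (H z) (H w)).
{ intros z w Hz Hw; specialize (HE z w Hz Hw).
  assert (T : Cdist z w <= Cdist (E z) (E w) + Cdist (H z) (H w)).
  { unfold Cdist at 1; apply Rmax_lub.
    - replace (Re z - Re w) with ((Re (E z) - Re (E w)) + (Re (H z) - Re (H w)))
        by (unfold E, Re; simpl; ring).
      eapply Rle_trans; [apply Rabs_triang |]; apply Rplus_le_compat; apply Rmax_l.
    - replace (Im z - Im w) with ((Im (E z) - Im (E w)) + (Im (H z) - Im (H w)))
        by (unfold E, Im; simpl; ring).
      eapply Rle_trans; [apply Rabs_triang |]; apply Rplus_le_compat; apply Rmax_r. }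
  lra. }
split.
{ intros z w Hz Hw Ezw; apply Cdist_0.
  eapply Rle_trans; [apply Expand; assumption |].
  rewrite Ezw; unfold Cdist; rewrite !Rminus_diag, Rabs_R0, Rmax_left; lra. }
(* The existential is total in [t], with the dummy value [z0] outside the box, so that [choice]
   applies. *)
assert (Ex : forall t, exists z, Cbox (H z0) (r / 4) t -> Cbox z0 r z /\ H z = t).
{ intros t; destruct (classic (Cbox (H z0) (r / 4) t)) as [Ht | Ht];
    [| exists z0; contradiction].
  destruct (contraction_fixed_point E z0 t r Hr HE) as [z [Hz Ez]].
  - apply Cbox_dist in Ht; eapply Rle_lt_trans; [right | exact Ht].
    unfold Cdist, E, Cplus, Cminus; f_equal; f_equal; unfold Re, Im; simpl; ring.
  - exists z; intros _; split; [exact Hz |].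
    unfold E in Ez; apply (f_equal (fun y => (y - z + H z)%C)) in Ez.
    replace (z - H z + t - z + H z)%C with t in Ez by ring.
    rewrite Ez; ring. }
destruct (choice _ Ex) as [gamma Hgamma].
exists gamma; split; [exact Hgamma |].
apply (inverse_smooth _ (Cbox z0 r) H); auto using open_Cbox.
- intros w t Hw Ht; destruct (Hgamma w Hw) as [W1 W2]; destruct (Hgamma t Ht) as [T1 T2].
  rewrite <- W2 at 2; rewrite <- T2 at 2; auto.
- intros z Hz; destruct (HB z Hz) as [B1 [B2 [B3 B4]]]; unfold jacobian.
  apply Rabs_le_between in B1; apply Rabs_le_between in B2.
  apply Rabs_le_between in B3; apply Rabs_le_between in B4.
  (* The determinant is at least (3/4)^2 - (1/4)^2. *)
  apply Rgt_not_eq; nra.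
Qed.

Lemma cont_at_Cbox (F : C -> R) (z : C) (eps : R) :
  cont_at F z -> 0 < eps ->
  exists r : posreal, forall w, Cbox z r w -> Rabs (F w - F z) <= eps.
Proof.
intros H He; destruct (H (mkposreal _ He)) as [d Hd].
exists d; intros w [W1 W2]; left.
specialize (Hd _ _ W1 W2); rewrite !C_eta in Hd; exact Hd.
Qed.

Lemma Cn_lin (n : nat) (U : C -> Prop) (F G : C -> R) (k l : R) :
  open U -> Cn n U F -> Cn n U G -> Cn n U (fun z => k * F z + l * G z).
Proof. intros HU HF HG; apply Cn_plus; auto; apply Cn_mult; auto using Cn_const. Qed.

(** Following [G] by [lin], the inverse of its differential at [z0], gives a map with identity
    differential there; continuity of the partials keeps it near the identity on a small box. *)
Theorem inverse_function (V : C -> Prop) (G : C -> C) (z0 : C) :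
  open V -> smoothC_on V G -> V z0 -> jacobian G z0 <> 0 ->
  exists (V0 : C -> Prop) (r : posreal) (gamma : C -> C),
    open V0 /\ (forall z, V0 z -> V z) /\ V0 z0 /\
    (forall z, V0 z -> Cbox (G z0) r (G z) -> gamma (G z) = z) /\
    (forall w, Cbox (G z0) r w -> V0 (gamma w) /\ G (gamma w) = w) /\
    smoothC_on (Cbox (G z0) r) gamma.
Proof.
intros HV HG Hz0 HJ.
set (J := jacobian G z0) in *.
set (a := pd ax1 (fun w => Re (G w)) z0); set (b := pd ax2 (fun w => Re (G w)) z0).
set (c := pd ax1 (fun w => Im (G w)) z0); set (d := pd ax2 (fun w => Im (G w)) z0).
assert (EJ : J = a * d - b * c) by reflexivity.
set (lin := fun w : C => (d / J * Re w + - b / J * Im w, - c / J * Re w + a / J * Im w) : C).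
set (H := fun z => lin (G z)).
assert (G1 : forall n, Cn n V (fun z => Re (G z))) by (apply smooth_on_Cn, HG).
assert (G2 : forall n, Cn n V (fun z => Im (G z))) by (apply smooth_on_Cn, HG).
assert (H1 : forall n, Cn n V (fun z => Re (H z))) by (intros n; apply Cn_lin; auto).
assert (H2 : forall n, Cn n V (fun z => Im (H z))) by (intros n; apply Cn_lin; auto).
assert (HS : smoothC_on V H) by (split; apply smooth_on_Cn; assumption).
destruct (smoothC_diff V G z0 HV HG Hz0) as [D1 D2]; fold a b c d in D1, D2.
destruct (diff_at_pd (fun z => Re (H z)) z0 _ _
  (diff_at_plus _ _ _ _ _ _ _ (diff_at_scal _ _ (d / J) _ _ D1) (diff_at_scal _ _ (- b / J) _ _ D2)))
  as [E1 E2].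
destruct (diff_at_pd (fun z => Im (H z)) z0 _ _
  (diff_at_plus _ _ _ _ _ _ _ (diff_at_scal _ _ (- c / J) _ _ D1) (diff_at_scal _ _ (a / J) _ _ D2)))
  as [E3 E4].
replace (d / J * a + - b / J * c) with 1 in E1 by (rewrite EJ in *; field; exact HJ).
replace (d / J * b + - b / J * d) with 0 in E2 by (field; exact HJ).
replace (- c / J * a + a / J * c) with 0 in E3 by (field; exact HJ).
replace (- c / J * b + a / J * d) with 1 in E4 by (rewrite EJ in *; field; exact HJ).
assert (Q : 0 < / 4) by lra.
destruct (cont_at_Cbox _ z0 (/ 4) (Cn_cont 0 V _ z0 (Cn_pd 0 V _ ax1 (H1 1%nat)) Hz0) Q) as [r1 R1].
destruct (cont_at_Cbox _ z0 (/ 4) (Cn_cont 0 V _ z0 (Cn_pd 0 V _ ax2 (H1 1%nat)) Hz0) Q) as [r2 R2].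
destruct (cont_at_Cbox _ z0 (/ 4) (Cn_cont 0 V _ z0 (Cn_pd 0 V _ ax1 (H2 1%nat)) Hz0) Q) as [r3 R3].
destruct (cont_at_Cbox _ z0 (/ 4) (Cn_cont 0 V _ z0 (Cn_pd 0 V _ ax2 (H2 1%nat)) Hz0) Q) as [r4 R4].
destruct (open_Cbox_subset V z0 HV Hz0) as [r5 R5].
rewrite E1 in R1; rewrite E2 in R2; rewrite E3 in R3; rewrite E4 in R4.
set (r := Rmin r5 (Rmin (Rmin r1 r2) (Rmin r3 r4))).
assert (Hr : 0 < r) by (repeat apply Rmin_pos; apply cond_pos).
assert (Sub : forall s, r <= s -> forall z, Cbox z0 r z -> Cbox z0 s z)
  by (intros s Hs z [Z1 Z2]; split; lra).
assert (L0 := Rmin_l r5 (Rmin (Rmin r1 r2) (Rmin r3 r4))).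
assert (L0' := Rmin_r r5 (Rmin (Rmin r1 r2) (Rmin r3 r4))).
assert (L1 := Rmin_l (Rmin r1 r2) (Rmin r3 r4)); assert (L2 := Rmin_r (Rmin r1 r2) (Rmin r3 r4)).
assert (L3 := Rmin_l r1 r2); assert (L4 := Rmin_r r1 r2).
assert (L5 := Rmin_l r3 r4); assert (L6 := Rmin_r r3 r4).
fold r in L0, L0'.
assert (HrV : forall z, Cbox z0 r z -> V z) by (intros z Hz; apply R5, (Sub r5 L0 z Hz)).
destruct (near_identity_inverse H z0 r Hr) as [Inj [gam [Hgam Sgam]]].
{ split; apply smooth_on_Cn; intros n; apply (Cn_subset n _ V); auto. }
{ intros z Hz; repeat split.
  - apply R1, (Sub r1 ltac:(lra) z Hz).
  - assert (K := R2 z (Sub r2 ltac:(lra) z Hz)); rewrite Rminus_0_r in K; exact K.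
  - assert (K := R3 z (Sub r3 ltac:(lra) z Hz)); rewrite Rminus_0_r in K; exact K.
  - apply R4, (Sub r4 ltac:(lra) z Hz). }
assert (Lin1 : forall n U, open U -> Cn n U (fun w => Re (lin w)))
  by (intros n U HU; apply Cn_lin; auto using Cn_Re, Cn_Im).
assert (Lin2 : forall n U, open U -> Cn n U (fun w => Im (lin w)))
  by (intros n U HU; apply Cn_lin; auto using Cn_Re, Cn_Im).
assert (Linj : forall w w', lin w = lin w' -> w = w').
{ intros w w' E; injection E as F1 F2.
  rewrite <- (C_eta w), <- (C_eta w'); f_equal.
  - transitivity (a * (d / J * Re w + - b / J * Im w) + b * (- c / J * Re w + a / J * Im w)).
    + rewrite EJ in *; field; exact HJ.
    + rewrite F1, F2; rewrite EJ in *; field; exact HJ.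
  - transitivity (c * (d / J * Re w + - b / J * Im w) + d * (- c / J * Re w + a / J * Im w)).
    + rewrite EJ in *; field; exact HJ.
    + rewrite F1, F2; rewrite EJ in *; field; exact HJ. }
assert (T : open (fun _ : C => True)) by (intros z _; exists (mkposreal 1 Rlt_0_1); auto).
assert (Q4 : 0 < r / 4) by lra.
(* A box about [G z0] that [lin] sends into the box of radius [r / 4]; the tolerance is [r / 8]
   because [cont_at_Cbox] gives a weak inequality. *)
destruct (cont_at_Cbox (fun w => Re (lin w)) (G z0) (r / 8)) as [s1 S1];
  [exact (Cn_cont 0 _ _ _ (Lin1 0%nat _ T) I) | lra |].
destruct (cont_at_Cbox (fun w => Im (lin w)) (G z0) (r / 8)) as [s2 S2];
  [exact (Cn_cont 0 _ _ _ (Lin2 0%nat _ T) I) | lra |].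
set (s := mkposreal _ (Rmin_pos _ _ (cond_pos s1) (cond_pos s2))).
assert (M1 : s <= s1) by apply Rmin_l; assert (M2 : s <= s2) by apply Rmin_r.
assert (Hs : forall w, Cbox (G z0) s w -> Cbox (H z0) (r / 4) (lin w)).
{ intros w [W1 W2]; split.
  - eapply Rle_lt_trans; [apply (S1 w); split; lra | lra].
  - eapply Rle_lt_trans; [apply (S2 w); split; lra | lra]. }
exists (Cbox z0 r), s, (fun w => gam (lin w)).
split; [apply open_Cbox |]; split; [exact HrV |]; split; [apply Cbox_center, Hr |].
split; [| split].
- intros z Hz Hw; destruct (Hgam _ (Hs _ Hw)) as [K1 K2]; apply Inj; auto.
- intros w Hw; destruct (Hgam _ (Hs _ Hw)) as [K1 K2]; split; [exact K1 |].
  apply Linj, K2.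
- destruct Sgam as [S1' S2']; split; apply smooth_on_Cn; intros n.
  + apply (Cn_comp n _ (Cbox (H z0) (r / 4)) (fun w => Re (gam w)) lin); auto using open_Cbox.
    intros w Hw; apply S1', Hw.
  + apply (Cn_comp n _ (Cbox (H z0) (r / 4)) (fun w => Im (gam w)) lin); auto using open_Cbox.
    intros w Hw; apply S2', Hw.
Qed.

(** * The immersion attached to holomorphic data *)

(* Real coordinate expressions: [p], [g], [q] stand for the values of [f'],
   [g], [g'], and [h] for [exp (Re f)]. *)
Definition Tr (g : C) : R := 1 + (Re g ^ 2 + Im g ^ 2).
Definition kr (p g q : C) : R :=
  Re q * (Re g * Re p - Im g * Im p) + Im q * (Re g * Im p + Im g * Re p).
Definition Nr1 (g : C) : R := 2 * Re g / Tr g.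
Definition Nr2 (g : C) : R := 2 * Im g / Tr g.
Definition Nr3 (g : C) : R := (2 - Tr g) / Tr g.
Definition Xr1 (h : R) (p g q : C) : R :=
  h / (2 * (Re q ^ 2 + Im q ^ 2)) *
    (Tr g * (Re q * Re p + Im q * Im p) - 2 * Re g * kr p g q) + h * Nr1 g.
Definition Xr2 (h : R) (p g q : C) : R :=
  h / (2 * (Re q ^ 2 + Im q ^ 2)) *
    (Tr g * (Im q * Re p - Re q * Im p) - 2 * Im g * kr p g q) + h * Nr2 g.
Definition Xr3 (h : R) (p g q : C) : R :=
  h / (2 * (Re q ^ 2 + Im q ^ 2)) * (- 2 * kr p g q) + h * Nr3 g.

Lemma Cmod_sq (z : C) : Cmod z ^ 2 = Re z ^ 2 + Im z ^ 2.
Proof.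
unfold Cmod; rewrite pow2_sqrt; [reflexivity |].
apply Rplus_le_le_0_compat; apply pow2_ge_0.
Qed.

Lemma Tr_pos (g : C) : 0 < Tr g.
Proof.
unfold Tr; assert (H1 := pow2_ge_0 (Re g)); assert (H2 := pow2_ge_0 (Im g)); lra.
Qed.

Lemma Tfun_Tr (g : C -> C) (z : C) : Tfun g z = Tr (g z).
Proof. unfold Tfun, Tr; rewrite Cmod_sq; reflexivity. Qed.

Lemma hfun_exp (f : C -> C) (z : C) : hfun f z = exp (Re (f z)).
Proof. unfold hfun, ipC; f_equal; unfold Re; simpl; ring. Qed.

Lemma norm_sq_neq_0 (q : C) : q <> RtoC 0 -> Re q ^ 2 + Im q ^ 2 <> 0.
Proof.
intros Hq E; apply Hq; rewrite <- Cmod_sq in E; apply Cmod_eq_0.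
destruct (Rmult_integral _ _ E) as [E' | E']; [exact E' | lra].
Qed.

Lemma comb3_coord (a b x1 x2 x3 y1 y2 y3 : R) :
  plus3 (scal3 a ((x1, x2), x3)) (scal3 b ((y1, y2), y3))
  = ((a * x1 + b * y1, a * x2 + b * y2), a * x3 + b * y3).
Proof.
unfold plus3, scal3, Cplus, Cmult, RtoC; simpl.
apply f_equal2; [apply f_equal2 |]; ring.
Qed.


Lemma Nfg_coord (g : C -> C) (z : C) :
  Nfg g z = ((Nr1 (g z), Nr2 (g z)), Nr3 (g z)).
Proof.
unfold Nfg; rewrite Tfun_Tr.
assert (HT := Tr_pos (g z)).
unfold scal3, Nr1, Nr2, Nr3, Cmult, RtoC, Re, Im; simpl.
apply f_equal2; [apply f_equal2 |]; field; lra.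
Qed.

Lemma Xfg_coord (f g : C -> C) (z : C) :
  C_derive g z <> RtoC 0 ->
  Xfg f g z = ((Xr1 (exp (Re (f z))) (C_derive f z) (g z) (C_derive g z),
                Xr2 (exp (Re (f z))) (C_derive f z) (g z) (C_derive g z)),
                Xr3 (exp (Re (f z))) (C_derive f z) (g z) (C_derive g z)).
Proof.
intros Hq; apply norm_sq_neq_0 in Hq.
unfold Xfg; rewrite Nfg_coord, Tfun_Tr, hfun_exp, Cmod_sq.
assert (Ek : ipC (C_derive g z) (g z * C_derive f z)%C = kr (C_derive f z) (g z) (C_derive g z))
  by (unfold ipC, kr, Cmult, Cconj, Re, Im; simpl; ring).
rewrite Ek.
unfold Xr1, Xr2, Xr3.
revert Hq; generalize (kr (C_derive f z) (g z) (C_derive g z)) (C_derive f z) (C_derive g z) (g z)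
  (exp (Re (f z))).
intros k [p1 p2] [q1 q2] w h; simpl; intros Hq.
unfold plus3, scal3, Cplus, Cmult, Cminus, Copp, Cconj, RtoC; simpl.
fold (Re w) (Im w).
apply f_equal2; [apply f_equal2 |]; field; simpl; lra.
Qed.

(* The derivatives of [Nr1], [Nr2], [Nr3] in the direction [d]. *)
Definition dNr1 (g d : C) : R :=
  2 * Re d / Tr g - 4 * Re g * (Re g * Re d + Im g * Im d) / Tr g ^ 2.
Definition dNr2 (g d : C) : R :=
  2 * Im d / Tr g - 4 * Im g * (Re g * Re d + Im g * Im d) / Tr g ^ 2.
Definition dNr3 (g d : C) : R := - 4 * (Re g * Re d + Im g * Im d) / Tr g ^ 2.

Lemma is_derive_Nr (gr gi : R -> R) (t : R) (d : C) :
  is_derive gr t (Re d) -> is_derive gi t (Im d) ->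
  is_derive (fun s => Nr1 (gr s, gi s)) t (dNr1 (gr t, gi t) d) /\
  is_derive (fun s => Nr2 (gr s, gi s)) t (dNr2 (gr t, gi t) d) /\
  is_derive (fun s => Nr3 (gr s, gi s)) t (dNr3 (gr t, gi t) d).
Proof.
intros H1 H2; assert (HT := Tr_pos (gr t, gi t)).
unfold Nr1, Nr2, Nr3, dNr1, dNr2, dNr3, Tr in *; simpl in *.
assert (K1 := is_derive_unique _ _ _ H1); assert (K2 := is_derive_unique _ _ _ H2).
split; [| split]; auto_derive; simpl;
  try (repeat split; try (eexists; eassumption); lra);
  change (Derive (fun x => gr x) t) with (Derive gr t);
  change (Derive (fun x => gi x) t) with (Derive gi t);
  rewrite ?K1, ?K2; field; lra.
Qed.

(** The conformal factor of the Gauss map, that is, the common squared length of N_,1 and N_,2. *)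
Definition Lr (g q : C) : R := 4 * (Re q ^ 2 + Im q ^ 2) / Tr g ^ 2.

(* The value of [2 / T * g' * conj g]. *)
Definition drift (g q : C) : C :=
  (2 / Tr g * (Re q * Re g + Im q * Im g), 2 / Tr g * (Im q * Re g - Re q * Im g)).

(* The matrix [V] in terms of the values of [h], [f'], [f''], [g], [g'] and of
   [mu = g'' / g' - 2 / T * g' * conj g], for which [xi = f' * mu - f'']. *)
Definition Vr (h : R) (p s g q mu : C) : mat2 := fun i j =>
  let xi := (p * mu - s)%C in
  match i, j with
  | ax1, ax1 => h * (Re p ^ 2 - Re xi) / Lr g q + h
  | ax2, ax2 => h * (Im p ^ 2 + Re xi) / Lr g q + h
  | _, _ => h * (Im xi - Re p * Im p) / Lr g q
  end.

(** Differentiation along a line of direction [dir] treats both axes in one computation. Writing g''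
    as [q * rho] lets it enter only through [rho - drift g q]. The vectors with arguments [q] and
    [Ci * q] are N_,1 and N_,2. *)
Lemma is_derive_Xr (h pr pi gr gi qr qi : R -> R) (t : R) (dir s rho : C) :
  let p := (pr t, pi t) in let g := (gr t, gi t) in let q := (qr t, qi t) in
  let V := Vr (h t) p s g q (rho - drift g q)%C in
  let a := Re dir * V ax1 ax1 + Im dir * V ax2 ax1 in
  let b := Re dir * V ax1 ax2 + Im dir * V ax2 ax2 in
  Re q ^ 2 + Im q ^ 2 <> 0 ->
  is_derive h t (h t * Re (dir * p)%C) ->
  is_derive pr t (Re (dir * s)%C) -> is_derive pi t (Im (dir * s)%C) ->
  is_derive gr t (Re (dir * q)%C) -> is_derive gi t (Im (dir * q)%C) ->
  is_derive qr t (Re (dir * (q * rho))%C) -> is_derive qi t (Im (dir * (q * rho))%C) ->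
  is_derive (fun t => Xr1 (h t) (pr t, pi t) (gr t, gi t) (qr t, qi t)) t
    (a * dNr1 g q + b * dNr1 g (Ci * q)%C) /\
  is_derive (fun t => Xr2 (h t) (pr t, pi t) (gr t, gi t) (qr t, qi t)) t
    (a * dNr2 g q + b * dNr2 g (Ci * q)%C) /\
  is_derive (fun t => Xr3 (h t) (pr t, pi t) (gr t, gi t) (qr t, qi t)) t
    (a * dNr3 g q + b * dNr3 g (Ci * q)%C).
Proof.
intros p g q V a b Hq Hh Hpr Hpi Hgr Hgi Hqr Hqi.
assert (HT := Tr_pos g).
assert (Kh := is_derive_unique _ _ _ Hh).
assert (Kpr := is_derive_unique _ _ _ Hpr); assert (Kpi := is_derive_unique _ _ _ Hpi).
assert (Kgr := is_derive_unique _ _ _ Hgr); assert (Kgi := is_derive_unique _ _ _ Hgi).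
assert (Kqr := is_derive_unique _ _ _ Hqr); assert (Kqi := is_derive_unique _ _ _ Hqi).
unfold a, b, V, Vr, Lr, drift, Xr1, Xr2, Xr3, Nr1, Nr2, Nr3, dNr1, dNr2, dNr3, kr, Tr, p, g, q in *.
destruct dir as [dr di], s as [sr si], rho as [rr ri].
simpl in *.
split; [| split]; auto_derive;
  try (repeat split; try (eexists; eassumption); lra);
  change (Derive (fun x => h x) t) with (Derive h t);
  change (Derive (fun x => pr x) t) with (Derive pr t);
  change (Derive (fun x => pi x) t) with (Derive pi t);
  change (Derive (fun x => gr x) t) with (Derive gr t);
  change (Derive (fun x => gi x) t) with (Derive gi t);
  change (Derive (fun x => qr x) t) with (Derive qr t);
  change (Derive (fun x => qi x) t) with (Derive qi t);
  rewrite Kh, Kpr, Kpi, Kgr, Kgi, Kqr, Kqi;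
  clear - Hq HT; revert Hq HT;
  generalize (h t) (pr t) (pi t) (gr t) (gi t) (qr t) (qi t);
  intros hh a b c d e f Hq HT;
  field; repeat split; lra.
Qed.

(** Logarithmic differentiation: ln L = ln 4 + 2 ln |g'| - 2 ln T, where ln |g'| contributes [rho]
    and ln T contributes [drift]. So [mu] encodes the gradient of (ln L) / 2. *)
Lemma is_derive_Lr (gr gi qr qi : R -> R) (t : R) (dir rho : C) :
  let g := (gr t, gi t) in let q := (qr t, qi t) in
  is_derive gr t (Re (dir * q)%C) -> is_derive gi t (Im (dir * q)%C) ->
  is_derive qr t (Re (dir * (q * rho))%C) -> is_derive qi t (Im (dir * (q * rho))%C) ->
  is_derive (fun t => Lr (gr t, gi t) (qr t, qi t)) t
    (2 * Lr g q * Re (dir * (rho - drift g q))%C).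
Proof.
intros g q Hgr Hgi Hqr Hqi.
assert (HT := Tr_pos g).
assert (Kgr := is_derive_unique _ _ _ Hgr); assert (Kgi := is_derive_unique _ _ _ Hgi).
assert (Kqr := is_derive_unique _ _ _ Hqr); assert (Kqi := is_derive_unique _ _ _ Hqi).
unfold Lr, drift, Tr, g, q in *.
destruct dir as [dr di], rho as [rr ri].
simpl in *.
auto_derive.
- repeat split; try (eexists; eassumption).
  apply Rgt_not_eq; nra.
- change (Derive (fun x => gr x) t) with (Derive gr t).
  change (Derive (fun x => gi x) t) with (Derive gi t).
  change (Derive (fun x => qr x) t) with (Derive qr t).
  change (Derive (fun x => qi x) t) with (Derive qi t).
  rewrite Kgr, Kgi, Kqr, Kqi.
  clear - HT; revert HT.
  generalize (gr t) (gi t) (qr t) (qi t); intros c d e f HT.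
  field; lra.
Qed.

(** * Partial derivatives of X, N, h and of the metric L *)

Definition dir (i : axis) : C := match i with ax1 => RtoC 1 | ax2 => Ci end.

Definition line (i : axis) (z : C) (t : R) : C :=
  match i with ax1 => (t, Im z) | ax2 => (Re z, t) end.

Definition coord (i : axis) (z : C) : R := match i with ax1 => Re z | ax2 => Im z end.

Lemma line_coord (i : axis) (z : C) : line i z (coord i z) = z.
Proof. destruct i, z; reflexivity. Qed.

Lemma pd_line (i : axis) (F : C -> R) (z : C) :
  pd i F z = Derive (fun t => F (line i z t)) (coord i z).
Proof. destruct i; reflexivity. Qed.

Lemma holomorphic_line (U : C -> Prop) (f : C -> C) (i : axis) (z : C) :
  holomorphic_on U f -> U z ->
  is_derive (fun t => Re (f (line i z t))) (coord i z) (Re (dir i * C_derive f z)%C) /\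
  is_derive (fun t => Im (f (line i z t))) (coord i z) (Im (dir i * C_derive f z)%C).
Proof.
intros Hf Hz; destruct (holomorphic_diff_at U f z Hf Hz) as [D1 D2].
apply diff_at_slices in D1; apply diff_at_slices in D2.
destruct D1 as [D1 D1'], D2 as [D2 D2'], i; unfold dir, line, coord.
- replace (RtoC 1 * C_derive f z)%C with (C_derive f z) by ring; split; assumption.
- replace (Re (Ci * C_derive f z)%C) with (- Im (C_derive f z)) by (unfold Re, Im; simpl; ring).
  replace (Im (Ci * C_derive f z)%C) with (Re (C_derive f z)) by (unfold Re, Im; simpl; ring).
  split; assumption.
Qed.

Lemma is_derive_hfun_line (U : C -> Prop) (f : C -> C) (i : axis) (z : C) :
  holomorphic_on U f -> U z ->
  is_derive (fun t => hfun f (line i z t)) (coord i z)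
    (hfun f z * Re (dir i * C_derive f z)%C).
Proof.
intros Hf Hz; destruct (holomorphic_line U f i z Hf Hz) as [D _].
apply (is_derive_ext (fun t => exp (Re (f (line i z t))))).
{ intros t; symmetry; apply hfun_exp. }
replace (hfun f z) with (exp (Re (f (line i z (coord i z)))))
  by (rewrite line_coord, hfun_exp; reflexivity).
rewrite Rmult_comm.
apply (is_derive_comp exp (fun t => Re (f (line i z t)))); [apply is_derive_exp |].
exact D.
Qed.

Definition mu_fun (g : C -> C) (z : C) : C :=
  (C_derive (C_derive g) z / C_derive g z - drift (g z) (C_derive g z))%C.

Definition Vfg (f g : C -> C) (z : C) : mat2 :=
  Vr (hfun f z) (C_derive f z) (C_derive (C_derive f) z) (g z) (C_derive g z) (mu_fun g z).

Lemma pd3_Nfg (U : C -> Prop) (g : C -> C) (i : axis) (z : C) :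
  holomorphic_on U g -> U z ->
  pd3 i (Nfg g) z =
    ((dNr1 (g z) (dir i * C_derive g z)%C, dNr2 (g z) (dir i * C_derive g z)%C),
      dNr3 (g z) (dir i * C_derive g z)%C).
Proof.
intros Hg Hz; destruct (holomorphic_line U g i z Hg Hz) as [G1 G2].
destruct (is_derive_Nr _ _ _ _ G1 G2) as [K1 [K2 K3]].
rewrite !line_coord, !C_eta in *.
unfold pd3; rewrite !pd_line.
apply f_equal2; [apply f_equal2 |]; apply is_derive_unique;
  (eapply is_derive_ext; [| eassumption]); intros t; cbv beta; rewrite C_eta, Nfg_coord; reflexivity.
Qed.

Lemma pd3_Xfg (U : C -> Prop) (f g : C -> C) (i : axis) (z : C) :
  open U -> holomorphic_on U f -> holomorphic_on U g ->
  (forall w, U w -> C_derive g w <> RtoC 0) -> U z ->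
  pd3 i (Xfg f g) z =
    plus3 (scal3 (Vfg f g z i ax1) (pd3 ax1 (Nfg g) z))
          (scal3 (Vfg f g z i ax2) (pd3 ax2 (Nfg g) z)).
Proof.
intros HU Hf Hg H0 Hz.
assert (Hf' := holomorphic_derive U f HU Hf); assert (Hg' := holomorphic_derive U g HU Hg).
assert (Hq := H0 z Hz).
set (rho := (C_derive (C_derive g) z / C_derive g z)%C).
assert (Erho : C_derive (C_derive g) z = (C_derive g z * rho)%C)
  by (unfold rho; field; exact Hq).
assert (Dh := is_derive_hfun_line U f i z Hf Hz).
destruct (holomorphic_line U _ i z Hf' Hz) as [Dp1 Dp2].
destruct (holomorphic_line U _ i z Hg Hz) as [Dg1 Dg2].
destruct (holomorphic_line U _ i z Hg' Hz) as [Dq1 Dq2].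
rewrite Erho in Dq1, Dq2.
assert (K := is_derive_Xr (fun t => hfun f (line i z t))
  (fun t => Re (C_derive f (line i z t))) (fun t => Im (C_derive f (line i z t)))
  (fun t => Re (g (line i z t))) (fun t => Im (g (line i z t)))
  (fun t => Re (C_derive g (line i z t))) (fun t => Im (C_derive g (line i z t)))
  (coord i z) (dir i) (C_derive (C_derive f) z) rho).
cbv zeta beta in K; rewrite !line_coord, !C_eta in K.
destruct (K (norm_sq_neq_0 _ Hq) Dh Dp1 Dp2 Dg1 Dg2 Dq1 Dq2) as [K1 [K2 K3]]; clear K.
change (Vr (hfun f z) (C_derive f z) (C_derive (C_derive f) z) (g z) (C_derive g z)
         (rho - drift (g z) (C_derive g z))) with (Vfg f g z) in *.
rewrite !(pd3_Nfg U g _ z Hg Hz).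
unfold pd3.
rewrite !(pd_ext U (fun w => Re (fst (Xfg f g w)))
  (fun w => Xr1 (hfun f w) (C_derive f w) (g w) (C_derive g w)) i z HU Hz)
  by (intros w Hw; rewrite Xfg_coord, hfun_exp by auto; reflexivity).
rewrite !(pd_ext U (fun w => Im (fst (Xfg f g w)))
  (fun w => Xr2 (hfun f w) (C_derive f w) (g w) (C_derive g w)) i z HU Hz)
  by (intros w Hw; rewrite Xfg_coord, hfun_exp by auto; reflexivity).
rewrite !(pd_ext U (fun w => snd (Xfg f g w))
  (fun w => Xr3 (hfun f w) (C_derive f w) (g w) (C_derive g w)) i z HU Hz)
  by (intros w Hw; rewrite Xfg_coord, hfun_exp by auto; reflexivity).
rewrite !pd_line.
assert (E1 : (dir ax1 * C_derive g z = C_derive g z)%C) by (simpl; ring).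
rewrite E1; simpl (dir ax2).
rewrite comb3_coord.
set (a := Vfg f g z i ax1) in *; set (b := Vfg f g z i ax2) in *.
replace (Re (dir i) * Vfg f g z ax1 ax1 + Im (dir i) * Vfg f g z ax2 ax1) with a in *
  by (unfold a; destruct i; simpl; ring).
replace (Re (dir i) * Vfg f g z ax1 ax2 + Im (dir i) * Vfg f g z ax2 ax2) with b in *
  by (unfold b; destruct i; simpl; ring).
apply f_equal2; [apply f_equal2 |]; apply is_derive_unique;
  (eapply is_derive_ext; [| eassumption]); intros t; cbv beta; rewrite !C_eta; reflexivity.
Qed.

Lemma Lmat_Lr (g : C -> C) (w : C) (i j : axis) :
  Lmat g w i j = Lr (g w) (C_derive g w) * delta i j.
Proof. unfold Lmat, Lr; rewrite Cmod_sq, Tfun_Tr; reflexivity. Qed.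

Lemma Lr_pos (g q : C) : q <> RtoC 0 -> 0 < Lr g q.
Proof.
intros Hq; apply norm_sq_neq_0 in Hq; assert (HT := Tr_pos g); unfold Lr.
assert (H1 := pow2_ge_0 (Re q)); assert (H2 := pow2_ge_0 (Im q)).
apply Rdiv_lt_0_compat; [lra | apply pow_lt; exact HT].
Qed.

Lemma pd_Lmat (U : C -> Prop) (g : C -> C) (i j k : axis) (z : C) :
  open U -> holomorphic_on U g -> U z -> C_derive g z <> RtoC 0 ->
  pd k (fun w => Lmat g w i j) z =
    2 * Lr (g z) (C_derive g z) * Re (dir k * mu_fun g z)%C * delta i j.
Proof.
intros HU Hg Hz Hq.
assert (Hg' := holomorphic_derive U g HU Hg).
set (rho := (C_derive (C_derive g) z / C_derive g z)%C).
assert (Erho : C_derive (C_derive g) z = (C_derive g z * rho)%C)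
  by (unfold rho; field; exact Hq).
destruct (holomorphic_line U _ k z Hg Hz) as [Dg1 Dg2].
destruct (holomorphic_line U _ k z Hg' Hz) as [Dq1 Dq2].
rewrite Erho in Dq1, Dq2.
assert (K := is_derive_Lr
  (fun t => Re (g (line k z t))) (fun t => Im (g (line k z t)))
  (fun t => Re (C_derive g (line k z t))) (fun t => Im (C_derive g (line k z t)))
  (coord k z) (dir k) rho).
cbv zeta beta in K; rewrite !line_coord, !C_eta in K.
specialize (K Dg1 Dg2 Dq1 Dq2).
rewrite pd_line; apply is_derive_unique.
apply (is_derive_ext (fun t => delta i j * Lr (g (line k z t)) (C_derive g (line k z t)))).
{ intros t; rewrite Lmat_Lr; apply Rmult_comm. }
rewrite Rmult_comm; apply (is_derive_scal (fun t => Lr (g (line k z t)) (C_derive g (line k z t)))).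
eapply is_derive_ext; [| exact K]; intros t; cbv beta; rewrite !C_eta; reflexivity.
Qed.

(** The classical Christoffel symbols of a conformal metric exp(2 phi) (du1^2 + du2^2), with [m] the
    differential of phi = (ln L) / 2. *)
Lemma christoffel_conformal (U : C -> Prop) (g : C -> C) (i j k : axis) (z : C) :
  open U -> holomorphic_on U g -> U z -> C_derive g z <> RtoC 0 ->
  let m := fun i => Re (dir i * mu_fun g z)%C in
  christoffel (Lmat g) k i j z = delta j k * m i + delta i k * m j - delta i j * m k.
Proof.
intros HU Hg Hz Hq m.
unfold christoffel, sum_axis.
rewrite !(pd_Lmat U g _ _ _ z HU Hg Hz Hq).
unfold inv2, det2; rewrite !Lmat_Lr.
assert (HL := Lr_pos (g z) _ Hq).
fold (m ax1) (m ax2) (m i) (m j).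
destruct i, j, k; simpl; field; lra.
Qed.

Lemma pd_hfun (U : C -> Prop) (f : C -> C) (i : axis) (z : C) :
  holomorphic_on U f -> U z -> pd i (hfun f) z = hfun f z * Re (dir i * C_derive f z)%C.
Proof.
intros Hf Hz; rewrite pd_line; apply is_derive_unique, (is_derive_hfun_line U); assumption.
Qed.

Lemma pd_pd_hfun (U : C -> Prop) (f : C -> C) (i j : axis) (z : C) :
  open U -> holomorphic_on U f -> U z ->
  pd j (pd i (hfun f)) z =
    hfun f z * (Re (dir j * C_derive f z)%C * Re (dir i * C_derive f z)%C
                + Re (dir i * (dir j * C_derive (C_derive f) z))%C).
Proof.
intros HU Hf Hz.
assert (Hf' := holomorphic_derive U f HU Hf).
assert (Dh := is_derive_hfun_line U f j z Hf Hz).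
destruct (holomorphic_line U _ j z Hf' Hz) as [D1 D2].
rewrite (pd_ext U _ (fun w => hfun f w * Re (dir i * C_derive f w)%C) j z HU Hz)
  by (intros w Hw; apply (pd_hfun U); assumption).
rewrite pd_line; apply is_derive_unique.
set (s := (dir j * C_derive (C_derive f) z)%C) in *.
assert (D : is_derive (fun t => Re (dir i * C_derive f (line j z t))%C) (coord j z)
              (Re (dir i * s)%C)).
{ destruct i; unfold dir.
  - replace (RtoC 1 * s)%C with s by ring.
    apply (is_derive_ext (fun t => Re (C_derive f (line j z t)))); [| exact D1].
    intros t; f_equal; ring.
  - replace (Re (Ci * s)%C) with (-1 * Im s) by (unfold Re, Im; simpl; ring).
    apply (is_derive_ext (fun t => -1 * Im (C_derive f (line j z t)))).
    + intros t; unfold Re, Im; simpl; ring.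
    + apply (is_derive_scal (fun t => Im (C_derive f (line j z t)))); exact D2. }
assert (K := is_derive_mult (K := R_AbsRing) _ _ _ _ _ Dh D Rmult_comm).
cbv beta in K; rewrite line_coord in K.
refine (eq_ind _ (is_derive _ _) K _ _).
match goal with |- ?a = ?b => change (@eq R a b) end.
unfold plus, mult; cbn -[Re Cmult C_derive hfun dir]; ring.
Qed.

(** The plain Hessian of [h = exp (Re f)] gives products of parts of f' and a part of f''; the
    Christoffel terms give the matching part of f' mu. Together these form [xi]. *)
Lemma Vmat_Vfg (U : C -> Prop) (f g : C -> C) (i j : axis) (z : C) :
  open U -> holomorphic_on U f -> holomorphic_on U g -> U z ->
  C_derive g z <> RtoC 0 ->
  Vmat f g z i j = Vfg f g z i j.
Proof.
intros HU Hf Hg Hz Hq.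
unfold Vmat, sum_axis.
rewrite !(pd_pd_hfun U), !(pd_hfun U), !(christoffel_conformal U), !Lmat_Lr by assumption.
assert (HL := Lr_pos (g z) _ Hq).
unfold Vfg, Vr; revert HL.
generalize (Lr (g z) (C_derive g z)) (hfun f z) (mu_fun g z) (C_derive f z) (C_derive (C_derive f) z).
intros L h [m1 m2] [p1 p2] [s1 s2] HL.
destruct i, j; simpl; field; lra.
Qed.

(** * Conformal frames, curvatures and fundamental forms *)

Lemma ip3_comb_l (a b : R) (x y w : R3) :
  ip3 (plus3 (scal3 a x) (scal3 b y)) w = a * ip3 x w + b * ip3 y w.
Proof.
destruct x as [[x1 x2] x3], y as [[y1 y2] y3], w as [[w1 w2] w3].
unfold ip3, ipC, plus3, scal3; simpl; ring.
Qed.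

Lemma ip3_sym (x y : R3) : ip3 x y = ip3 y x.
Proof.
destruct x as [[x1 x2] x3], y as [[y1 y2] y3]; unfold ip3, ipC; simpl; ring.
Qed.

Lemma ip3_coord (x1 x2 x3 y1 y2 y3 : R) :
  ip3 ((x1, x2), x3) ((y1, y2), y3) = x1 * y1 + x2 * y2 + x3 * y3.
Proof. unfold ip3, ipC; simpl; ring. Qed.

Lemma Nr_unit (g : C) : Nr1 g * Nr1 g + Nr2 g * Nr2 g + Nr3 g * Nr3 g = 1.
Proof.
assert (HT := Tr_pos g); destruct g as [x y]; unfold Nr1, Nr2, Nr3, Tr in *; simpl in *.
field; lra.
Qed.

Lemma Nr_dNr (g d : C) : Nr1 g * dNr1 g d + Nr2 g * dNr2 g d + Nr3 g * dNr3 g d = 0.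
Proof.
assert (HT := Tr_pos g); destruct g as [x y], d as [d1 d2].
unfold Nr1, Nr2, Nr3, dNr1, dNr2, dNr3, Tr in *; simpl in *.
field; lra.
Qed.

(* Stereographic projection is conformal. *)
Lemma dNr_dNr (g d e : C) :
  dNr1 g d * dNr1 g e + dNr2 g d * dNr2 g e + dNr3 g d * dNr3 g e
  = 4 * (Re d * Re e + Im d * Im e) / Tr g ^ 2.
Proof.
assert (HT := Tr_pos g); destruct g as [x y], d as [d1 d2], e as [e1 e2].
unfold dNr1, dNr2, dNr3, Tr in *; simpl in *.
field; lra.
Qed.

Definition conformal_frame (L : R) (N1 N2 : R3) : Prop :=
  0 < L /\ ip3 N1 N1 = L /\ ip3 N2 N2 = L /\ ip3 N1 N2 = 0.

Lemma Nfg_frame (U : C -> Prop) (g : C -> C) (z : C) :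
  holomorphic_on U g -> U z -> C_derive g z <> RtoC 0 ->
  conformal_frame (Lr (g z) (C_derive g z)) (pd3 ax1 (Nfg g) z) (pd3 ax2 (Nfg g) z).
Proof.
intros Hg Hz Hq; split; [apply Lr_pos, Hq |].
rewrite !(pd3_Nfg U g _ z Hg Hz), !ip3_coord, !dNr_dNr.
unfold Lr, dir.
generalize (C_derive g z) (Tr_pos (g z)); intros [q1 q2]; generalize (Tr (g z)); intros T HT; simpl.
repeat split; field; lra.
Qed.

Lemma Nfg_unit (g : C -> C) (z : C) : ip3 (Nfg g z) (Nfg g z) = 1.
Proof. rewrite Nfg_coord, ip3_coord; apply Nr_unit. Qed.

Lemma Nfg_orthogonal (U : C -> Prop) (g : C -> C) (i : axis) (z : C) :
  holomorphic_on U g -> U z -> ip3 (Nfg g z) (pd3 i (Nfg g) z) = 0.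
Proof.
intros Hg Hz; rewrite (pd3_Nfg U g _ z Hg Hz), Nfg_coord, ip3_coord; apply Nr_dNr.
Qed.

Definition comb (v : axis -> R) (N1 N2 : R3) : R3 :=
  plus3 (scal3 (v ax1) N1) (scal3 (v ax2) N2).

Definition mulmat (A B : mat2) : mat2 := fun i k => A i ax1 * B ax1 k + A i ax2 * B ax2 k.

Lemma comb_mulmat (A B : mat2) (N1 N2 : R3) (i : axis) :
  comb (A i) (comb (B ax1) N1 N2) (comb (B ax2) N1 N2) = comb (mulmat A B i) N1 N2.
Proof.
destruct N1 as [[x1 x2] x3], N2 as [[y1 y2] y3]; unfold comb.
rewrite !comb3_coord; unfold mulmat.
apply f_equal2; [apply f_equal2 |]; ring.
Qed.

Lemma ip3_comb_frame (L : R) (N1 N2 : R3) (v w : axis -> R) :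
  conformal_frame L N1 N2 ->
  ip3 (comb v N1 N2) (comb w N1 N2) = L * (v ax1 * w ax1 + v ax2 * w ax2).
Proof.
intros [HL [H1 [H2 H3]]]; unfold comb.
rewrite ip3_comb_l, !(ip3_sym _ (plus3 _ _)), !ip3_comb_l.
rewrite (ip3_sym N2 N1), H1, H2, H3; ring.
Qed.

Lemma comb_inj (L : R) (N1 N2 : R3) (v w : axis -> R) :
  conformal_frame L N1 N2 -> comb v N1 N2 = comb w N1 N2 -> forall i, v i = w i.
Proof.
intros F E.
assert (K : forall u : axis -> R, ip3 (comb v N1 N2) (comb u N1 N2) = ip3 (comb w N1 N2) (comb u N1 N2))
  by (intros u; rewrite E; reflexivity).
assert (HL := proj1 F).
assert (K1 := K (delta ax1)); assert (K2 := K (delta ax2)).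
rewrite !(ip3_comb_frame L) in K1, K2 by exact F; simpl in K1, K2.
intros [|]; apply Rmult_eq_reg_l with L; lra.
Qed.

Lemma comb_0 (N1 N2 : R3) : comb (fun _ => 0) N1 N2 = origin3.
Proof.
destruct N1 as [[x1 x2] x3], N2 as [[y1 y2] y3]; unfold comb.
rewrite comb3_coord; unfold origin3, RtoC.
apply f_equal2; [apply f_equal2 |]; ring.
Qed.

Lemma regular_frame (Y : C -> R3) (z : C) (L : R) (N1 N2 : R3) (A : mat2) :
  conformal_frame L N1 N2 -> (forall i, pd3 i Y z = comb (A i) N1 N2) ->
  (regular_at Y z <-> det2 A <> 0).
Proof.
intros F HA.
assert (K : forall s t, plus3 (scal3 s (pd3 ax1 Y z)) (scal3 t (pd3 ax2 Y z)) = origin3 <->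
  s * A ax1 ax1 + t * A ax2 ax1 = 0 /\ s * A ax1 ax2 + t * A ax2 ax2 = 0).
{ intros s t.
  assert (E : plus3 (scal3 s (pd3 ax1 Y z)) (scal3 t (pd3 ax2 Y z))
    = comb (fun k => s * A ax1 k + t * A ax2 k) N1 N2).
  { rewrite !HA.
    exact (comb_mulmat (fun _ j => match j with ax1 => s | ax2 => t end) A N1 N2 ax1). }
  rewrite E, <- (comb_0 N1 N2); split.
  - intros H; split.
    + exact (comb_inj L N1 N2 _ _ F H ax1).
    + exact (comb_inj L N1 N2 _ _ F H ax2).
  - intros [H1 H2]; unfold comb; rewrite H1, H2; reflexivity. }
unfold regular_at, det2; split.
- intros HR D.
  assert (R1 := fun s t H => HR s t (proj2 (K s t) H)).
  (* When the determinant vanishes, the cofactor vectors are relations between the rows of [A].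
     Regularity makes them zero, hence [A] is zero, and then (1, 0) is a forbidden relation. *)
  destruct (R1 (- A ax2 ax1) (A ax1 ax1)) as [E1 E2]; [split; [ring | lra] |].
  destruct (R1 (A ax2 ax2) (- A ax1 ax2)) as [E3 E4]; [split; [lra | ring] |].
  destruct (R1 1 0) as [E5 _]; [split; lra | lra].
- intros D s t H; apply K in H; destruct H as [H1 H2].
  split; apply Rmult_eq_reg_r with (A ax1 ax1 * A ax2 ax2 - A ax1 ax2 * A ax2 ax1);
    try exact D; rewrite Rmult_0_l.
  + transitivity ((s * A ax1 ax1 + t * A ax2 ax1) * A ax2 ax2
      - (s * A ax1 ax2 + t * A ax2 ax2) * A ax2 ax1); [ring | rewrite H1, H2; ring].
  + transitivity ((s * A ax1 ax2 + t * A ax2 ax2) * A ax1 ax1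
      - (s * A ax1 ax1 + t * A ax2 ax1) * A ax1 ax2); [ring | rewrite H1, H2; ring].
Qed.

(** This makes the choice by [epsilon] harmless: [J A^-1] shows that a Weingarten matrix exists, and
    linear independence of the frame turns the defining vector equations into matrix equations. *)
Lemma weingarten_frame (Y M : C -> R3) (z : C) (L : R) (N1 N2 : R3) (A J : mat2) :
  conformal_frame L N1 N2 -> regular_at Y z ->
  (forall i, pd3 i Y z = comb (A i) N1 N2) ->
  (forall i, pd3 i M z = comb (J i) N1 N2) ->
  forall i k, mulmat (weingarten Y M z) A i k = J i k.
Proof.
intros F HR HA HJ.
assert (HD : det2 A <> 0) by (apply (regular_frame Y z L N1 N2 A F HA); exact HR).
assert (W : is_weingarten Y M z (weingarten Y M z)).
{ unfold weingarten; apply epsilon_spec.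
  exists (mulmat J (inv2 A)); intros i; rewrite !HA, HJ.
  change (comb (J i) N1 N2 = comb (mulmat J (inv2 A) i) (comb (A ax1) N1 N2) (comb (A ax2) N1 N2)).
  rewrite comb_mulmat.
  unfold comb, mulmat, inv2; f_equal; f_equal; unfold det2 in *; field; exact HD. }
intros i k; specialize (W i); rewrite !HA, HJ in W.
change (comb (J i) N1 N2 = comb (weingarten Y M z i) (comb (A ax1) N1 N2) (comb (A ax2) N1 N2)) in W.
rewrite comb_mulmat in W.
symmetry; exact (comb_inj L N1 N2 _ _ F W k).
Qed.

(* The Weingarten matrix is conjugate to the inverse of [V]. *)
Lemma curvatures_frame (Y M : C -> R3) (z : C) (L : R) (N1 N2 : R3) (V J : mat2) :
  conformal_frame L N1 N2 -> regular_at Y z ->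
  (forall i, pd3 i Y z = comb (mulmat J V i) N1 N2) ->
  (forall i, pd3 i M z = comb (J i) N1 N2) ->
  det2 V <> 0 /\ gauss_curv Y M z = 1 / det2 V /\
  mean_curv Y M z = - (tr2 V / (2 * det2 V)).
Proof.
intros F HR HA HJ.
assert (HD : det2 (mulmat J V) <> 0) by (apply (regular_frame Y z L N1 N2 _ F HA); exact HR).
assert (W := weingarten_frame Y M z L N1 N2 _ J F HR HA HJ).
unfold gauss_curv, mean_curv.
set (w := weingarten Y M z) in *.
assert (EV : det2 (mulmat J V) = det2 J * det2 V) by (unfold det2, mulmat; ring).
rewrite EV in HD.
assert (HDJ : det2 J <> 0) by (intros E; apply HD; rewrite E; ring).
assert (HDV : det2 V <> 0) by (intros E; apply HD; rewrite E; ring).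
assert (EW : forall i k, w i k = mulmat J (inv2 (mulmat J V)) i k).
{ intros i k; unfold mulmat at 1; rewrite <- !W; fold w.
  set (B := mulmat J V) in *.
  rewrite <- EV in HD.
  destruct k; unfold mulmat, inv2; unfold det2 in *; field; exact HD. }
split; [exact HDV |].
unfold tr2; unfold det2 at 1.
rewrite !EW; unfold mulmat, inv2; unfold det2 in *.
split; field; unfold mulmat; repeat split; try lra.
Qed.

Lemma drift_C (g q : C) : drift g q = (RtoC (2 / Tr g) * q * Cconj g)%C.
Proof.
destruct g as [x y], q as [q1 q2].
unfold drift, Cmult, Cconj, RtoC, Re, Im; cbn -[Tr].
apply f_equal2; ring.
Qed.

(** The spherical type equation multiplied by [det2 V]. The result contains neither curvatures nor
    [J], so it can be read off in any coordinate. *)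
Lemma SS_frame (Y M : C -> R3) (z : C) (L : R) (N1 N2 : R3) (V J : mat2) :
  conformal_frame L N1 N2 -> regular_at Y z -> ip3 (M z) (M z) = 1 ->
  (forall i, pd3 i Y z = comb (mulmat J V i) N1 N2) ->
  (forall i, pd3 i M z = comb (J i) N1 N2) ->
  SS_at Y M z <->
  quad_dist Y z + support Y M z ^ 2 = support Y M z * tr2 V.
Proof.
intros F HR HM HA HJ.
destruct (curvatures_frame Y M z L N1 N2 V J F HR HA HJ) as [HD [EK EH]].
rewrite SS_atE; [| exact HM | rewrite EK; unfold Rdiv; rewrite Rmult_1_l; apply Rinv_neq_0_compat, HD].
rewrite EK, EH.
set (Q := quad_dist Y z); set (psi := support Y M z); set (D := det2 V) in *.
replace (2 * psi * - (tr2 V / (2 * D)) + (Q + psi ^ 2) * (1 / D))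
  with ((Q + psi ^ 2 - psi * tr2 V) / D) by (field; exact HD).
split; intros E.
- apply Rmult_eq_compat_r with (r := D) in E.
  unfold Rdiv in E; rewrite Rmult_assoc, Rinv_l, Rmult_1_r, Rmult_0_l in E by exact HD; lra.
- rewrite E; unfold Rdiv; rewrite Rminus_diag; ring.
Qed.

Lemma Xfg_support (f g : C -> C) (z : C) :
  C_derive g z <> RtoC 0 -> ip3 (Xfg f g z) (Nfg g z) = hfun f z.
Proof.
intros Hq; rewrite Xfg_coord, Nfg_coord, ip3_coord, hfun_exp by exact Hq.
apply norm_sq_neq_0 in Hq; assert (HT := Tr_pos (g z)).
revert Hq HT; generalize (exp (Re (f z))) (C_derive f z) (g z) (C_derive g z).
intros h [p1 p2] [x y] [q1 q2]; unfold Xr1, Xr2, Xr3, Nr1, Nr2, Nr3, kr, Tr; simpl.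
intros Hq HT; field; repeat split; lra.
Qed.

(** Pythagoras for [h N + grad h]: in the metric L the gradient of [h = exp (Re f)] has squared
    length h^2 |f'|^2 / L. *)
Lemma Xfg_quad_dist (f g : C -> C) (z : C) :
  C_derive g z <> RtoC 0 ->
  ip3 (Xfg f g z) (Xfg f g z) =
    hfun f z ^ 2 * (Re (C_derive f z) ^ 2 + Im (C_derive f z) ^ 2) / Lr (g z) (C_derive g z)
    + hfun f z ^ 2.
Proof.
intros Hq; rewrite Xfg_coord, ip3_coord, hfun_exp by exact Hq.
apply norm_sq_neq_0 in Hq; assert (HT := Tr_pos (g z)).
revert Hq HT; generalize (exp (Re (f z))) (C_derive f z) (g z) (C_derive g z).
intros h [p1 p2] [x y] [q1 q2]; unfold Xr1, Xr2, Xr3, Nr1, Nr2, Nr3, kr, Lr, Tr; simpl.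
intros Hq HT; field; repeat split; lra.
Qed.

(** [Re xi] cancels between the diagonal entries, so no second derivative of [f] or [g] is left;
    this is where harmonicity of ln h = Re f enters. The trace then matches the quadratic distance
    and the spherical type equation becomes an identity. *)
Lemma tr2_Vfg (f g : C -> C) (z : C) :
  tr2 (Vfg f g z) =
    hfun f z * (Re (C_derive f z) ^ 2 + Im (C_derive f z) ^ 2) / Lr (g z) (C_derive g z)
    + 2 * hfun f z.
Proof. unfold tr2, Vfg, Vr, Rdiv; ring. Qed.

Lemma Xfg_fundamental_forms (U : C -> Prop) (f g : C -> C) (i j : axis) (z : C) :
  open U -> holomorphic_on U f -> holomorphic_on U g ->
  (forall w, U w -> C_derive g w <> RtoC 0) -> U z ->
  let L := Lr (g z) (C_derive g z) in
  let V := Vfg f g z in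
  ip3 (pd3 i (Xfg f g) z) (pd3 j (Xfg f g) z)
    = L * (V i ax1 * V j ax1 + V i ax2 * V j ax2) /\
  ip3 (pd3 i (Xfg f g) z) (pd3 j (Nfg g) z) = L * V i j.
Proof.
intros HU Hf Hg H0 Hz L V.
assert (F := Nfg_frame U g z Hg Hz (H0 z Hz)).
rewrite !(pd3_Xfg U f g _ z HU Hf Hg H0 Hz).
split; [exact (ip3_comb_frame L _ _ (V i) (V j) F) |].
destruct F as [HL [H1 [H2 H3]]].
rewrite ip3_comb_l; destruct j.
- rewrite H1, (ip3_sym (pd3 ax2 _ _)), H3; fold L V; ring.
- rewrite H2, H3; fold L V; ring.
Qed.

Lemma Xfg_unit_normal (U : C -> Prop) (f g : C -> C) (z : C) :
  open U -> holomorphic_on U f -> holomorphic_on U g ->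
  (forall w, U w -> C_derive g w <> RtoC 0) -> U z ->
  unit_normal_at (Xfg f g) (Nfg g) z.
Proof.
intros HU Hf Hg H0 Hz; split; [apply Nfg_unit |]; intros i.
rewrite (pd3_Xfg U f g i z HU Hf Hg H0 Hz), ip3_comb_l.
rewrite !(ip3_sym (pd3 _ _ _)), !(Nfg_orthogonal U) by assumption; ring.
Qed.

Lemma Xfg_gauss_curv (U : C -> Prop) (f g : C -> C) (z : C) :
  open U -> holomorphic_on U f -> holomorphic_on U g ->
  (forall w, U w -> C_derive g w <> RtoC 0) -> U z ->
  (regular_at (Xfg f g) z <-> det2 (Vfg f g z) <> 0) /\
  (regular_at (Xfg f g) z ->
     gauss_curv (Xfg f g) (Nfg g) z = 1 / det2 (Vfg f g z)).
Proof.
intros HU Hf Hg H0 Hz.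
assert (F := Nfg_frame U g z Hg Hz (H0 z Hz)).
assert (HX := fun i => pd3_Xfg U f g i z HU Hf Hg H0 Hz).
split; [exact (regular_frame _ z _ _ _ _ F HX) |].
intros HR.
(* In the parameter z itself N_,1 and N_,2 are the frame, so [J] is the identity matrix. *)
apply (curvatures_frame (Xfg f g) (Nfg g) z _ _ _ (Vfg f g z) delta F HR).
- intros i; rewrite HX; unfold comb, mulmat; destruct i; simpl;
    f_equal; f_equal; ring.
- intros i; destruct (pd3 ax1 (Nfg g) z) as [[x1 x2] x3] eqn:E1,
    (pd3 ax2 (Nfg g) z) as [[y1 y2] y3] eqn:E2; unfold comb; rewrite comb3_coord.
  destruct i; [rewrite E1 | rewrite E2]; simpl;
    apply f_equal2; [apply f_equal2 | | apply f_equal2 |]; ring.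
Qed.

(** * The spherical type equation *)

(** Rows are indexed by the direction of differentiation, the transpose of the usual Jacobian
    matrix, so that the chain rule multiplies coefficient rows from the left as [comb_mulmat]
    does. *)
Definition jac (G : C -> C) (z : C) : mat2 := fun i k =>
  match k with
  | ax1 => pd i (fun w => Re (G w)) z
  | ax2 => pd i (fun w => Im (G w)) z
  end.

Lemma smooth_on_ext (U : C -> Prop) (F G : C -> R) :
  open U -> (forall w, U w -> F w = G w) -> smooth_on U F -> smooth_on U G.
Proof.
intros HU E H; apply smooth_on_Cn; intros n; apply (Cn_ext n U F); auto.
apply smooth_on_Cn, H.
Qed.

Lemma smooth_on_comp (U V : C -> Prop) (F : C -> R) (tau : C -> C) :
  open U -> open V -> (forall z, U z -> V (tau z)) ->
  smooth_on V F -> smoothC_on U tau -> smooth_on U (fun w => F (tau w)).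
Proof.
intros HU HV H HF [H1 H2]; apply smooth_on_Cn; intros n.
apply (Cn_comp n U V F tau); auto; apply smooth_on_Cn; assumption.
Qed.

Lemma smooth3_comp (U V : C -> Prop) (F Y : C -> R3) (tau : C -> C) :
  open U -> open V -> (forall z, U z -> V (tau z)) ->
  smooth3_on V F -> smoothC_on U tau -> (forall w, U w -> Y w = F (tau w)) ->
  smooth3_on U Y.
Proof.
intros HU HV H [[H1 H2] H3] Ht E.
split; [split |].
- apply (smooth_on_ext U (fun w => Re (fst (F (tau w))))); auto.
  + intros w Hw; rewrite E by exact Hw; reflexivity.
  + apply (smooth_on_comp U V (fun w => Re (fst (F w)))); auto.
- apply (smooth_on_ext U (fun w => Im (fst (F (tau w))))); auto.
  + intros w Hw; rewrite E by exact Hw; reflexivity.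
  + apply (smooth_on_comp U V (fun w => Im (fst (F w)))); auto.
- apply (smooth_on_ext U (fun w => snd (F (tau w)))); auto.
  + intros w Hw; rewrite E by exact Hw; reflexivity.
  + apply (smooth_on_comp U V (fun w => snd (F w))); auto.
Qed.

Lemma smoothC_comp (U V : C -> Prop) (F G tau : C -> C) :
  open U -> open V -> (forall z, U z -> V (tau z)) ->
  smoothC_on V F -> smoothC_on U tau -> (forall w, U w -> G w = F (tau w)) ->
  smoothC_on U G.
Proof.
intros HU HV H [H1 H2] Ht E; split.
- apply (smooth_on_ext U (fun w => Re (F (tau w)))); auto.
  + intros w Hw; rewrite E by exact Hw; reflexivity.
  + apply (smooth_on_comp U V (fun w => Re (F w))); auto.
- apply (smooth_on_ext U (fun w => Im (F (tau w)))); auto.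
  + intros w Hw; rewrite E by exact Hw; reflexivity.
  + apply (smooth_on_comp U V (fun w => Im (F w))); auto.
Qed.

Lemma smooth_on_diff (U : C -> Prop) (F : C -> R) (z : C) :
  open U -> smooth_on U F -> U z -> diff_at F z (pd ax1 F z) (pd ax2 F z).
Proof. intros HU HF Hz; apply (Cn_diff 0 U); auto; intros w Hw; apply HF, Hw. Qed.

Lemma pd_comp (O V : C -> Prop) (F : C -> R) (tau : C -> C) (i : axis) (z : C) :
  open O -> open V -> smoothC_on O tau -> smooth_on V F -> O z -> V (tau z) ->
  pd i (fun w => F (tau w)) z
    = jac tau z i ax1 * pd ax1 F (tau z) + jac tau z i ax2 * pd ax2 F (tau z).
Proof.
intros HO HV Ht HF Hz Htz.
destruct (smoothC_diff O tau z HO Ht Hz) as [D1 D2].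
assert (D := diff_at_pd _ _ _ _ (diff_at_comp F tau z _ _ _ _ _ _
               (smooth_on_diff V F (tau z) HV HF Htz) D1 D2)).
destruct D as [E1 E2], i; unfold jac; [rewrite E1 | rewrite E2]; ring.
Qed.

Lemma comb_pd3 (v : axis -> R) (F : C -> R3) (z : C) :
  comb v (pd3 ax1 F z) (pd3 ax2 F z) =
  ((v ax1 * pd ax1 (fun w => Re (fst (F w))) z + v ax2 * pd ax2 (fun w => Re (fst (F w))) z,
    v ax1 * pd ax1 (fun w => Im (fst (F w))) z + v ax2 * pd ax2 (fun w => Im (fst (F w))) z),
    v ax1 * pd ax1 (fun w => snd (F w)) z + v ax2 * pd ax2 (fun w => snd (F w)) z).
Proof. unfold comb, pd3 at 1 2; apply comb3_coord. Qed.

Lemma pd3_comp (O V : C -> Prop) (Y F : C -> R3) (tau : C -> C) (i : axis) (z : C) :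
  open O -> open V -> smoothC_on O tau -> smooth3_on V F -> O z -> V (tau z) ->
  (forall w, O w -> Y w = F (tau w)) ->
  pd3 i Y z = comb (jac tau z i) (pd3 ax1 F (tau z)) (pd3 ax2 F (tau z)).
Proof.
intros HO HV Ht [[H1 H2] H3] Hz Htz E.
rewrite comb_pd3; unfold pd3.
rewrite (pd_ext O (fun w => Re (fst (Y w))) (fun w => Re (fst (F (tau w)))) i z HO Hz)
  by (intros w Hw; rewrite E by exact Hw; reflexivity).
rewrite (pd_ext O (fun w => Im (fst (Y w))) (fun w => Im (fst (F (tau w)))) i z HO Hz)
  by (intros w Hw; rewrite E by exact Hw; reflexivity).
rewrite (pd_ext O (fun w => snd (Y w)) (fun w => snd (F (tau w))) i z HO Hz)
  by (intros w Hw; rewrite E by exact Hw; reflexivity).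
rewrite <- (pd_comp O V (fun w => Re (fst (F w)))) by assumption.
rewrite <- (pd_comp O V (fun w => Im (fst (F w)))) by assumption.
rewrite <- (pd_comp O V (fun w => snd (F w))) by assumption.
reflexivity.
Qed.

Lemma fg_support_pos (S : RiemannSurface) (X N : S -> R3) :
  locally_given_by_fg S X N -> forall p, 0 < ip3 (X p) (N p).
Proof.
intros H p; destruct (H p) as [U [phi [f [g [_ [[z [Hz <-]] [_ [_ Hfg]]]]]]]].
destruct (Hfg z Hz) as [Hq [-> ->]].
rewrite Xfg_support by exact Hq; apply exp_pos.
Qed.

(** The equation is an identity in the parameter z. It reaches the chart through the transition
    [tau2], whose Jacobian serves as [J] in [SS_frame]. *)
Lemma fg_SS_surface (S : RiemannSurface) (X N : S -> R3) :
  immersion S X -> gauss_map S X N ->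
  locally_given_by_fg S X N -> SS_surface S X N.
Proof.
intros HX HN H a z0 Hz0.
destruct (H (par S a z0)) as [U [phi [f [g [[HU [_ Hphi]] [[z1 [Hz1 Ez1]] [Hf [Hg Hfg]]]]]]]].
destruct (Hphi a) as [[HO1 [tau1 [Stau1 Htau1]]] [HO2 [tau2 [Stau2 Htau2]]]].
set (O1 := fun z : C => U z /\ exists w, dom S a w /\ par S a w = phi z) in *.
set (O2 := fun z : C => dom S a z /\ exists w, U w /\ phi w = par S a z) in *.
assert (Hz0' : O2 z0) by (split; [exact Hz0 | exists z1; split; assumption]).
destruct (Htau2 z0 Hz0') as [Hw0 Ew0].
set (w0 := tau2 z0) in *.
assert (Hw0' : O1 w0) by (split; [exact Hw0 | exists z0; split; [exact Hz0 | symmetry; exact Ew0]]).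
destruct (HX a) as [SX RX]; destruct (HN a) as [SN NX].
assert (Hdom := dom_open S a).
assert (Hq := fun w Hw => proj1 (Hfg w Hw)).
(* Smoothness of [Xfg f g] and [Nfg g], required by the chain rule, is inherited from [X] and [N]
   through the opposite transition [tau1]. *)
assert (SXfg : smooth3_on O1 (Xfg f g)).
{ apply (smooth3_comp O1 (dom S a) (fun w => X (par S a w)) _ tau1); auto.
  - intros z Hz; apply Htau1, Hz.
  - intros z Hz; destruct (Htau1 z Hz) as [_ ->].
    symmetry; apply (Hfg z (proj1 Hz)). }
assert (SNfg : smooth3_on O1 (Nfg g)).
{ apply (smooth3_comp O1 (dom S a) (fun w => N (par S a w)) _ tau1); auto.
  - intros z Hz; apply Htau1, Hz.
  - intros z Hz; destruct (Htau1 z Hz) as [_ ->].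
    symmetry; apply (Hfg z (proj1 Hz)). }
assert (EY : forall w, O2 w -> X (par S a w) = Xfg f g (tau2 w)).
{ intros w Hw; destruct (Htau2 w Hw) as [Hu <-]; apply (Hfg _ Hu). }
assert (EM : forall w, O2 w -> N (par S a w) = Nfg g (tau2 w)).
{ intros w Hw; destruct (Htau2 w Hw) as [Hu <-]; apply (Hfg _ Hu). }
set (Y := fun w => X (par S a w)) in *; set (M := fun w => N (par S a w)) in *.
assert (F := Nfg_frame U g w0 Hg Hw0 (Hq w0 Hw0)).
apply (SS_frame Y M z0 _ _ _ (Vfg f g w0) (jac tau2 z0) F).
- apply RX, Hz0.
- apply (NX z0 Hz0).
- intros i; rewrite (pd3_comp O2 O1 Y (Xfg f g) tau2 i z0) by assumption.
  fold w0; rewrite <- comb_mulmat.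
  rewrite !(pd3_Xfg U f g _ w0) by assumption; reflexivity.
- intros i; apply (pd3_comp O2 O1 M (Nfg g) tau2 i z0); assumption.
- unfold support, quad_dist, Y, M; rewrite EY, EM by exact Hz0'; fold w0.
  rewrite Xfg_support, Xfg_quad_dist, tr2_Vfg by (apply Hq, Hw0).
  assert (HL := proj1 F); field; lra.
Qed.

(** * The sphere in its stereographic coordinate, g(z) = z *)

Definition idC (z : C) : C := z.

Lemma is_derive_idC (z : C) : @is_derive C_AbsRing C_NormedModule idC z (RtoC 1).
Proof.
apply is_derive_C_Cauchy_Riemann; rewrite Ropp_0; split; [apply diff_at_Re | apply diff_at_Im].
Qed.

Lemma C_derive_idC (z : C) : C_derive idC z = RtoC 1.
Proof. apply is_C_derive_unique, is_derive_idC. Qed.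

Lemma holomorphic_idC (U : C -> Prop) : holomorphic_on U idC.
Proof. intros z _; exists (RtoC 1); apply is_derive_idC. Qed.

Lemma RtoC_1_neq_0 : RtoC 1 <> RtoC 0.
Proof. intros E; injection E; lra. Qed.

Lemma open_true : open (fun _ : C => True).
Proof. intros z _; exists (mkposreal 1 Rlt_0_1); auto. Qed.

Lemma smooth_Tr_inv : smooth_on (fun _ => True) (fun z => / Tr z).
Proof.
apply smooth_on_Cn; intros n; apply Cn_inv; [apply open_true | |].
- intros z _; assert (H := Tr_pos z); lra.
- apply (Cn_ext n _ (fun z => 1 + (Re z * Re z + Im z * Im z))).
  + apply open_true.
  + intros w _; unfold Tr; ring.
  + apply Cn_plus; [apply open_true | apply Cn_const, open_true |].
    apply Cn_plus; [apply open_true | |]; apply Cn_mult;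
      auto using open_true, Cn_Re, Cn_Im.
Qed.

Lemma smooth3_N : smooth3_on (fun _ => True) (Nfg idC).
Proof.
assert (T := open_true).
assert (HT := proj1 (smooth_on_Cn _ _) smooth_Tr_inv).
split; [split |]; apply smooth_on_Cn; intros n.
- apply (Cn_ext n _ (fun z => 2 * Re z * / Tr z)); auto.
  + intros w _; rewrite Nfg_coord; reflexivity.
  + repeat apply Cn_mult; auto using Cn_const, Cn_Re.
- apply (Cn_ext n _ (fun z => 2 * Im z * / Tr z)); auto.
  + intros w _; rewrite Nfg_coord; reflexivity.
  + repeat apply Cn_mult; auto using Cn_const, Cn_Im.
- apply (Cn_ext n _ (fun z => 2 * / Tr z + -1)); auto.
  + intros w _; rewrite Nfg_coord; simpl; unfold idC, Nr3; field.
    assert (H := Tr_pos w); lra.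
  + apply Cn_plus; auto using Cn_const; apply Cn_mult; auto using Cn_const.
Qed.

Lemma smooth3_subset (U V : C -> Prop) (F : C -> R3) :
  (forall z, U z -> V z) -> smooth3_on V F -> smooth3_on U F.
Proof.
intros H [[H1 H2] H3]; split; [split |]; intros z Hz; auto.
Qed.

Lemma smooth_pd (U : C -> Prop) (F : C -> R) (i : axis) :
  smooth_on U F -> smooth_on U (pd i F).
Proof.
rewrite !smooth_on_Cn; intros H n; apply Cn_pd, H.
Qed.

Lemma smooth3_pd3 (U : C -> Prop) (F : C -> R3) (i : axis) :
  smooth3_on U F -> smooth3_on U (pd3 i F).
Proof.
intros [[H1 H2] H3]; split; [split |]; simpl.
- exact (smooth_pd U (fun w => Re (fst (F w))) i H1).
- exact (smooth_pd U (fun w => Im (fst (F w))) i H2).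
- exact (smooth_pd U (fun w => snd (F w)) i H3).
Qed.

Lemma ip3_E (p q : R3) :
  ip3 p q = Re (fst p) * Re (fst q) + Im (fst p) * Im (fst q) + snd p * snd q.
Proof. destruct p as [[p1 p2] p3], q as [[q1 q2] q3]; apply ip3_coord. Qed.

Lemma smooth_ip3 (U : C -> Prop) (Y M : C -> R3) :
  open U -> smooth3_on U Y -> smooth3_on U M -> smooth_on U (fun w => ip3 (Y w) (M w)).
Proof.
intros HU [[Y1 Y2] Y3] [[M1 M2] M3].
apply (smooth_on_ext U (fun w => Re (fst (Y w)) * Re (fst (M w))
   + Im (fst (Y w)) * Im (fst (M w)) + snd (Y w) * snd (M w))); auto.
- intros w _; symmetry; apply ip3_E.
- apply smooth_on_Cn; intros n.
  apply Cn_plus; [exact HU | apply Cn_plus; [exact HU | |] |]; apply Cn_mult; auto;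
    apply smooth_on_Cn; assumption.
Qed.

Lemma pd_ip3 (U : C -> Prop) (Y M : C -> R3) (i : axis) (z : C) :
  open U -> smooth3_on U Y -> smooth3_on U M -> U z ->
  pd i (fun w => ip3 (Y w) (M w)) z = ip3 (pd3 i Y z) (M z) + ip3 (Y z) (pd3 i M z).
Proof.
intros HU [[Y1 Y2] Y3] [[M1 M2] M3] Hz.
rewrite (pd_ext U _ (fun w => Re (fst (Y w)) * Re (fst (M w))
   + Im (fst (Y w)) * Im (fst (M w)) + snd (Y w) * snd (M w)) i z HU Hz)
  by (intros; apply ip3_E).
assert (D := diff_at_pd _ _ _ _ (diff_at_plus _ _ _ _ _ _ _ (diff_at_plus _ _ _ _ _ _ _
  (diff_at_mult _ _ _ _ _ _ _ (smooth_on_diff U _ z HU Y1 Hz) (smooth_on_diff U _ z HU M1 Hz))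
  (diff_at_mult _ _ _ _ _ _ _ (smooth_on_diff U _ z HU Y2 Hz) (smooth_on_diff U _ z HU M2 Hz)))
  (diff_at_mult _ _ _ _ _ _ _ (smooth_on_diff U _ z HU Y3 Hz) (smooth_on_diff U _ z HU M3 Hz)))).
rewrite !ip3_E; unfold pd3; simpl fst; simpl snd.
destruct D as [D1 D2], i; [rewrite D1 | rewrite D2]; unfold Re, Im; simpl; ring.
Qed.

Definition ddNr1 (g d : C) : R :=
  - (8 * Re d * (Re g * Re d + Im g * Im d) + 4 * Re g * (Re d ^ 2 + Im d ^ 2)) / Tr g ^ 2
  + 16 * Re g * (Re g * Re d + Im g * Im d) ^ 2 / Tr g ^ 3.
Definition ddNr2 (g d : C) : R :=
  - (8 * Im d * (Re g * Re d + Im g * Im d) + 4 * Im g * (Re d ^ 2 + Im d ^ 2)) / Tr g ^ 2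
  + 16 * Im g * (Re g * Re d + Im g * Im d) ^ 2 / Tr g ^ 3.
Definition ddNr3 (g d : C) : R :=
  - 4 * (Re d ^ 2 + Im d ^ 2) / Tr g ^ 2
  + 16 * (Re g * Re d + Im g * Im d) ^ 2 / Tr g ^ 3.

Lemma is_derive_dNr (gr gi : R -> R) (t : R) (d : C) :
  is_derive gr t (Re d) -> is_derive gi t (Im d) ->
  is_derive (fun s => dNr1 (gr s, gi s) d) t (ddNr1 (gr t, gi t) d) /\
  is_derive (fun s => dNr2 (gr s, gi s) d) t (ddNr2 (gr t, gi t) d) /\
  is_derive (fun s => dNr3 (gr s, gi s) d) t (ddNr3 (gr t, gi t) d).
Proof.
intros H1 H2; assert (HT := Tr_pos (gr t, gi t)).
unfold dNr1, dNr2, dNr3, ddNr1, ddNr2, ddNr3, Tr in *; simpl in *.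
assert (K1 := is_derive_unique _ _ _ H1); assert (K2 := is_derive_unique _ _ _ H2).
split; [| split]; auto_derive; simpl;
  try (repeat split; try (eexists; eassumption);
       try (apply Rgt_not_eq; repeat apply Rmult_lt_0_compat; lra); lra);
  change (Derive (fun x => gr x) t) with (Derive gr t);
  change (Derive (fun x => gi x) t) with (Derive gi t);
  rewrite ?K1, ?K2; field; lra.
Qed.

Lemma pd3_N (i : axis) (z : C) :
  pd3 i (Nfg idC) z = ((dNr1 z (dir i), dNr2 z (dir i)), dNr3 z (dir i)).
Proof.
rewrite (pd3_Nfg (fun _ => True) idC i z (holomorphic_idC _) I), C_derive_idC.
replace (dir i * RtoC 1)%C with (dir i) by ring; reflexivity.
Qed.

Lemma pd3_pd3_N (i : axis) (z : C) :
  pd3 i (pd3 i (Nfg idC)) z = ((ddNr1 z (dir i), ddNr2 z (dir i)), ddNr3 z (dir i)).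
Proof.
destruct (holomorphic_line (fun _ => True) idC i z (holomorphic_idC _) I) as [G1 G2].
rewrite C_derive_idC in G1, G2.
replace (dir i * RtoC 1)%C with (dir i) in G1, G2 by ring.
destruct (is_derive_dNr _ _ _ _ G1 G2) as [K1 [K2 K3]].
rewrite !line_coord, !C_eta in *; unfold idC in *.
transitivity ((pd i (fun w => Re (fst (pd3 i (Nfg idC) w))) z,
  pd i (fun w => Im (fst (pd3 i (Nfg idC) w))) z),
  pd i (fun w => snd (pd3 i (Nfg idC) w)) z); [reflexivity |].
rewrite !pd_line.
apply f_equal2; [apply f_equal2 |]; apply is_derive_unique;
  (eapply is_derive_ext; [| eassumption]); intros t; cbv beta; rewrite C_eta.
- rewrite (pd3_N i (line i z t)); reflexivity.
- rewrite (pd3_N i (line i z t)); reflexivity.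
- rewrite (pd3_N i (line i z t)); reflexivity.
Qed.

Definition Lid (z : C) : R := 4 / Tr z ^ 2.

Lemma L1_pos (z : C) : 0 < Lid z.
Proof.
assert (H := Tr_pos z); apply Rdiv_lt_0_compat; [lra | apply pow_lt, H].
Qed.

Lemma N_frame (z : C) :
  conformal_frame (Lid z) (pd3 ax1 (Nfg idC) z) (pd3 ax2 (Nfg idC) z).
Proof.
assert (F := Nfg_frame (fun _ => True) idC z (holomorphic_idC _) I).
rewrite C_derive_idC in F; specialize (F RtoC_1_neq_0).
replace (Lr (idC z) (RtoC 1)) with (Lid z) in F; [exact F |].
unfold Lr, Lid, idC; simpl; f_equal; ring.
Qed.

(* The unit sphere is totally umbilic and [N] is conformal, so [N] is harmonic
   as a map to the sphere. *)
Lemma laplacian_N (v : R3) (z : C) :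
  ip3 v (pd3 ax1 (pd3 ax1 (Nfg idC)) z) + ip3 v (pd3 ax2 (pd3 ax2 (Nfg idC)) z)
  = - 2 * Lid z * ip3 v (Nfg idC z).
Proof.
rewrite !pd3_pd3_N, Nfg_coord; destruct v as [[v1 v2] v3]; rewrite !ip3_coord.
assert (HT := Tr_pos z); destruct z as [x y].
unfold ddNr1, ddNr2, ddNr3, Nr1, Nr2, Nr3, Lid, idC, Tr in *; simpl in *.
field; lra.
Qed.

(** N, N_,1, N_,2 form an orthogonal basis with squared lengths 1, [Lid] and [Lid], which explains
    the denominators. *)
Lemma N_expansion (v : R3) (z : C) :
  v = plus3 (scal3 (ip3 v (Nfg idC z)) (Nfg idC z))
        (comb (fun k => ip3 v (pd3 k (Nfg idC) z) / Lid z)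
           (pd3 ax1 (Nfg idC) z) (pd3 ax2 (Nfg idC) z)).
Proof.
unfold comb; rewrite !pd3_N, Nfg_coord, comb3_coord.
destruct v as [[v1 v2] v3]; rewrite !ip3_coord.
assert (HT := Tr_pos z); destruct z as [x y].
unfold plus3, scal3, Cplus, Cmult, RtoC, Nr1, Nr2, Nr3, dNr1, dNr2, dNr3, Lid, idC, Tr, dir in *;
  simpl in *.
apply f_equal2; [apply f_equal2 |]; field; lra.
Qed.

Lemma tangent_expansion (v : R3) (z : C) :
  ip3 v (Nfg idC z) = 0 ->
  v = comb (fun k => ip3 v (pd3 k (Nfg idC) z) / Lid z)
        (pd3 ax1 (Nfg idC) z) (pd3 ax2 (Nfg idC) z).
Proof.
intros H; rewrite (N_expansion v z) at 1; rewrite H.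
generalize (comb (fun k => ip3 v (pd3 k (Nfg idC) z) / Lid z)
        (pd3 ax1 (Nfg idC) z) (pd3 ax2 (Nfg idC) z)).
intros [[x1 x2] x3]; destruct (Nfg idC z) as [[y1 y2] y3].
unfold plus3, scal3, Cplus, Cmult, RtoC; simpl.
apply f_equal2; [apply f_equal2 |]; ring.
Qed.

(** The form -(h_,2 / h) dx + (h_,1 / h) dy has equal cross derivatives exactly when h times its
    Laplacian is |grad h|^2. Its potential is the harmonic conjugate of [ln h], that is, the
    imaginary part of [f]. *)
Lemma harmonic_log_real_part (w0 : C) (r : R) (h : C -> R) :
  smooth_on (Cbox w0 r) h -> (forall w, Cbox w0 r w -> 0 < h w) ->
  (forall w, Cbox w0 r w ->
     h w * (pd ax1 (pd ax1 h) w + pd ax2 (pd ax2 h) w) = pd ax1 h w ^ 2 + pd ax2 h w ^ 2) ->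
  exists f : C -> C, forall w, Cbox w0 r w ->
    Re (f w) = ln (h w) /\
    @is_derive C_AbsRing C_NormedModule f w (pd ax1 h w / h w, - (pd ax2 h w / h w)).
Proof.
intros Sh Hh Hlap.
assert (HU := open_Cbox w0 r).
set (U := Cbox w0 r) in *.
assert (Dh := fun w Hw => smooth_on_diff U h w HU Sh Hw).
assert (D1 := fun w Hw => smooth_on_diff U _ w HU (smooth_pd U h ax1 Sh) Hw).
assert (D2 := fun w Hw => smooth_on_diff U _ w HU (smooth_pd U h ax2 Sh) Hw).
set (h1 := pd ax1 h) in *; set (h2 := pd ax2 h) in *.
assert (Dinv := fun w Hw => diff_at_inv h w _ _ (Dh w Hw) (Rgt_not_eq _ _ (Hh w Hw))).
assert (DQ := fun w Hw => diff_at_mult h1 (fun w => / h w) w _ _ _ _ (D1 w Hw) (Dinv w Hw)).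
assert (DP := fun w Hw => diff_at_scal _ w (-1) _ _
  (diff_at_mult h2 (fun w => / h w) w _ _ _ _ (D2 w Hw) (Dinv w Hw))).
destruct (potential_on_box (fun x y => -1 * (h2 (x, y) * / h (x, y)))
  (fun x y => h1 (x, y) * / h (x, y)) (Re w0) (Im w0) r) as [Phi HPhi].
{ intros x y Hxy; assert (Hw : U (x, y)) by exact Hxy.
  assert (K1 := DP _ Hw); assert (K2 := DQ _ Hw); specialize (Hlap _ Hw); specialize (Hh _ Hw).
  unfold diff_at in K1, K2; simpl Re in K1, K2; simpl Im in K1, K2.
  eexists; eexists; eexists; split; [exact K1 |].
  match type of K2 with differentiable_pt_lim _ _ _ ?s _ =>
    match goal with |- differentiable_pt_lim _ _ _ ?s' _ => replace s' with s end end;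
    [exact K2 |].
  apply Rmult_eq_reg_r with (h (x, y) ^ 2); [| apply pow_nonzero; lra].
  field_simplify; [| lra | lra].
  fold h1 h2 in Hlap |- *; lra. }
exists (fun w => (ln (h w), Phi (Re w) (Im w))); intros w Hw; split; [reflexivity |].
apply is_derive_C_Cauchy_Riemann; split.
- assert (K := diff_at_comp1 ln h w _ _ _ (is_derive_ln (h w) (Hh w Hw)) (Dh w Hw)).
  replace (h1 w / h w) with (/ h w * h1 w) by apply Rmult_comm.
  replace (- - (h2 w / h w)) with (/ h w * h2 w) by (rewrite Ropp_involutive; apply Rmult_comm).
  exact K.
- assert (K := HPhi (Re w) (Im w) Hw); rewrite C_eta in K.
  replace (- (h2 w / h w)) with (-1 * (h2 w * / h w)) by (unfold Rdiv; ring).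
  exact K.
Qed.

(** With g(z) = z and f' = (h_,1 - i h_,2) / h, which is forced by Re f = ln h, the closed formula
    for X is the reconstruction [h N + grad h]. *)
Lemma Xfg_idC (h h1 h2 : R) (w : C) :
  0 < h ->
  plus3 (scal3 h (Nfg idC w))
    (comb (fun k => match k with ax1 => h1 | ax2 => h2 end / Lid w)
       (pd3 ax1 (Nfg idC) w) (pd3 ax2 (Nfg idC) w))
  = ((Xr1 h (h1 / h, - (h2 / h)) w (RtoC 1), Xr2 h (h1 / h, - (h2 / h)) w (RtoC 1)),
      Xr3 h (h1 / h, - (h2 / h)) w (RtoC 1)).
Proof.
intros Hh; unfold comb; rewrite !pd3_N, Nfg_coord, comb3_coord.
assert (HT := Tr_pos w); destruct w as [x y].
unfold plus3, scal3, Cplus, Cmult, RtoC, Xr1, Xr2, Xr3, kr,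
  Nr1, Nr2, Nr3, dNr1, dNr2, dNr3, Lid, idC, Tr, dir in *; simpl in *.
apply f_equal2; [apply f_equal2 |]; field; lra.
Qed.

(* [Z] is recovered from its support function [h] as [h N + grad h], and the
   spherical type equation says that [ln h] is harmonic. *)
Lemma support_representation (w0 : C) (r : R) (Z : C -> R3) :
  let N := Nfg idC in
  smooth3_on (Cbox w0 r) Z ->
  (forall w i, Cbox w0 r w -> ip3 (pd3 i Z w) (N w) = 0) ->
  (forall w, Cbox w0 r w -> 0 < ip3 (Z w) (N w)) ->
  (forall w, Cbox w0 r w ->
     quad_dist Z w + support Z N w ^ 2 =
     support Z N w * tr2 (fun i k => ip3 (pd3 i Z w) (pd3 k N w) / Lid w)) ->
  exists f, holomorphic_on (Cbox w0 r) f /\ forall w, Cbox w0 r w -> Z w = Xfg f idC w.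
Proof.
intros N SZ Hort Hpos HSS.
assert (HU := open_Cbox w0 r).
set (U := Cbox w0 r) in *.
assert (SN : smooth3_on U N) by (apply (smooth3_subset U (fun _ => True)); [auto | apply smooth3_N]).
set (h := fun w => ip3 (Z w) (N w)) in *.
assert (Sh : smooth_on U h) by (apply smooth_ip3; assumption).
assert (Hpd : forall i w, U w -> pd i h w = ip3 (Z w) (pd3 i N w)).
{ intros i w Hw; unfold h; rewrite (pd_ip3 U Z N i w HU SZ SN Hw), Hort by exact Hw; ring. }
assert (Hpp : forall i w, U w -> pd i (pd i h) w
   = ip3 (pd3 i Z w) (pd3 i N w) + ip3 (Z w) (pd3 i (pd3 i N) w)).
{ intros i w Hw; rewrite (pd_ext U _ (fun w => ip3 (Z w) (pd3 i N w)) i w HU Hw) by apply Hpd.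
  apply (pd_ip3 U); auto; apply smooth3_pd3, SN. }
assert (HZ : forall w, U w -> Z w = plus3 (scal3 (h w) (N w))
   (comb (fun k => match k with ax1 => pd ax1 h w | ax2 => pd ax2 h w end / Lid w)
       (pd3 ax1 N w) (pd3 ax2 N w))).
{ intros w Hw; rewrite (N_expansion (Z w) w) at 1; fold N.
  unfold comb; rewrite !Hpd by exact Hw; reflexivity. }
assert (HQ : forall w, U w ->
   quad_dist Z w = h w ^ 2 + (pd ax1 h w ^ 2 + pd ax2 h w ^ 2) / Lid w).
{ intros w Hw; unfold quad_dist.
  rewrite (HZ w Hw) at 1.
  assert (E : forall v : R3, ip3 (plus3 (scal3 (h w) (N w))
     (comb (fun k => match k with ax1 => pd ax1 h w | ax2 => pd ax2 h w end / Lid w)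
       (pd3 ax1 N w) (pd3 ax2 N w))) v
     = h w * ip3 v (N w) + (pd ax1 h w / Lid w * ip3 v (pd3 ax1 N w)
                            + pd ax2 h w / Lid w * ip3 v (pd3 ax2 N w))).
  { intros v; rewrite !(ip3_sym v), <- ip3_comb_l.
    generalize (pd3 ax1 N w) (pd3 ax2 N w); intros [[x1 x2] x3] [[y1 y2] y3].
    unfold comb; rewrite comb3_coord; destruct (N w) as [[n1 n2] n3], v as [[v1 v2] v3].
    unfold plus3, scal3, ip3, ipC; simpl; ring. }
  rewrite E, <- !Hpd by exact Hw; change (ip3 (Z w) (N w)) with (h w).
  unfold Rdiv; ring. }
destruct (harmonic_log_real_part w0 r h Sh Hpos) as [f Hf].
{ intros w Hw; specialize (HSS w Hw); rewrite HQ in HSS by exact Hw.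
  unfold support, tr2 in HSS; change (ip3 (Z w) (N w)) with (h w) in HSS.
  assert (P1 := Hpp ax1 w Hw); assert (P2 := Hpp ax2 w Hw).
  assert (PL := laplacian_N (Z w) w); fold N in PL; change (ip3 (Z w) (N w)) with (h w) in PL.
  assert (HL := L1_pos w).
  set (a := ip3 (pd3 ax1 Z w) (pd3 ax1 N w)) in *; set (b := ip3 (pd3 ax2 Z w) (pd3 ax2 N w)) in *.
  (* Summing [P1] and [P2] gives the Laplacian of h as [a + b] plus the pairing of Z with the
     Laplacian of N, which is [- 2 * Lid w * h w]. The term [2 * h ^ 2] on the other side then
     cancels the zeroth order part. *)
  assert (Eab : a + b = pd ax1 (pd ax1 h) w + pd ax2 (pd ax2 h) w + 2 * Lid w * h w) by lra.
  apply Rmult_eq_compat_r with (r := Lid w) in HSS.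
  replace ((h w ^ 2 + (pd ax1 h w ^ 2 + pd ax2 h w ^ 2) / Lid w + h w ^ 2) * Lid w)
    with (2 * h w ^ 2 * Lid w + (pd ax1 h w ^ 2 + pd ax2 h w ^ 2)) in HSS by (field; lra).
  replace (h w * (a / Lid w + b / Lid w) * Lid w) with (h w * (a + b)) in HSS by (field; lra).
  rewrite Eab in HSS; lra. }
exists f; split.
- intros w Hw; eexists; apply (Hf w Hw).
- intros w Hw; destruct (Hf w Hw) as [Ef Df].
  rewrite Xfg_coord by (rewrite C_derive_idC; apply RtoC_1_neq_0).
  rewrite Ef, exp_ln, C_derive_idC, (is_C_derive_unique _ _ _ Df) by (apply Hpos, Hw).
  rewrite (HZ w Hw); apply Xfg_idC, Hpos, Hw.
Qed.

(** * The Gauss map as a local coordinate *)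

Definition stereo (m : R3) : C := (Re (fst m) / (1 + snd m), Im (fst m) / (1 + snd m)).

Lemma south_pole (m : R3) : ip3 m m = 1 -> m <> (RtoC 0, -1) -> 1 + snd m <> 0.
Proof.
destruct m as [[x y] z]; rewrite ip3_coord; simpl; intros E Hm Hz.
apply Hm; assert (z = -1) by lra; subst z.
assert (x = 0) by nra; assert (y = 0) by nra; subst; reflexivity.
Qed.

(** On the unit sphere T = 1 + |stereo m|^2 equals 2 / (1 + m3), so (2 - T) / T returns the height
    m3 and 2 / T the factor that [stereo] divided out. *)
Lemma stereo_inverse (m : R3) :
  ip3 m m = 1 -> m <> (RtoC 0, -1) -> m = Nfg idC (stereo m).
Proof.
intros E Hm; assert (Hz := south_pole m E Hm).
rewrite Nfg_coord; unfold stereo, idC.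
destruct m as [[x y] z]; rewrite ip3_coord in E; simpl in *.
assert (ET : Tr (x / (1 + z), y / (1 + z)) = 2 / (1 + z)).
{ unfold Tr; simpl; apply Rmult_eq_reg_r with ((1 + z) ^ 2); [| apply pow_nonzero, Hz].
  field_simplify; [| exact Hz | exact Hz]; lra. }
unfold Nr1, Nr2, Nr3; rewrite ET; simpl.
apply f_equal2; [apply f_equal2 |]; field; lra.
Qed.

Lemma smooth_stereo (U : C -> Prop) (M : C -> R3) :
  open U -> smooth3_on U M -> (forall z, U z -> 1 + snd (M z) <> 0) ->
  smoothC_on U (fun z => stereo (M z)).
Proof.
intros HU [[M1 M2] M3] H0.
assert (I : forall n, Cn n U (fun z => / (1 + snd (M z)))).
{ intros n; apply Cn_inv; auto; apply Cn_plus; auto using Cn_const.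
  apply smooth_on_Cn, M3. }
split; apply smooth_on_Cn; intros n.
- apply (Cn_mult n U (fun z => Re (fst (M z)))); auto; apply smooth_on_Cn, M1.
- apply (Cn_mult n U (fun z => Im (fst (M z)))); auto; apply smooth_on_Cn, M2.
Qed.

(** In the frame of the sphere the Weingarten matrix times the coefficient matrix [A] of the
    derivatives of [Y] is the Jacobian matrix of [stereo] after [M]. The first factor has
    determinant K and the second is invertible by regularity. *)
Lemma gauss_map_local_diffeo (U : C -> Prop) (Y M : C -> R3) (z : C) :
  open U -> smooth3_on U M -> (forall w, U w -> ip3 (M w) (M w) = 1) ->
  (forall w, U w -> M w <> (RtoC 0, -1)) -> U z ->
  regular_at Y z -> unit_normal_at Y M z -> gauss_curv Y M z <> 0 ->
  jacobian (fun w => stereo (M w)) z <> 0.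
Proof.
intros HU SM H1 H0 Hz HR [_ Hn] HK.
set (G := fun w => stereo (M w)).
assert (SG : smoothC_on U G).
{ apply smooth_stereo; auto; intros w Hw; apply south_pole; auto. }
assert (EM : forall w, U w -> M w = Nfg idC (G w)) by (intros w Hw; apply stereo_inverse; auto).
assert (HM : forall i, pd3 i M z = comb (jac G z i) (pd3 ax1 (Nfg idC) (G z)) (pd3 ax2 (Nfg idC) (G z))).
{ intros i; apply (pd3_comp U (fun _ => True)); auto using open_true, smooth3_N. }
set (A := fun i k => ip3 (pd3 i Y z) (pd3 k (Nfg idC) (G z)) / Lid (G z)).
assert (HY : forall i, pd3 i Y z = comb (A i) (pd3 ax1 (Nfg idC) (G z)) (pd3 ax2 (Nfg idC) (G z))).
{ intros i; apply tangent_expansion; rewrite <- EM by exact Hz; apply Hn. }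
assert (F := N_frame (G z)).
assert (HA := proj1 (regular_frame Y z _ _ _ A F HY) HR).
assert (W := weingarten_frame Y M z _ _ _ A (jac G z) F HR HY HM).
unfold gauss_curv in HK; set (w := weingarten Y M z) in *.
intros E; apply HK; apply Rmult_eq_reg_r with (det2 A); [| exact HA].
rewrite Rmult_0_l, <- E.
transitivity (det2 (mulmat w A)); [unfold det2, mulmat; ring |].
unfold det2; rewrite !W; unfold jac, jacobian; ring.
Qed.

Lemma open_preimage (W O : C -> Prop) (tau : C -> C) :
  open W -> open O -> smoothC_on O tau -> open (fun z => O z /\ W (tau z)).
Proof.
intros HW HO St z [Oz Wz].
destruct (open_Cbox_subset W _ HW Wz) as [r Hr'].
destruct (smoothC_diff O tau z HO St Oz) as [D1 D2].
destruct (cont_at_Cbox _ z (r / 2) (diff_at_cont _ _ _ _ D1)) as [r1 R1];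
  [apply is_pos_div_2 |].
destruct (cont_at_Cbox _ z (r / 2) (diff_at_cont _ _ _ _ D2)) as [r2 R2];
  [apply is_pos_div_2 |].
destruct (open_Cbox_subset O z HO Oz) as [r3 R3].
assert (P := cond_pos r).
exists (mkposreal _ (Rmin_pos _ _ (cond_pos r3) (Rmin_pos _ _ (cond_pos r1) (cond_pos r2)))).
assert (K1 := Rmin_l r3 (Rmin r1 r2)); assert (K2 := Rmin_r r3 (Rmin r1 r2)).
assert (K3 := Rmin_l r1 r2); assert (K4 := Rmin_r r1 r2).
intros w [W1 W2].
change (Rabs (Re w - Re z) < Rmin r3 (Rmin r1 r2)) in W1.
change (Rabs (Im w - Im z) < Rmin r3 (Rmin r1 r2)) in W2.
split; [apply R3; split; lra |].
apply Hr'; split.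
- eapply Rle_lt_trans; [apply (R1 w); split; lra | lra].
- eapply Rle_lt_trans; [apply (R2 w); split; lra | lra].
Qed.

(** Compatibility with an arbitrary chart [b] is reduced to the transitions between [a] and [b],
    which are holomorphic and hence smooth, composed with [gamma] in one direction and with [G] in
    the other. *)
Lemma local_parametrization_comp (S : RiemannSurface) (a : chart S)
    (V0 U : C -> Prop) (G gamma : C -> C) :
  open V0 -> open U -> (forall z, V0 z -> dom S a z) ->
  smoothC_on V0 G -> smoothC_on U gamma ->
  (forall z, V0 z -> U (G z) -> gamma (G z) = z) ->
  (forall w, U w -> V0 (gamma w) /\ G (gamma w) = w) ->
  local_parametrization S U (fun w => par S a (gamma w)).
Proof.
intros HV HU Hdom SG Sg Hl Hr.
assert (HVG := open_preimage U V0 G HU HV SG).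
split; [exact HU |]; split.
- intros z w Hz Hw E.
  destruct (Hr z Hz) as [Z1 <-]; destruct (Hr w Hw) as [W1 <-]; f_equal.
  apply (par_inj S a); auto.
- intros b.
  destruct (par_transition S a b) as [Oab [tab [Htab Ttab]]].
  destruct (par_transition S b a) as [Oba [tba [Htba Ttba]]].
  set (Dab := fun z : C => dom S a z /\ exists w, dom S b w /\ par S b w = par S a z) in *.
  set (Dba := fun z : C => dom S b z /\ exists w, dom S a w /\ par S a w = par S b z) in *.
  assert (Stab := holomorphic_smooth Dab tab Oab Htab).
  assert (Stba := holomorphic_smooth Dba tba Oba Htba).
  split; split.
  + apply (open_ext (fun z => U z /\ Dab (gamma z))); [| apply open_preimage; assumption].
    intros z; split; [intros [Hz [_ Hw]] | intros [Hz Hw]]; split; auto.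
    split; [apply Hdom, Hr, Hz | exact Hw].
  + exists (fun z => tab (gamma z)); split.
    * apply (smoothC_comp _ Dab tab _ gamma); auto.
      -- apply (open_ext (fun z => U z /\ Dab (gamma z))); [| apply open_preimage; assumption].
         intros z; split; [intros [Hz [_ Hw]] | intros [Hz Hw]]; split; auto.
         split; [apply Hdom, Hr, Hz | exact Hw].
      -- intros z [Hz Hw]; split; [apply Hdom, Hr, Hz | exact Hw].
      -- destruct Sg as [S1 S2]; split; intros z [Hz _]; auto.
    * intros z [Hz Hw]; apply Ttab; split; [apply Hdom, Hr, Hz | exact Hw].
  (* The existential domain is rewritten as an iterated preimage, which makes its openness visible.
     Injectivity of the chart [a] identifies [tba z] with [gamma w] for any witness [w]. *)
  + apply (open_ext (fun z => Dba z /\ (V0 (tba z) /\ U (G (tba z))))).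
    * intros z; split.
      -- intros [Hz [HV' HU']]; destruct (Ttba z Hz) as [T1 T2]; split; [apply Hz |].
         exists (G (tba z)); rewrite Hl by assumption; split; assumption.
      -- intros [Hz [w [Hw Ew]]].
         assert (Dz : Dba z) by (split; [exact Hz | exists (gamma w); split; [apply Hdom, Hr, Hw | exact Ew]]).
         destruct (Ttba z Dz) as [T1 T2].
         assert (Et : tba z = gamma w)
           by (apply (par_inj S a); [exact T1 | apply Hdom, Hr, Hw | rewrite T2; symmetry; exact Ew]).
         split; [exact Dz |]; rewrite Et; destruct (Hr w Hw) as [R1 R2].
         rewrite R2; split; assumption.
    * apply (open_preimage (fun z => V0 z /\ U (G z)) Dba tba); assumption.
  + exists (fun z => G (tba z)).
    assert (Key : forall z, dom S b z /\ (exists w, U w /\ par S a (gamma w) = par S b z) ->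
      Dba z /\ V0 (tba z) /\ U (G (tba z))).
    { intros z [Hz [w [Hw Ew]]].
      assert (Dz : Dba z) by (split; [exact Hz | exists (gamma w); split; [apply Hdom, Hr, Hw | exact Ew]]).
      destruct (Ttba z Dz) as [T1 T2].
      assert (Et : tba z = gamma w)
        by (apply (par_inj S a); [exact T1 | apply Hdom, Hr, Hw | rewrite T2; symmetry; exact Ew]).
      split; [exact Dz |]; rewrite Et; destruct (Hr w Hw) as [R1 R2].
      rewrite R2; split; assumption. }
    split.
    * apply (smoothC_comp _ V0 G _ tba); auto.
      -- apply (open_ext (fun z => Dba z /\ (V0 (tba z) /\ U (G (tba z)))));
           [| apply (open_preimage (fun z => V0 z /\ U (G z)) Dba tba); assumption].
         intros z; split; [| apply Key].
         intros [Hz [HV' HU']]; destruct (Ttba z Hz) as [T1 T2]; split; [apply Hz |].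
         exists (G (tba z)); rewrite Hl by assumption; split; assumption.
      -- intros z Hz; apply Key, Hz.
      -- destruct Stba as [S1 S2]; split; intros z Hz; [apply S1 | apply S2]; apply Key, Hz.
    * intros z Hz; destruct (Key z Hz) as [K1 [K2 K3]]; split; [exact K3 |].
      rewrite Hl by assumption; apply Ttba, K1.
Qed.

Lemma SS_surface_fg (S : RiemannSurface) (X N : S -> R3) :
  immersion S X -> gauss_map S X N -> nonzero_gauss_curv S X N ->
  (forall p, N p <> (RtoC 0, -1)) ->
  SS_surface S X N -> (forall p, 0 < ip3 (X p) (N p)) ->
  locally_given_by_fg S X N.
Proof.
intros HX HN HK H0 HSS Hpos p.
destruct (par_cover S p) as [a [z0 [Hz0 <-]]].
destruct (HX a) as [SX RX]; destruct (HN a) as [SN NX].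
assert (Hdom := dom_open S a).
set (Y := fun w => X (par S a w)) in *; set (M := fun w => N (par S a w)) in *.
set (G := fun w => stereo (M w)).
assert (HM1 : forall w, dom S a w -> ip3 (M w) (M w) = 1) by (intros w Hw; apply (NX w Hw)).
assert (EM : forall w, dom S a w -> M w = Nfg idC (G w))
  by (intros w Hw; apply stereo_inverse; [apply HM1, Hw | apply H0]).
assert (SG : smoothC_on (dom S a) G).
{ apply smooth_stereo; auto; intros w Hw; apply south_pole; [apply HM1, Hw | apply H0]. }
assert (HJ : jacobian G z0 <> 0).
{ apply (gauss_map_local_diffeo (dom S a) Y M z0); auto.
  - intros; apply H0.
  - apply (HK a z0 Hz0). }
destruct (inverse_function (dom S a) G z0 Hdom SG Hz0 HJ)
  as [V0 [r [gamma [OV0 [HV0 [Vz0 [Hl [Hr Sg]]]]]]]].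
set (U := Cbox (G z0) r) in *.
assert (HU : open U) by apply open_Cbox.
assert (SGV : smoothC_on V0 G) by (destruct SG as [S1 S2]; split; intros z Hz; auto).
assert (SYV : smooth3_on V0 Y) by (apply (smooth3_subset V0 (dom S a)); auto).
assert (SMV : smooth3_on V0 M) by (apply (smooth3_subset V0 (dom S a)); auto).
(* The surface in the coordinate [w = stereo N], in which the normal becomes [Nfg idC]. *)
set (Z := fun w => Y (gamma w)).
assert (SZ : smooth3_on U Z)
  by (apply (smooth3_comp U V0 Y Z gamma); auto; intros w Hw; apply Hr, Hw).
assert (EN : forall w, U w -> M (gamma w) = Nfg idC w).
{ intros w Hw; destruct (Hr w Hw) as [V1 V2]; rewrite EM, V2 by auto; reflexivity. }
assert (Hort : forall w i, U w -> ip3 (pd3 i Z w) (Nfg idC w) = 0).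
{ intros w i Hw; destruct (Hr w Hw) as [V1 V2].
  rewrite (pd3_comp U V0 Z Y gamma i w) by auto.
  unfold comb; rewrite ip3_comb_l, <- EN by exact Hw.
  destruct (NX (gamma w) (HV0 _ V1)) as [_ Hn]; rewrite !Hn; ring. }
destruct (support_representation (G z0) r Z SZ) as [f [Hf Ef]]; auto.
{ intros w Hw; rewrite <- EN by exact Hw; apply Hpos. }
{ intros w Hw; destruct (Hr w Hw) as [V1 V2].
  set (z := gamma w) in *.
  assert (HO := open_preimage U V0 G HU OV0 SGV).
  set (O := fun z => V0 z /\ U (G z)) in *.
  assert (Oz : O z) by (split; [exact V1 | rewrite V2; exact Hw]).
  assert (SGO : smoothC_on O G) by (destruct SGV as [S1 S2]; split; intros x [Hx _]; auto).
  assert (UGz : U (G z)) by (rewrite V2; exact Hw).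
  (* The sphere condition is known in the chart only. There the derivatives of [Y] and [M] have
     coefficient matrices [jac G z] times [V] and [jac G z], so [SS_frame] delivers the equation for
     [Z] at [w]. *)
  set (V := fun i k => ip3 (pd3 i Z w) (pd3 k (Nfg idC) w) / Lid w).
  assert (K := SS_frame Y M z (Lid w) (pd3 ax1 (Nfg idC) w) (pd3 ax2 (Nfg idC) w) V (jac G z)
                 (N_frame w) (RX z (HV0 z V1)) (HM1 z (HV0 z V1))).
  assert (ES : support Y M z = support Z (Nfg idC) w)
    by (unfold support; rewrite <- EN by exact Hw; reflexivity).
  rewrite ES in K; apply K; [| | apply (HSS a z (HV0 z V1))].
  - intros i; rewrite (pd3_comp O U Y Z G i z); auto.
    + rewrite V2, <- comb_mulmat.
      f_equal; apply tangent_expansion, Hort, Hw.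
    + intros x [Vx Ux]; unfold Z; rewrite Hl by assumption; reflexivity.
  - intros i; rewrite (pd3_comp O (fun _ => True) M (Nfg idC) G i z);
      auto using open_true, smooth3_N.
    + rewrite V2; reflexivity.
    + intros x [Vx _]; apply EM, HV0, Vx. }
exists U, (fun w => par S a (gamma w)), f, idC.
split; [apply (local_parametrization_comp S a V0 U G gamma); auto |].
split.
{ exists (G z0).
  assert (UG : U (G z0)) by (apply Cbox_center, cond_pos).
  split; [exact UG |]; rewrite Hl; auto. }
split; [exact Hf |]; split; [apply holomorphic_idC |].
intros w Hw; split; [rewrite C_derive_idC; apply RtoC_1_neq_0 |].
split; [exact (Ef w Hw) | exact (EN w Hw)].
Qed.

Theorem theorem3p4 :
  (forall (S : RiemannSurface) (X N : S -> R3),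
     immersion S X ->
     gauss_map S X N ->
     nonzero_gauss_curv S X N ->
     (forall p, N p <> (RtoC 0, -1)) ->
     (SS_surface S X N /\ (forall p, 0 < ip3 (X p) (N p)))
     <-> locally_given_by_fg S X N)
  /\
  (forall (U : C -> Prop) (f g : C -> C),
     open U ->
     holomorphic_on U f ->
     holomorphic_on U g ->
     (forall z, U z -> C_derive g z <> RtoC 0) ->
     forall z, U z ->
     let X := Xfg f g in
     let N := Nfg g in
     let T := Tfun g z in
     let h := hfun f z in
     let f' := C_derive f z in
     let f'' := C_derive (C_derive f) z in
     let g' := C_derive g z in
     let g'' := C_derive (C_derive g) z in
     let P := det2 (Vmat f g z) in
     let xi := (f' * (g'' / g' - RtoC (2 / T) * g' * Cconj (g z)) - f'')%C in
     let A1 := ipC 1 f' ^ 2 - ipC 1 xi in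
     let A2 := ipC 1 (Ci * f')%C ^ 2 + ipC 1 xi in
     let B := ipC Ci (xi - f' * f' / RtoC 2)%C in
     let q := Cmod g' ^ 2 in
     unit_normal_at X N z /\
     (regular_at X z <-> P <> 0) /\
     (regular_at X z -> gauss_curv X N z <> 0 /\ P = 1 / gauss_curv X N z) /\
     ip3 (pd3 ax1 X z) (pd3 ax1 X z)
       = T ^ 2 * h ^ 2 / (4 * q) * (A1 ^ 2 + B ^ 2)
         + 2 * h ^ 2 * A1 + 4 * h ^ 2 * q / T ^ 2 /\
     ip3 (pd3 ax1 X z) (pd3 ax2 X z)
       = (T ^ 2 * h ^ 2 * Cmod f' ^ 2 / (4 * q) + 2 * h ^ 2) * B /\
     ip3 (pd3 ax2 X z) (pd3 ax2 X z)
       = T ^ 2 * h ^ 2 / (4 * q) * (A2 ^ 2 + B ^ 2)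
         + 2 * h ^ 2 * A2 + 4 * h ^ 2 * q / T ^ 2 /\
     ip3 (pd3 ax1 X z) (pd3 ax1 N z) = h * A1 + 4 * h * q / T ^ 2 /\
     ip3 (pd3 ax1 X z) (pd3 ax2 N z) = h * B /\
     ip3 (pd3 ax2 X z) (pd3 ax2 N z) = h * A2 + 4 * h * q / T ^ 2).
Proof.
split.
- intros S X N HX HN HK H0; split.
  + intros [H1 H2]; apply SS_surface_fg; assumption.
  + intros H; split; [apply fg_SS_surface | apply fg_support_pos]; assumption.
- intros U f g HU Hf Hg H0 z Hz X N T h f' f'' g' g'' P xi A1 A2 B q.
  assert (HP : P = det2 (Vfg f g z)).
  { unfold P, det2; rewrite !(Vmat_Vfg U f g _ _ z HU Hf Hg Hz (H0 z Hz)); reflexivity. }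
  destruct (Xfg_gauss_curv U f g z HU Hf Hg H0 Hz) as [R1 R2].
  split; [apply (Xfg_unit_normal U); assumption |].
  split; [rewrite HP; exact R1 |].
  split.
  { intros HR; assert (HD := proj1 R1 HR); unfold X, N; rewrite (R2 HR), HP.
    split; [| field; exact HD].
    unfold Rdiv; rewrite Rmult_1_l; apply Rinv_neq_0_compat, HD. }
  assert (FF := fun i j => Xfg_fundamental_forms U f g i j z HU Hf Hg H0 Hz); cbv zeta in FF.
  assert (Hq := norm_sq_neq_0 _ (H0 z Hz)).
  assert (HT := Tr_pos (g z)).
  assert (Emu : mu_fun g z = (g'' / g' - RtoC (2 / T) * g' * Cconj (g z))%C).
  { unfold mu_fun; fold g' g''; rewrite drift_C, <- Tfun_Tr; reflexivity. }
  assert (Exi : (f' * mu_fun g z - f'')%C = xi) by (rewrite Emu; reflexivity).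
  assert (EA1 : A1 = Re f' ^ 2 - Re xi).
  { unfold A1, ipC; destruct f' as [p1 p2], xi as [x1 x2]; unfold Re; simpl; ring. }
  assert (EA2 : A2 = Im f' ^ 2 + Re xi).
  { unfold A2, ipC; destruct f' as [p1 p2], xi as [x1 x2]; unfold Re, Im; simpl; ring. }
  assert (EB : B = Im xi - Re f' * Im f').
  { unfold B, ipC; destruct f' as [p1 p2], xi as [x1 x2]; unfold Re, Im; simpl; field. }
  assert (EL : Lr (g z) g' = 4 * q / T ^ 2) by (unfold Lr, q, T; rewrite Tfun_Tr, Cmod_sq; reflexivity).
  (* The product of X_,1 and X_,2 is L V12 (V11 + V22), because V is symmetric; its factor |f'|^2
     arises as this sum. *)
  assert (Emod : Cmod f' ^ 2 = A1 + A2) by (rewrite Cmod_sq, EA1, EA2; ring).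
  assert (V11 : Vfg f g z ax1 ax1 = h * A1 / Lr (g z) g' + h)
    by (rewrite EA1, <- Exi; reflexivity).
  assert (V12 : Vfg f g z ax1 ax2 = h * B / Lr (g z) g')
    by (rewrite EB, <- Exi; reflexivity).
  assert (V21 : Vfg f g z ax2 ax1 = h * B / Lr (g z) g')
    by (rewrite EB, <- Exi; reflexivity).
  assert (V22 : Vfg f g z ax2 ax2 = h * A2 / Lr (g z) g' + h)
    by (rewrite EA2, <- Exi; reflexivity).
  assert (HT' : T <> 0) by (unfold T; rewrite Tfun_Tr; lra).
  assert (Hq' : q <> 0) by (unfold q; rewrite Cmod_sq; exact Hq).
  rewrite Emod.
  repeat split; (rewrite (proj1 (FF _ _)) || rewrite (proj2 (FF _ _)));
    fold g'; rewrite ?V11, ?V12, ?V21, ?V22, EL; field; auto.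
Qed.
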